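(* Let $\alpha\in(0,1)$. Let $K$ satisfy: $K\in L^1(\mathbb R)$ is bounded and continuous, $K\ge 0$, $K(0)>0$, and $K(x)=K(-x)$ for all $x\in\mathbb R$. Put $\kappa=\int_{\mathbb R}K(y)\,dy$ and let $u_T\in(0,\kappa)$. Let $u_0\in C^1(\mathbb R)$ satisfy $u_0'<0$ on $\mathbb R$, $u_0(0)=u_T$, $\lim_{x\to-\infty}u_0(x)=\kappa$ and $\lim_{x\to+\infty}u_0(x)=0$. Let $u$ be the front solution to the time-fractional Amari equation with initial datum $u_0$, and $x^*(t)$ its threshold location. Then $$\lim_{t\to+\infty}\ \sup_{z\in\mathbb R}\left|u(t,x^*(t)+z)-\phi(z;c^* )\right|=0,$$ where $\phi(z;c)=\int_0^{+\infty}g_\alpha(r)\mathcal K(z+cr)\,dr$ and $c^*\in\mathbb R$ is the unique solution $c$ of $u_T=\int_0^{+\infty}g_\alpha(r)\mathcal K(cr)\,dr$.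
   Context: Notation: $\mathcal K(x)=\int_x^{+\infty}K(y)\,dy$; $E_{\alpha,\beta}(z)=\sum_{n=0}^\infty \frac{z^n}{\Gamma(\alpha n+\beta)}$; $f_\alpha(t)=E_{\alpha,1}(-t^\alpha)$ for $t\ge0$ and $g_\alpha(t)=t^{\alpha-1}E_{\alpha,\alpha}(-t^\alpha)$ for $t>0$. $H$ is the Heaviside function: $H(v)=1$ for $v>0$, $H(v)=0$ for $v<0$, with $H(0)$ any fixed value in $[0,1]$. The time-fractional Amari equation is $\partial_t^\alpha u(t,x)=\int_{\mathbb R}K(x-y)H(u(t,y)-u_T)\,dy-u(t,x)$ for $t>0$, $x\in\mathbb R$, with $\partial_t^\alpha$ the Caputo derivative and initial condition $u(0,x)=u_0(x)$. It is understood in the mild sense: a mild solution is a function $u\in C([0,+\infty)\times\mathbb R)$ such that for all $t\ge0$, $x\in\mathbb R$, $$u(t,x)=f_\alpha(t)u_0(x)+\int_0^t g_\alpha(t-s)\int_{\mathbb R}K(x-y)H(u(s,y)-u_T)\,dy\,ds .$$ A front solution is a mild solution $u$ for which there exists $x^*\in C[0,+\infty)$ such that for every $t\ge0$: $u(t,x)>u_T$ for $x<x^*(t)$, $u(t,x^*(t))=u_T$, and $u(t,x)<u_T$ for $x>x^*(t)$. The function $x^*$ is called the threshold location. Under the stated hypotheses there is exactly one front solution. *)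

(* Defs.v *)
From HB Require Import structures.
From mathcomp Require Import all_boot all_order all_algebra.
From mathcomp Require Import all_classical all_reals all_analysis.

Set Implicit Arguments.
Unset Strict Implicit.
Unset Printing Implicit Defensive.

Import Order.TTheory GRing.Theory Num.Theory.
Import numFieldNormedType.Exports.

Local Open Scope classical_set_scope.
Local Open Scope ring_scope.

(* Euler's integral: meaningful for z > 0, the only case used below. *)
Definition Gamma (R : realType) (z : R) : R :=
  \int[lebesgue_measure]_(t in `]0, +oo[) (t `^ (z - 1) * expR (- t)).

Definition mittag_leffler (R : realType) (a b z : R) : R :=
  limn (series (fun n => z ^+ n / Gamma (a * n%:R + b))).

Definition ml_f (R : realType) (a t : R) : R :=
  mittag_leffler a 1 (- (t `^ a)).

(* Meaningful for t > 0; its value at t = 0 never matters below, since it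
   only appears under an integral. *)
Definition ml_g (R : realType) (a t : R) : R :=
  t `^ (a - 1) * mittag_leffler a a (- (t `^ a)).

(* h0 is the arbitrary value of the Heaviside function at 0. *)
Definition heaviside (R : realType) (h0 v : R) : R :=
  if 0 < v then 1 else if v < 0 then 0 else h0.

Definition tail_integral (R : realType) (K : R -> R) (x : R) : R :=
  \int[lebesgue_measure]_(y in `[x, +oo[) K y.

Definition front_profile (R : realType) (a : R) (K : R -> R) (z c : R) : R :=
  \int[lebesgue_measure]_(r in `]0, +oo[)
    (ml_g a r * tail_integral K (z + c * r)).

(* u t x is only constrained for t >= 0; its values at t < 0 are irrelevant. *)
Definition mild_solution (R : realType) (a : R) (K : R -> R) (h0 uT : R)
    (u0 : R -> R) (u : R -> R -> R) : Prop :=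
  {within [set p : R * R | 0 <= p.1], continuous (fun p => u p.1 p.2)} /\
  forall t x : R, 0 <= t ->
    u t x = ml_f a t * u0 x +
      \int[lebesgue_measure]_(s in `[0, t])
        (ml_g a (t - s) *
         \int[lebesgue_measure]_y (K (x - y) * heaviside h0 (u s y - uT))).

Definition threshold_location (R : realType) (uT : R) (u : R -> R -> R)
    (xs : R -> R) : Prop :=
  {within `[0, +oo[, continuous xs} /\
  forall t : R, 0 <= t ->
    [/\ forall x, x < xs t -> uT < u t x,
        u t (xs t) = uT
      & forall x, xs t < x -> u t x < uT].

Definition front_solution (R : realType) (a : R) (K : R -> R) (h0 uT : R)
    (u0 : R -> R) (u : R -> R -> R) : Prop :=
  mild_solution a K h0 uT u0 u /\ exists xs, threshold_location uT u xs.

(* Main.v *)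
Require Import Defs.
From HB Require Import structures.
From mathcomp Require Import all_boot all_order all_algebra.
From mathcomp Require Import all_classical all_reals all_analysis.
From mathcomp Require Import measurable_realfun ring lra.
Set Implicit Arguments.
Unset Strict Implicit.
Unset Printing Implicit Defensive.
Import Order.TTheory GRing.Theory Num.Theory.
Import numFieldNormedType.Exports.
Local Open Scope classical_set_scope.
Local Open Scope ring_scope.

(** Write f and g for ml_f alpha and ml_g alpha, P for the tail integral of K
    and kappa for the total mass of K.

    The kernel g is a positive probability density on the half-line, bounded
    below near 0, with tails f(t) that decrease to 0. Both functions are
    alternating series of Riemann-Liouville kernels, for which convolution
    adds the exponents; so g solves the Volterra equation g = k - g conv k,
    where k(t) = t^(alpha - 1) / Gamma(alpha), and its primitive is 1 - f.
    Positivity ([ml_sum_gt0]) follows from that equation and the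
    log-convexity of k; then 1 - f is increasing, and the equation satisfied
    by f forces f to decay ([integral_ml_sum], [ml_f_cvg0]).

    Since u(s, .) crosses uT only at xs(s), the space integral in the mild
    equation is P(x - xs(s)). Freeze the front before time 0, that is, put
    a(s) = xs(max(s, 0)), and let J_t(x) be the average of P(x - a(t - r))
    over r with the density g. The mild equation becomes
    u(t, x) = J_t(x) + f(t) (u0(x) - P(x - a(0))), so that u - J tends to 0
    uniformly in x ([mild_delayed]) and the front solves the delay equation
    J_t(a(t)) --> uT ([asymptotic_front]). Everything else concerns
    this equation: if a(t) - a(t - r) --> c r for every r > 0, then
    J_t(a(t) + z) converges uniformly in z to the profile of speed c, because
    P is bounded and Lipschitz ([profile_cvg]).

    Reflection exchanges a, uT with - a, kappa - uT; this halves the work.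

    Compactness comes first. If uT < kappa / 2, the front cannot fall far
    behind a position which it has already reached ([front_bounded_retreat]),
    nor run ahead too fast, and so for large t the points x with J_t(x) close
    to uT lie in a bounded window; if uT = kappa / 2, the front stays where it
    starts ([half_level_front]). As P decreases strictly near 0, this window
    can be shrunk step by step to an arbitrarily small length
    ([level_width_small]). Since J_t depends on t slowly, a(t + h) lies in the
    window of J_t for small h: the front is equicontinuous
    ([front_equicontinuous]).

    Next the speed. Fix h > 0 and let M be the upper limit of
    D(t) = a(t + h) - a(t). Where D is close to M, comparing the equation
    at t and at t + h forces D to be close to M on long stretches of the past
    ([increment_propagation_far]). There a(s) - (M / h) s is almost
    h-periodic, and at its maximum over a period the past of the front lies
    behind the line of slope M / h, whence uT <= w(M / h), where w(c) is the
    average of P(c r) ([increment_limsup_level]). The function w decreases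
    strictly from kappa to 0, so it takes the value uT exactly once, at cs say,
    and M <= cs h. Reflection gives the matching lower limit. *)

(** * Affine changes of variable in the Lebesgue integral *)

Section affine_change_of_variable.
Variable R : realType.
Local Notation mu := (@lebesgue_measure R).
Local Open Scope ereal_scope.

Lemma measurable_affine (c d : R) :
  measurable_fun [set: R] (fun x : R => (c * x + d)%R).
Proof.
by apply: measurable_funD => //; exact: measurable_funM.
Qed.

(** The push-forward of Lebesgue measure under the affine map, scaled by c,
    gives each interval its length, hence is Lebesgue measure. *)
Lemma ge0_integral_scale_shift (c d : R) (f : R -> \bar R) : (0 < c)%R ->
  measurable_fun [set: R] f -> (forall x, 0 <= f x) ->
  \int[mu]_x f x = c%:E * \int[mu]_x f (c * x + d)%R.
Proof.
move=> c0 mf f0.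
have mphi := measurable_affine c d.
pose phi := (fun x : R => c * x + d)%R : measurableTypeR R -> measurableTypeR R.
pose cn := NngNum (ltW c0).
have mphi' : measurable_fun [set: measurableTypeR R] phi by [].
pose nu : {measure set (measurableTypeR R) -> \bar R} :=
  mscale cn (measure_function_pushforward__canonical__measure_function_Measure mu mphi').
transitivity (\int[nu]_x f x).
  apply: eq_measure_integral => /= A mA _.
  apply: lebesgue_measure_unique => //= _ [[a b]] _ <-.
  rewrite /nu /= /mscale /= -[pushforward mu phi _]/(mu (phi @^-1` [set` `]a, b]%R])).
  have -> : phi @^-1` [set` `]a, b]%R] = [set` `](a - d) / c, (b - d) / c]%R].
    apply/seteqP; split => x /=; rewrite !in_itv/=.
      by rewrite ltr_pdivrMr// ler_pdivlMr// ltrBlDr lerBrDr mulrC.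
    by rewrite ltr_pdivrMr// ler_pdivlMr// ltrBlDr lerBrDr mulrC.
  rewrite !lebesgue_measure_itv /= !lte_fin.
  rewrite ltr_pM2r ?invr_gt0// ltrD2r.
  case: ifPn => ab; last by rewrite mule0.
  rewrite -!EFinB -EFinM; congr EFin.
  by field; rewrite gt_eqF.
rewrite /nu ge0_integral_mscale//.
congr (_ * _).
rewrite ge0_integral_pushforward//.
Qed.

Lemma ge0_integral_shift (d : R) (f : R -> \bar R) :
  measurable_fun [set: R] f -> (forall x, 0 <= f x) ->
  \int[mu]_x f (x + d)%R = \int[mu]_x f x.
Proof.
move=> mf f0; rewrite (@ge0_integral_scale_shift 1 d f ltr01 mf f0) mul1e.
by apply: eq_integral => x _; rewrite mul1r.
Qed.

Lemma ge0_integral_opp (f : R -> \bar R) :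
  measurable_fun [set: R] f -> (forall x, 0 <= f x) ->
  \int[mu]_x f (- x)%R = \int[mu]_x f x.
Proof.
move=> mf f0.
transitivity (\int[pushforward mu (-%R : _ -> measurableTypeR R)]_x f x).
  by rewrite ge0_integral_pushforward//; apply: measurable_oppr.
by apply: eq_measure_integral => //= A mA AS; exact/lebesgue_measureN.
Qed.

Lemma ge0_integral_reflect (c : R) (f : R -> \bar R) :
  measurable_fun [set: R] f -> (forall x, 0 <= f x) ->
  \int[mu]_x f (c - x)%R = \int[mu]_x f x.
Proof.
move=> mf f0; rewrite -[RHS]ge0_integral_opp//.
rewrite -[RHS](@ge0_integral_shift (- c)) //.
- by apply: eq_integral => x _; rewrite opprD opprK addrC.
- by apply: measurableT_comp.
Qed.

End affine_change_of_variable.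

(** * Euler's Gamma and Beta integrals *)

Section euler_integrals.
Variable R : realType.
Local Notation mu := (@lebesgue_measure R).
Local Open Scope ereal_scope.

(** Extended by 0 to the whole line, so that Beta integrals become
    convolutions over the line, without moving bounds. *)
Definition pow_pos (a t : R) : R := (if 0 < t then t `^ (a - 1) else 0)%R.

Lemma pow_pos_ge0 a t : (0 <= pow_pos a t)%R.
Proof. by rewrite /pow_pos; case: ifPn => // _; exact: powR_ge0. Qed.

Lemma measurable_pow_pos a : measurable_fun [set: R] (pow_pos a).
Proof.
rewrite /pow_pos; apply: measurable_fun_ifT => //.
exact: measurable_fun_ltr.
Qed.

Definition euler_gamma (a : R) : \bar R := \int[mu]_t (pow_pos a t * expR (- t))%:E.

Definition euler_beta (a b t : R) : \bar R :=
  \int[mu]_s (pow_pos a s * pow_pos b (t - s))%:E.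

Lemma GammaE a : Gamma a = fine (euler_gamma a).
Proof.
rewrite /Gamma /Rintegral /euler_gamma integral_mkcond; congr fine.
apply: eq_integral => t _; rewrite /pow_pos patchE mem_setE in_itv/= andbT.
by case: ifPn => // _; rewrite mul0r.
Qed.

Lemma measurable_gamma_integrand a :
  measurable_fun [set: R] (fun t => (pow_pos a t * expR (- t))%:E).
Proof.
apply/measurable_EFinP; apply: measurable_funM; first exact: measurable_pow_pos.
by apply: measurableT_comp.
Qed.

Lemma euler_gamma_ge0 a : 0 <= euler_gamma a.
Proof.
by apply: integral_ge0 => t _; rewrite lee_fin mulr_ge0 ?pow_pos_ge0 ?expR_ge0.
Qed.

Lemma euler_beta_ge0 a b t : 0 <= euler_beta a b t.
Proof. by apply: integral_ge0 => s _; rewrite lee_fin mulr_ge0 ?pow_pos_ge0. Qed.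

Lemma measurable_beta_integrand a b t :
  measurable_fun [set: R] (fun s => (pow_pos a s * pow_pos b (t - s))%:E).
Proof.
apply/measurable_EFinP; apply: measurable_funM; first exact: measurable_pow_pos.
apply: (measurableT_comp (measurable_pow_pos b)).
exact: measurable_funB.
Qed.

Lemma pow_pos_scale a t s : (0 < t)%R -> pow_pos a (t * s) = (t `^ (a - 1) * pow_pos a s)%R.
Proof.
move=> t0; rewrite /pow_pos pmulr_rgt0//; case: ifPn => s0; last by rewrite mulr0.
by rewrite powRM// ltW.
Qed.

Lemma euler_beta_scale a b t : (0 < t)%R ->
  euler_beta a b t = (t `^ (a + b - 1))%:E * euler_beta a b 1.
Proof.
move=> t0; rewrite /euler_beta (@ge0_integral_scale_shift _ t 0 _ t0).
- have -> : (t `^ (a + b - 1))%:E = t%:E * (t `^ (a - 1) * t `^ (b - 1))%:E.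
    rewrite -EFinM; congr EFin; rewrite -powRD; last by rewrite (gt_eqF t0) implybT.
    rewrite -{2}(powRr1 (ltW t0)) -powRD; last by rewrite (gt_eqF t0) implybT.
    by congr powR; ring.
  rewrite -muleA; congr (_ * _).
  rewrite -ge0_integralZl//.
  + apply: eq_integral => s _; rewrite addr0 -EFinM; congr EFin.
    have -> : (t - t * s = t * (1 - s))%R by ring.
    by rewrite !pow_pos_scale//; ring.
  + exact: measurable_beta_integrand.
  + by move=> s _; rewrite lee_fin mulr_ge0 ?pow_pos_ge0.
  + by rewrite lee_fin mulr_ge0 ?powR_ge0.
- exact: measurable_beta_integrand.
- by move=> s; rewrite lee_fin mulr_ge0 ?pow_pos_ge0.
Qed.

(** Tonelli applied to the integral of s^(a-1) (u-s)^(b-1) exp(-u) over s < u. *)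
Lemma euler_gamma_beta a b :
  euler_gamma a * euler_gamma b = euler_gamma (a + b) * euler_beta a b 1.
Proof.
pose F (z : R * R) := (pow_pos a z.1 * pow_pos b (z.2 - z.1) * expR (- z.2))%:E.
have mF : measurable_fun [set: R * R] F.
  apply/measurable_EFinP; apply: measurable_funM; last first.
    apply: measurableT_comp => //; apply: measurableT_comp => //.
  apply: measurable_funM.
    by apply: (measurableT_comp (measurable_pow_pos a)).
  apply: (measurableT_comp (measurable_pow_pos b)).
  exact: measurable_funB.
have F0 z : 0 <= F z by rewrite lee_fin !mulr_ge0 ?pow_pos_ge0 ?expR_ge0.
transitivity (\int[mu]_s \int[mu]_u F (s, u)).
  rewrite /euler_gamma -ge0_integralZr//; last 3 first.
  - exact: measurable_gamma_integrand.
  - by move=> s _; rewrite lee_fin mulr_ge0 ?pow_pos_ge0 ?expR_ge0.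
  - exact: euler_gamma_ge0.
  apply: eq_integral => s _.
  rewrite -ge0_integralZl//; last 3 first.
  - exact: measurable_gamma_integrand.
  - by move=> t _; rewrite lee_fin mulr_ge0 ?pow_pos_ge0 ?expR_ge0.
  - by rewrite lee_fin mulr_ge0 ?pow_pos_ge0 ?expR_ge0.
  rewrite -[RHS](@ge0_integral_shift _ s).
  - apply: eq_integral => t _; rewrite /F /= -EFinM; congr EFin.
    by rewrite opprD expRD addrK; ring.
  - by apply: measurableT_comp mF _.
  - by move=> u; exact: F0.
transitivity (\int[mu]_u \int[mu]_s F (s, u)).
  exact: (@fubini_tonelli _ _ _ _ _ mu mu F).
rewrite /euler_gamma -ge0_integralZr//; last 3 first.
- exact: measurable_gamma_integrand.
- by move=> s _; rewrite lee_fin mulr_ge0 ?pow_pos_ge0 ?expR_ge0.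
- exact: euler_beta_ge0.
apply: eq_integral => u _; rewrite /F /=.
have [u0|u0] := ltP 0%R u.
  rewrite EFinM muleAC -[pow_pos (a + b) u]/(if (0 < u)%R then _ else _) u0.
  rewrite -euler_beta_scale// /euler_beta -ge0_integralZr//.
  - exact: measurable_beta_integrand.
  - by move=> s _; rewrite lee_fin mulr_ge0 ?pow_pos_ge0.
have u0F : (0 < u)%R = false by apply/negbTE; rewrite -leNgt.
rewrite {3}/pow_pos u0F mul0r mul0e integral0_eq// => s _.
rewrite /pow_pos; case: ifPn => s0; last by rewrite !mul0r.
by rewrite ifF ?mulr0 ?mul0r//; apply/negbTE; rewrite -leNgt subr_le0 (le_trans u0) ?ltW.
Qed.

Lemma integral_powR_itv (a b x : R) : (0 < a)%R -> (0 < x)%R -> (x < b)%R ->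
  \int[mu]_(s in `[x, b]) (s `^ (a - 1))%:E = ((b `^ a - x `^ a) / a)%:E.
Proof.
move=> a0 x0 xb.
have pos s : s \in `[x, b]%R -> (0 < s)%R by rewrite in_itv/= => /andP[xs _]; exact: lt_le_trans xs.
have pw s r : (0 < s)%R -> {for s, continuous (fun t : R => t `^ r)%R}.
  move=> s0; apply: differentiable_continuous; apply/derivable1_diffP.
  by apply: derivable_powR; rewrite in_itv/= s0.
rewrite (@continuous_FTC2 _ _ (fun s => s `^ a / a)%R)//.
- by rewrite -EFinB -mulrBl.
- apply: continuous_in_subspaceT => s; rewrite inE/= => sab.
  by apply: pw; exact: pos.
- split.
  + move=> s sab; apply: derivableM => //; apply: derivable_powR.
    by rewrite in_itv/= andbT; apply: pos; apply: subset_itv_oo_cc.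
  + apply: cvg_at_right_filter; apply: cvgM; last exact: cvg_cst.
    by apply: pw.
  + apply: cvg_at_left_filter; apply: cvgM; last exact: cvg_cst.
    by apply: pw; exact: lt_trans xb.
- move=> s sab.
  have s0 : (0 < s)%R by apply: pos; apply: subset_itv_oo_cc.
  rewrite derive1E; have [] := @is_derive1_powR _ a s s0 => d1 d2.
  rewrite deriveM// derive_cst scaler0 add0r d2.
rewrite -[LHS]/(a^-1 * (a * s `^ (a - 1)))%R.
  by rewrite mulrA mulVf ?mul1r// gt_eqF.
Qed.

(** The integrand is singular at 0 when a < 1: the fundamental theorem of
    calculus is used on [1/n, 1], followed by monotone convergence. *)
Lemma euler_beta_1r a : (0 < a)%R -> euler_beta a 1 1 = (a^-1)%:E.
Proof.
move=> a0.
transitivity (\int[mu]_(s in `]0%R, 1%R]) (s `^ (a - 1))%:E).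
  rewrite -integral_itv_bndo_bndc; last first.
    by apply/measurable_EFinP; exact: measurable_funTS.
  rewrite integral_mkcond; apply: eq_integral => s _.
  rewrite patchE mem_setE in_itv/= /pow_pos subr_gt0 subrr powRr0.
  by case: ltP => s0; case: ltP => s1; rewrite ?mulr1 ?mulr0 ?mul0r.
pose F (n : nat) := [set` `[n.+2%:R^-1 : R, 1]%R].
have F01 : \bigcup_n F n = [set` `]0%R, 1%R]%R].
  apply/seteqP; split => [s [n _]|s].
    rewrite /F/= !in_itv/= => /andP[ns ->]; rewrite andbT.
    by rewrite (lt_le_trans _ ns).
  rewrite /F/= !in_itv/= => /andP[s0 s1].
  exists (Num.truncn s^-1) => //=; rewrite in_itv/= s1 andbT.
  rewrite invf_ple ?posrE//.
  apply: (le_trans (ltW (truncnS_gt s^-1)%R)).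
  by rewrite ler_nat.
have cv : \int[mu]_(s in F n) (s `^ (a - 1))%:E @[n --> \oo] -->
   \int[mu]_(s in `]0%R, 1%R]) (s `^ (a - 1))%:E.
  rewrite -F01; apply: ge0_nondecreasing_set_cvg_integral.
  - move=> m n mn; rewrite /F subsetEset; apply: subset_itvr.
    by rewrite bnd_simp lef_pV2 ?posrE// ler_nat.
  - by move=> n; exact: measurable_itv.
  - by move=> n; apply/measurable_EFinP; exact: measurable_funTS.
  - by move=> n s _; rewrite lee_fin powR_ge0.
apply: (cvg_unique _ cv) => //=.
rewrite (_ : (fun n => _) = (fun n => ((1 - n.+2%:R^-1 `^ a) / a)%:E)); last first.
  apply/funext => n; rewrite integral_powR_itv// ?powR1 ?invr_gt0 ?invf_lt1 ?ltr1n//.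
apply: cvg_EFin; first exact: nearW.
rewrite -[X in _ --> X]mul1r; apply: cvgM; last exact: cvg_cst.
rewrite -[X in _ --> X]subr0; apply: cvgB; first exact: cvg_cst.
have := @powR_cvg0 R a a0 => /cvg_at_rightP; apply; split => //.
by have := @cvg_harmonic R; rewrite -cvg_shiftS.
Qed.

Lemma pow_posE (a t : R) : (0 < t)%R -> pow_pos a t = (t `^ (a - 1))%R.
Proof. by rewrite /pow_pos => ->. Qed.

Lemma euler_gamma1 : euler_gamma 1 = 1.
Proof.
rewrite -(@integral_exponential_pdf R 1 ltr01).
rewrite /euler_gamma.
transitivity (\int[mu]_(t in `]0%R, +oo[) (expR (- t))%:E).
  rewrite [RHS]integral_mkcond; apply: eq_integral => t _.
  rewrite patchE mem_setE in_itv/= andbT /pow_pos subrr powRr0.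
  by case: ifPn; rewrite ?mul1r ?mul0r.
rewrite integral_itv_obnd_cbnd; last first.
  apply/measurable_EFinP; apply: measurable_funTS; exact: measurableT_comp.
rewrite [LHS]integral_mkcond; apply: eq_integral => t _.
rewrite patchE mem_setE in_itv/= andbT.
rewrite /exponential_pdf patchE mem_setE in_itv/= andbT mul1r mulN1r.
by case: ifPn.
Qed.

Lemma euler_gammaS (a : R) : (0 < a)%R -> euler_gamma (a + 1) = a%:E * euler_gamma a.
Proof.
move=> a0; have := euler_gamma_beta a 1.
rewrite euler_gamma1 mule1 euler_beta_1r// => ->.
by rewrite muleCA -EFinM divff ?mule1// gt_eqF.
Qed.

(** Finite at positive integers by the functional equation, then at a >= 1 since
    t^(a-1) is at most 1 + t^n, then at a > 0 by the functional equation again. *)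
Lemma euler_gamma_lty (a : R) : (0 < a)%R -> euler_gamma a < +oo.
Proof.
have nat_lty n : euler_gamma n.+1%:R < +oo.
  elim: n => [|n IH]; first by rewrite euler_gamma1 ltry.
  by rewrite -natr1 euler_gammaS// lte_mul_pinfty// lee_fin.
have ge1_lty b : (1 <= b)%R -> euler_gamma b < +oo.
  move=> b1; pose n := Num.truncn b.
  apply: (@le_lt_trans _ _ (euler_gamma 1 + euler_gamma n.+1%:R)); last first.
    by rewrite lte_add_pinfty// euler_gamma1 ltry.
  rewrite /euler_gamma -ge0_integralD//.
  - apply: ge0_le_integral => //.
    + by move=> t _; rewrite lee_fin mulr_ge0 ?pow_pos_ge0 ?expR_ge0.
    + exact: measurable_gamma_integrand.
    + by apply: emeasurable_funD; exact: measurable_gamma_integrand.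
    + move=> t _; rewrite -EFinD lee_fin -mulrDl ler_wpM2r ?expR_ge0//.
      rewrite /pow_pos; case: ifPn => t0; last by rewrite addr0.
      rewrite subrr powRr0.
      have [t1|/ltW t1] := lerP t 1.
        rewrite -[leLHS]addr0 lerD ?powR_ge0//.
        by rewrite -[leRHS](powRr0 t) ger_powR ?t0// subr_ge0.
      rewrite -[leLHS]add0r lerD// ler_powR// lerD2r.
      exact: ltW (truncnS_gt b).
  - by move=> t _; rewrite lee_fin mulr_ge0 ?pow_pos_ge0 ?expR_ge0.
  - exact: measurable_gamma_integrand.
  - by move=> t _; rewrite lee_fin mulr_ge0 ?pow_pos_ge0 ?expR_ge0.
  - exact: measurable_gamma_integrand.
move=> a0.
have : euler_gamma (a + 1) < +oo by apply: ge1_lty; rewrite lerDr ltW.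
rewrite euler_gammaS//; have := euler_gamma_ge0 a.
case: (euler_gamma a) => [r _ _|_|//]; first exact: ltry.
by rewrite gt0_muley ?lte_fin.
Qed.

Lemma euler_gammaE (a : R) : (0 < a)%R -> euler_gamma a = (Gamma a)%:E.
Proof.
move=> a0; rewrite GammaE fineK// ge0_fin_numE ?euler_gamma_ge0//.
exact: euler_gamma_lty.
Qed.

(** The contribution of [A, A+1]. With A arbitrary it shows that Gamma grows faster
    than every exponential, which is all that convergence of the Mittag-Leffler
    series needs. *)
Lemma Gamma_lb (A a : R) : (0 < A)%R -> (0 < a)%R ->
  (A `^ a * (expR (- (A + 1)) / (A + 1)) <= Gamma a)%R.
Proof.
move=> A0 a0; rewrite -lee_fin -euler_gammaE//.
have A1 : (0 < A + 1)%R by rewrite addr_gt0.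
apply: (@le_trans _ _ (\int[mu]_(t in `[A, (A + 1)%R]) (pow_pos a t * expR (- t))%:E)).
  apply: (@le_trans _ _ (\int[mu]_(t in `[A, (A + 1)%R]) (A `^ a * (expR (- (A + 1)) / (A + 1)))%:E)).
    rewrite integral_cst//= lebesgue_measure_itv/= lte_fin ltrDl ltr01.
    by rewrite -EFinB addrAC subrr add0r mule1.
  apply: ge0_le_integral => //.
  - by move=> t _; rewrite lee_fin mulr_ge0 ?divr_ge0 ?powR_ge0 ?expR_ge0// ltW.
  - by apply: measurable_funTS; exact: measurable_gamma_integrand.
  - move=> t /=; rewrite in_itv/= => /andP[At tA].
    have t0 : (0 < t)%R by apply: lt_le_trans At.
    rewrite lee_fin pow_posE// powRB; last by rewrite (gt_eqF t0) implybT.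
    rewrite powRr1 ?(ltW t0)//.
    rewrite mulrCA [leRHS]mulrC.
    apply: ler_pM; rewrite ?mulr_ge0 ?invr_ge0 ?powR_ge0 ?expR_ge0 ?(ltW A1)//.
      by rewrite ler_expR lerN2.
    apply: ler_pM; rewrite ?invr_ge0 ?powR_ge0 ?(ltW A1)//.
      by rewrite ge0_ler_powR ?nnegrE ?(ltW a0) ?(ltW A0) ?(ltW t0).
    by rewrite lef_pV2.
apply: ge0_subset_integral => //; first exact: measurable_gamma_integrand.
by move=> t _; rewrite lee_fin mulr_ge0 ?pow_pos_ge0 ?expR_ge0.
Qed.

Lemma Gamma_gt0 (a : R) : (0 < a)%R -> (0 < Gamma a)%R.
Proof.
move=> a0; apply: lt_le_trans (Gamma_lb ltr01 a0).
by rewrite mulr_gt0 ?powR_gt0// divr_gt0 ?expR_gt0// addr_gt0.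
Qed.

Lemma Gamma1 : Gamma 1 = 1%R :> R.
Proof. by rewrite GammaE euler_gamma1. Qed.

End euler_integrals.

(** * Riemann-Liouville kernels *)

(** The kernel of fractional integration of order a. Locked: otherwise unification
    compares exponents by unfolding the integrals that define Gamma. *)
HB.lock Definition rl_kernel (R : realType) (a t : R) : R := pow_pos a t / Gamma a.

Section rl_kernel_theory.
Variable R : realType.
Local Notation mu := (@lebesgue_measure R).
Local Open Scope ereal_scope.

Lemma rl_kernelE (a t : R) : (0 < t)%R -> rl_kernel a t = (t `^ (a - 1) / Gamma a)%R.
Proof. by move=> t0; rewrite unlock pow_posE. Qed.

Lemma rl_kernel_le0 (a t : R) : (t <= 0)%R -> rl_kernel a t = 0%R.
Proof. by move=> t0; rewrite unlock /pow_pos ltNge t0 mul0r. Qed.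

Lemma rl_kernel_ge0 (a t : R) : (0 < a)%R -> (0 <= rl_kernel a t)%R.
Proof. by move=> a0; rewrite unlock divr_ge0 ?pow_pos_ge0// ltW// Gamma_gt0. Qed.

Lemma measurable_rl_kernel (a : R) : measurable_fun [set: R] (rl_kernel a).
Proof. by rewrite unlock; apply: measurable_funM => //; exact: measurable_pow_pos. Qed.

Lemma measurable_rl_kernel_reflect (a t : R) : measurable_fun [set: R] (fun s => rl_kernel a (t - s)).
Proof.
apply: (measurableT_comp (measurable_rl_kernel a)).
exact: measurable_funB.
Qed.

(** Fractional integrals compose by adding orders; this is the Beta integral. *)
Lemma rl_kernel_conv (a b t : R) : (0 < a)%R -> (0 < b)%R ->
  \int[mu]_s (rl_kernel a s * rl_kernel b (t - s))%:E = (rl_kernel (a + b) t)%:E.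
Proof.
move=> a0 b0.
have Ga := Gamma_gt0 a0; have Gb := Gamma_gt0 b0.
have ab0 : (0 < a + b)%R by rewrite addr_gt0.
have Gab := Gamma_gt0 ab0.
transitivity (((Gamma a)^-1 * (Gamma b)^-1)%:E * euler_beta a b t).
  rewrite /euler_beta -ge0_integralZl//.
  - by apply: eq_integral => s _; rewrite -EFinM unlock; congr EFin; rewrite mulrACA -invfM mulrC.
  - exact: measurable_beta_integrand.
  - by move=> s _; rewrite lee_fin mulr_ge0 ?pow_pos_ge0.
  - rewrite lee_fin; apply: mulr_ge0; rewrite invr_ge0; [exact: ltW Ga|exact: ltW Gb].
have [t0|t0] := ltP 0%R t; last first.
  have -> : euler_beta a b t = 0.
    rewrite /euler_beta integral0_eq// => s _.
    rewrite /pow_pos; case: ifPn => s0; last by rewrite !mul0r.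
    by rewrite ifF ?mulr0 ?mul0r//; apply/negbTE; rewrite -leNgt subr_le0 (le_trans t0) ?ltW.
  by rewrite mule0 rl_kernel_le0.
rewrite euler_beta_scale//.
have := euler_gamma_beta a b; rewrite !euler_gammaE//.
have := euler_beta_ge0 a b 1; case: (euler_beta a b 1) => [r| |] //= _.
  rewrite -!EFinM => -[] GG; congr EFin.
  rewrite rl_kernelE//.
  have -> : r = (Gamma a * Gamma b / Gamma (a + b))%R by rewrite GG mulrC mulKf// gt_eqF.
  rewrite -invfM mulrCA mulKf//.
  exact: (mulf_neq0 (lt0r_neq0 Ga) (lt0r_neq0 Gb)).
by rewrite gt0_muley ?lte_fin.
Qed.

End rl_kernel_theory.

(** * Mittag-Leffler functions as series of Riemann-Liouville kernels *)

Section mittag_leffler_series.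
Variables (R : realType) (alpha : R).
Hypothesis alpha_gt0 : 0 < alpha.
Local Notation mu := (@lebesgue_measure R).

Lemma ml_index_gt0 (c : R) n : 0 < c -> 0 < alpha * n%:R + c.
Proof. by move=> c0; rewrite ltr_wpDl// mulr_ge0// ltW. Qed.

(** [Gamma_lb] with A chosen so that A^alpha = 2 t^alpha. *)
Lemma rl_kernel_geometric (c t : R) : 0 < c -> 0 < t ->
  exists2 C, 0 <= C & forall n, rl_kernel (alpha * n%:R + c) t <= C * 2^-1 ^+ n.
Proof.
move=> c0 t0.
pose M : R := 2 `^ alpha^-1.
have M0 : 0 < M by rewrite powR_gt0.
have Ma : M `^ alpha = 2 by rewrite /M -powRrM mulVf ?powRr1 ?gt_eqF.
pose A := t * M.
have A0 : 0 < A by rewrite mulr_gt0.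
pose L := expR (- (A + 1)) / (A + 1).
have L0 : 0 < L by rewrite divr_gt0 ?expR_gt0 ?addr_gt0.
exists ((t * L * M `^ c)^-1); first by rewrite invr_ge0 ltW// mulr_gt0 ?powR_gt0// mulr_gt0.
move=> n; set a := _ + c; have a0 : 0 < a := ml_index_gt0 n c0.
rewrite rl_kernelE// ler_pdivrMr ?Gamma_gt0//.
have -> : (t * L * M `^ c)^-1 * 2^-1 ^+ n = (t * L * M `^ a)^-1.
  rewrite /a addrC powRD; last by rewrite (gt_eqF M0) implybT.
  rewrite powRrM Ma powR_mulrn// exprVn.
  by field; rewrite ?(gt_eqF t0, gt_eqF L0, gt_eqF (powR_gt0 _ M0), expf_neq0)//.
rewrite ler_pdivlMl; last by rewrite mulr_gt0 ?powR_gt0// mulr_gt0.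
apply: le_trans (Gamma_lb A0 a0).
rewrite -/L /A powRM ?(ltW t0) ?(ltW M0)// powRB; last by rewrite (gt_eqF t0) implybT.
rewrite powRr1 ?(ltW t0)// le_eqVlt; apply/orP; left; apply/eqP.
by field; rewrite gt_eqF.
Qed.

Lemma is_cvg_rl_series (c t : R) : 0 < c ->
  cvgn (series (fun n => rl_kernel (alpha * n%:R + c) t)).
Proof.
move=> c0; have [t0|t0] := ltP 0 t.
  have [C C0 Cb] := rl_kernel_geometric c0 t0.
  apply: series_le_cvg Cb _.
  - by move=> n; rewrite rl_kernel_ge0// ml_index_gt0.
  - by move=> n; rewrite mulr_ge0// exprn_ge0// invr_ge0.
  - apply: (@is_cvg_geometric_series R C 2^-1).
    by rewrite ger0_norm ?invr_ge0// invf_lt1// ltr1n.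
rewrite (_ : (fun n => _) = (fun n => 0)); last first.
  by apply/funext => n; rewrite rl_kernel_le0.
by rewrite /series/=; under eq_fun do rewrite big1//; exact: is_cvg_cst.
Qed.

Definition ml_term (c t : R) (n : nat) : R := (-1) ^+ n * rl_kernel (alpha * n%:R + c) t.

(** For t > 0 this is t^(c-1) E_(alpha,c)(-t^alpha), so that c = alpha and c = 1 give
    ml_g and ml_f; it vanishes for t <= 0. In this form fractional integration
    acts on the index c alone. *)
Definition ml_sum (c t : R) : R := limn (series (ml_term c t)).

Lemma is_cvg_ml_sum (c t : R) : 0 < c -> cvgn (series (ml_term c t)).
Proof.
move=> c0; apply: normed_cvg.
rewrite (_ : [normed series _] = series (fun n => rl_kernel (alpha * n%:R + c) t)).
  exact: is_cvg_rl_series.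
congr series; apply/funext => n; rewrite /= /ml_term normrM normrX normrN1 expr1n mul1r.
by rewrite ger0_norm// rl_kernel_ge0// ml_index_gt0.
Qed.

Lemma ml_sum_rec (c t : R) : 0 < c -> ml_sum c t = rl_kernel c t - ml_sum (c + alpha) t.
Proof.
move=> c0; have ca0 : 0 < c + alpha by rewrite addr_gt0.
apply/cvg_lim => //; rewrite -cvg_shiftS /=.
rewrite (_ : (fun n => _) = (fun n => rl_kernel c t - series (ml_term (c + alpha) t) n)).
  by apply: cvgB; [exact: cvg_cst|exact: is_cvg_ml_sum].
apply/funext => n; rewrite /series/= big_nat_recl//.
rewrite {1}/ml_term expr0 mul1r mulr0 add0r; congr (_ + _).
rewrite -sumrN; apply: eq_bigr => i _; rewrite /ml_term exprS mulN1r mulNr.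
by congr (- (_ * rl_kernel _ _)); rewrite -natr1; ring.
Qed.

Lemma measurable_ml_sum (c : R) : 0 < c -> measurable_fun [set: R] (ml_sum c).
Proof.
move=> c0; apply: (@measurable_fun_cvg _ _ _ _ (fun n t => series (ml_term c t) n)).
- move=> n; apply: measurable_sum => k; apply: measurable_funM => //.
  exact: measurable_rl_kernel.
- by move=> t _; exact: is_cvg_ml_sum.
Qed.

Lemma integrable_rl_conv (a b t : R) : 0 < a -> 0 < b ->
  mu.-integrable [set: R] (fun s => (rl_kernel a s * rl_kernel b (t - s))%:E).
Proof.
move=> a0 b0; apply/integrableP; split.
  apply/measurable_EFinP; apply: measurable_funM; first exact: measurable_rl_kernel.
  exact: measurable_rl_kernel_reflect.
rewrite [X in (X < _)%E](_ : _ = (rl_kernel (a + b) t)%:E) ?ltry//.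
rewrite -rl_kernel_conv//; apply: eq_integral.
by move=> s _; rewrite gee0_abs// lee_fin mulr_ge0 ?rl_kernel_ge0.
Qed.

(** Termwise, by dominated convergence: the series of absolute values is itself
    integrable against the kernel. *)
Lemma ml_sum_conv (b c t : R) : 0 < b -> 0 < c ->
  mu.-integrable [set: R] (fun s => (ml_sum c s * rl_kernel b (t - s))%:E) /\
  (\int[mu]_s (ml_sum c s * rl_kernel b (t - s))%:E = (ml_sum (b + c) t)%:E)%E.
Proof.
move=> b0 c0.
have bc0 : 0 < b + c by rewrite addr_gt0.
pose h n s := rl_kernel (alpha * n%:R + c) s * rl_kernel b (t - s).
have h0 n s : 0 <= h n s by rewrite mulr_ge0 ?rl_kernel_ge0 ?ml_index_gt0.
have ih n : mu.-integrable [set: R] (fun s => (h n s)%:E).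
  by apply: integrable_rl_conv; rewrite ?ml_index_gt0.
have mh n : measurable_fun [set: R] (fun s => (h n s)%:E).
  exact: measurable_int (ih n).
pose G s := (\sum_(n <oo) (h n s)%:E)%E.
have G0 s : (0 <= G s)%E by apply: nneseries_ge0 => n _ _; rewrite lee_fin.
have mG : measurable_fun [set: R] G.
  by apply: ge0_emeasurable_sum => // n s _ _; rewrite lee_fin.
have iG : mu.-integrable [set: R] G.
  apply/integrableP; split => //.
  rewrite [X in (X < _)%E](_ : _ = (\int[mu]_s G s)%E); last first.
    by apply: eq_integral => s _; rewrite gee0_abs.
  rewrite integral_nneseries//; last by move=> n s _; rewrite lee_fin.
  rewrite (eq_eseriesr (g := fun n => (rl_kernel (alpha * n%:R + (b + c)) t)%:E)); last first.
    move=> n _; rewrite rl_kernel_conv ?ml_index_gt0//.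
    by congr (rl_kernel _ _)%:E; ring.
  have := @is_cvg_rl_series (b + c) t bc0 => /EFin_lim.
  rewrite [X in limn (_ \o X)](_ : _ = fun n => \sum_(0 <= i < n) rl_kernel (alpha * i%:R + (b + c)) t)//.
  move=> H; rewrite (_ : limn _ = limn (EFin \o (fun n => \sum_(0 <= i < n) rl_kernel (alpha * i%:R + (b + c)) t))).
    by rewrite H ltry.
  by congr (lim (_ @ \oo)); apply/funext => n /=; rewrite sumEFin.
pose f_ n s := (series (ml_term c s) n * rl_kernel b (t - s))%:E.
have f_E n s : f_ n s = (\sum_(0 <= k < n) ((-1) ^+ k)%:E * (h k s)%:E)%E.
  rewrite /f_ /series/= mulr_suml -sumEFin; apply: eq_bigr => k _.
  by rewrite -EFinM; congr EFin; rewrite /ml_term /h; ring.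
have mf_ n : measurable_fun [set: R] (f_ n).
  rewrite (_ : f_ n = fun s => \sum_(0 <= k < n) ((-1) ^+ k)%:E * (h k s)%:E)%E; last first.
    by apply/funext => s; exact: f_E.
  by apply: emeasurable_sum => k; apply: measurable_funeM.
have dc := @dominated_convergence _ _ _ mu setT measurableT f_
  (fun s => (ml_sum c s * rl_kernel b (t - s))%:E) G mf_.
have [] := dc.
- apply/measurable_EFinP; apply: measurable_funM; first exact: measurable_ml_sum.
  exact: measurable_rl_kernel_reflect.
- apply: aeW => s _; apply: cvg_EFin; first exact: nearW.
  by apply: cvgM; [exact: is_cvg_ml_sum|exact: cvg_cst].
- exact: iG.
- apply: aeW => s n _; rewrite f_E.
  apply: (@le_trans _ _ (\sum_(0 <= k < n) (h k s)%:E)%E).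
    apply: le_trans (lee_abs_sum _ _ _) _.
    apply: lee_sum => k _; rewrite abseM abse_EFin normrX normrN1 expr1n mul1e.
    by rewrite gee0_abs// lee_fin.
  by apply: nneseries_lim_ge => k _; rewrite lee_fin.
move=> int_ml _ cv; split => //.
apply/esym; apply: (cvg_unique _ _ cv) => //=.
rewrite (_ : (fun n => _) = EFin \o (fun n => series (ml_term (b + c) t) n)).
  by apply: cvg_EFin; [exact: nearW|exact: is_cvg_ml_sum].
apply/funext => n /=.
under eq_integral do rewrite f_E.
rewrite integral_sum//; last by move=> k; apply: integrableZl.
rewrite /series/= -sumEFin; apply: eq_bigr => k _.
rewrite integralZl// rl_kernel_conv ?ml_index_gt0// /ml_term -EFinM.
by congr (_ * rl_kernel _ _)%:E; ring.
Qed.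

End mittag_leffler_series.

(** * Continuity of Mittag-Leffler functions *)

Section mittag_leffler_continuity.
Variables (R : realType) (alpha : R).
Hypothesis alpha_gt0 : 0 < alpha.

(** With nonnegative coefficients, (n+1) y^n is at most (2 y)^(n+1) / y. *)
Lemma is_cvg_pseries_diffs_entire (f : R^nat) : (forall n, 0 <= f n) ->
  (forall x, cvgn (pseries f x)) -> forall x, cvgn (pseries (pseries_diffs f) x).
Proof.
move=> f0 cf x.
suff pos y : 0 < y -> cvgn (pseries (pseries_diffs f) y).
  apply: (@is_cvg_pseries_inside _ _ (`|x| + 1)); first by apply: pos; rewrite ltr_wpDl.
  by rewrite [ltRHS]ger0_norm ?ltrDl// addr_ge0.
move=> y0.
have H := cf (2 * y).
apply: (@series_le_cvg _ _ (fun n => y^-1 * (f n.+1 * (2 * y) ^+ n.+1))).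
- by move=> n; rewrite !mulr_ge0// exprn_ge0// ltW.
- by move=> n; rewrite !mulr_ge0 ?invr_ge0 ?exprn_ge0 ?mulr_ge0// ltW.
- move=> n; rewrite /pseries_diffs exprMn (exprS y).
  have -> : y^-1 * (f n.+1 * (2 ^+ n.+1 * (y * y ^+ n))) = 2 ^+ n.+1 * f n.+1 * y ^+ n.
    by field; rewrite gt_eqF.
  rewrite ler_wpM2r ?exprn_ge0 ?(ltW y0)// ler_wpM2r//.
  by rewrite -natrX ler_nat ltnW// ltn_expl.
- rewrite (_ : (fun n => _) = y^-1 *: (fun n => f n.+1 * (2 * y) ^+ n.+1)); last by apply/funext.
  apply: is_cvg_seriesZ.
  have := H; rewrite /pseries => /cvg_ex[l Hl]; apply/cvg_ex; exists (l - f 0%N).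
  rewrite -cvg_shiftS in Hl.
  rewrite (_ : series _ = fun n => series (fun i => f i * (2 * y) ^+ i) n.+1 - f 0%N).
    by apply: cvgB => //; exact: cvg_cst.
  apply/funext => n; rewrite /series/= big_nat_recl// expr0 mulr1.
  by rewrite addrAC subrr add0r.
Qed.

Lemma entire_pseries_continuous (f : R^nat) : (forall n, 0 <= f n) ->
  (forall x, cvgn (pseries f x)) -> continuous (fun x => limn (pseries f x)).
Proof.
move=> f0 cf x.
have d0 n : 0 <= pseries_diffs f n by rewrite mulr_ge0.
have cd := is_cvg_pseries_diffs_entire f0 cf.
have cdd := is_cvg_pseries_diffs_entire d0 cd.
have [] := @pseries_snd_diffs R f (`|x| + 1) x (cf _) (cd _) (cdd _) _.
  by rewrite [ltRHS]ger0_norm ?ltrDl// addr_ge0.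
by move=> /derivable1_diffP /differentiable_continuous.
Qed.

Lemma mittag_lefflerE (b : R) : mittag_leffler alpha b =
  fun z => limn (pseries (fun n => (Gamma (alpha * n%:R + b))^-1) z).
Proof.
apply/funext => z; rewrite /mittag_leffler /pseries.
by congr (lim (series _ @ \oo)); apply/funext => n; rewrite mulrC.
Qed.

Lemma powR_ml_coef (c t : R) n : 0 < c -> 0 < t ->
  t `^ (c - 1) * (t `^ alpha) ^+ n / Gamma (alpha * n%:R + c) = rl_kernel (alpha * n%:R + c) t.
Proof.
move=> c0 t0; rewrite rl_kernelE//; congr (_ / _).
rewrite -powR_mulrn ?powR_ge0// -powRrM -powRD; last by rewrite (gt_eqF t0) implybT.
by congr powR; ring.
Qed.

Lemma is_cvg_ml_pseries (b z : R) : 0 < b ->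
  cvgn (pseries (fun n => (Gamma (alpha * n%:R + b))^-1) z).
Proof.
move=> b0.
suff pos y : 0 < y -> cvgn (pseries (fun n => (Gamma (alpha * n%:R + b))^-1) y).
  apply: (@is_cvg_pseries_inside _ _ (`|z| + 1)); first by apply: pos; rewrite ltr_wpDl.
  by rewrite [ltRHS]ger0_norm ?ltrDl// addr_ge0.
move=> y0; pose t := y `^ alpha^-1.
have t0 : 0 < t by rewrite powR_gt0.
have ty : t `^ alpha = y by rewrite /t -powRrM mulVf ?powRr1 ?gt_eqF// ltW.
have tb : t `^ (b - 1) != 0 by rewrite gt_eqF// powR_gt0.
rewrite /pseries (_ : (fun i => _) = (t `^ (b - 1))^-1 *: (fun n => rl_kernel (alpha * n%:R + b) t)).
  by apply: is_cvg_seriesZ; exact: is_cvg_rl_series.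
apply/funext => n; rewrite fctE /GRing.scale/= -powR_ml_coef// ty.
by rewrite -mulrA mulKf// mulrC.
Qed.

Lemma continuous_mittag_leffler (b : R) : 0 < b -> continuous (mittag_leffler alpha b).
Proof.
move=> b0; rewrite mittag_lefflerE; apply: entire_pseries_continuous.
- by move=> n; rewrite invr_ge0 ltW// Gamma_gt0// ml_index_gt0.
- by move=> x; exact: is_cvg_ml_pseries.
Qed.

Lemma mittag_leffler0 (b : R) : 0 < b -> mittag_leffler alpha b 0 = (Gamma b)^-1.
Proof.
move=> b0; apply/cvg_lim => //; rewrite -cvg_shiftS/=.
rewrite (_ : (fun n => _) = fun=> (Gamma b)^-1); first exact: cvg_cst.
apply/funext => n; rewrite /series/= big_nat_recl// big1 ?addr0.
  by rewrite expr0 mul1r mulr0 add0r.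
by move=> i _; rewrite expr0n mul0r.
Qed.

Lemma ml_sumE (c t : R) : 0 < c -> 0 < t ->
  ml_sum alpha c t = t `^ (c - 1) * mittag_leffler alpha c (- (t `^ alpha)).
Proof.
move=> c0 t0; apply/cvg_lim => //.
rewrite (_ : series _ = fun n => t `^ (c - 1) *
   series (fun n => (- (t `^ alpha)) ^+ n / Gamma (alpha * n%:R + c)) n).
  apply: cvgM; first exact: cvg_cst.
  have := @is_cvg_ml_pseries c (- (t `^ alpha)) c0; rewrite /pseries /mittag_leffler.
  rewrite (_ : (fun i => (Gamma (alpha * i%:R + c))^-1 * _) =
     (fun n => (- (t `^ alpha)) ^+ n / Gamma (alpha * n%:R + c)))//.
  by apply/funext => n; rewrite mulrC.
apply/funext => n; rewrite /series/= mulr_sumr; apply: eq_bigr => i _.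
rewrite /ml_term -powR_ml_coef// [in RHS]exprNn.
by rewrite !mulrA [(-1) ^+ i * _]mulrC.
Qed.

Lemma continuous_powR_gt0 (r t : R) : 0 < t -> {for t, continuous (fun s : R => s `^ r)}.
Proof.
move=> t0; apply: differentiable_continuous; apply/derivable1_diffP.
by apply: derivable_powR; rewrite in_itv/= t0.
Qed.

Lemma continuous_ml_g (t : R) : 0 < t -> {for t, continuous (ml_g alpha)}.
Proof.
move=> t0; rewrite /ml_g.
apply: cvgM; first exact: continuous_powR_gt0.
apply: (@continuous_comp _ _ _ (fun s : R => - (s `^ alpha)) (mittag_leffler alpha alpha)).
  by apply: cvgN; exact: continuous_powR_gt0.
exact: continuous_mittag_leffler.
Qed.

Lemma ml_gE (t : R) : 0 < t -> ml_g alpha t = ml_sum alpha alpha t.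
Proof. by move=> t0; rewrite ml_sumE. Qed.

Lemma ml_fE (t : R) : 0 < t -> ml_f alpha t = ml_sum alpha 1 t.
Proof. by move=> t0; rewrite ml_sumE// subrr powRr0 mul1r. Qed.

Lemma ml_f0 : ml_f alpha 0 = 1.
Proof. by rewrite /ml_f powR0 ?gt_eqF// oppr0 mittag_leffler0// Gamma1 invr1. Qed.

Lemma ml_sum_le0 (c t : R) : t <= 0 -> ml_sum alpha c t = 0.
Proof.
move=> t0; apply/cvg_lim => //.
rewrite (_ : series _ = fun=> 0); first exact: cvg_cst.
apply/funext => n; rewrite /series/= big1// => i _.
by rewrite /ml_term rl_kernel_le0// mulr0.
Qed.

End mittag_leffler_continuity.

(** * The relaxation kernel is a probability density *)

Section relaxation_kernel.
Variables (R : realType) (alpha : R).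
Hypothesis alpha01 : 0 < alpha < 1.
Local Notation mu := (@lebesgue_measure R).
Local Notation k := (rl_kernel alpha).
Local Notation g := (ml_sum alpha alpha).

Let alpha_gt0 : 0 < alpha. Proof. by case/andP: alpha01. Qed.
Let alpha_lt1 : alpha < 1. Proof. by case/andP: alpha01. Qed.

(** The infimum of the closed set where phi <= 0. *)
Lemma first_nonpos (phi : R -> R) (y1 : R) : continuous phi ->
  0 < phi 0 -> 0 < y1 -> phi y1 <= 0 ->
  exists y0, [/\ 0 < y0, phi y0 <= 0 & forall y, 0 <= y < y0 -> 0 < phi y].
Proof.
move=> cphi phi0 y10 phi1.
pose S := [set y : R | 0 <= y /\ phi y <= 0].
have S1 : S y1 by split => //; exact: ltW.
have lbS : lbound S 0 by move=> y [].
have hS : has_inf S by split; [exists y1|exists 0].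
pose y0 := inf S.
have y0S y : 0 <= y < y0 -> 0 < phi y.
  move=> /andP[y0' yy]; rewrite ltNge; apply/negP => py.
  by have := ge_inf (ex_intro _ 0 lbS) (conj y0' py : S y); rewrite leNgt yy.
have y0ge : 0 <= y0 by apply: lb_le_inf => //; exists y1.
have py0 : phi y0 <= 0.
  rewrite leNgt; apply/negP => p0.
  have := cphi y0 => /cvgrPdist_lt /(_ _ p0)[/= e e0 He].
  have [z [z0 pz] zlt] := @inf_adherent _ S e e0 hS.
  have zge : y0 <= z by apply: ge_inf => //; exists 0.
  have : `|phi y0 - phi z| < phi y0.
    by apply: He; rewrite /= ler0_norm ?subr_le0// opprB ltrBlDl.
  by rewrite real_lter_norml ?num_real// => /andP[_]; rewrite ltrBlDl ltrDr ltNge pz.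
exists y0; split => //.
rewrite lt_neqAle y0ge andbT; apply/eqP => y00.
by move: py0; rewrite -y00 leNgt phi0.
Qed.

Lemma rl_kernel_gt0 (a t : R) : 0 < a -> 0 < t -> 0 < rl_kernel a t.
Proof. by move=> a0 t0; rewrite rl_kernelE// divr_gt0 ?powR_gt0 ?Gamma_gt0. Qed.

Lemma rl_kernel1 (t : R) : 0 < t -> rl_kernel 1 t = 1.
Proof. by move=> t0; rewrite rl_kernelE// subrr powRr0 Gamma1 divr1. Qed.

(** Log-convexity of t^(alpha-1): the ratio k(x - s) / k(x) decreases in x. *)
Lemma rl_kernel_log_convex (s t tau : R) : 0 < s -> s < tau -> tau < t ->
  k (t - s) * k tau <= k t * k (tau - s).
Proof.
move=> s0 st tt.
have t0 : 0 < t by apply: lt_trans tt; apply: lt_trans st.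
have tau0 : 0 < tau by apply: lt_trans st.
have ts : 0 < t - s by rewrite subr_gt0 (lt_trans st).
have taus : 0 < tau - s by rewrite subr_gt0.
rewrite !rl_kernelE// !mulrA.
rewrite ler_pM2r ?invr_gt0 ?Gamma_gt0//.
rewrite [leLHS]mulrAC [leRHS]mulrAC ler_pM2r ?invr_gt0 ?Gamma_gt0//.
rewrite -!powRM ?(ltW t0) ?(ltW tau0) ?(ltW ts) ?(ltW taus)//.
have prod0 : 0 < t * (tau - s) by rewrite mulr_gt0.
have prod1 : 0 < (t - s) * tau by rewrite mulr_gt0.
rewrite -(opprK (alpha - 1)) opprB !powRN lef_pV2 ?posrE ?powR_gt0 ?mulr_gt0//.
by rewrite ge0_ler_powR ?nnegrE ?(ltW prod0) ?(ltW prod1) ?subr_ge0 ?(ltW alpha_lt1)//; nra.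
Qed.

Lemma integral_rl_shift (b d t : R) : 0 < b ->
  (mu.-integrable [set: R] (fun s => (rl_kernel 1 (s - d) * rl_kernel b (t - s))%:E) /\
  \int[mu]_s (rl_kernel 1 (s - d) * rl_kernel b (t - s))%:E = (rl_kernel (1 + b) (t - d))%:E)%E.
Proof.
move=> b0.
have m1 : measurable_fun [set: R] (fun s => (rl_kernel 1 (s - d) * rl_kernel b (t - s))%:E).
  apply/measurable_EFinP; apply: measurable_funM; last exact: measurable_rl_kernel_reflect.
  apply: (measurableT_comp (measurable_rl_kernel 1)); exact: measurable_funB.
have p1 s : (0 <= (rl_kernel 1 (s - d) * rl_kernel b (t - s))%:E)%E.
  by rewrite lee_fin mulr_ge0 ?rl_kernel_ge0.
have E : (\int[mu]_s (rl_kernel 1 (s - d) * rl_kernel b (t - s))%:E = (rl_kernel (1 + b) (t - d))%:E)%E.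
  rewrite -(@ge0_integral_shift R d)// -rl_kernel_conv//.
  by apply: eq_integral => s _; rewrite addrK opprD addrA addrAC.
split => //; apply/integrableP; split => //.
rewrite [X in (X < _)%E](_ : _ = (rl_kernel (1 + b) (t - d))%:E) ?ltry//.
by rewrite -E; apply: eq_integral => s _; rewrite gee0_abs.
Qed.

(** The Volterra equation of g. *)
Lemma conv_g (t : R) : mu.-integrable [set: R] (fun s => (g s * k (t - s))%:E) /\
  (\int[mu]_s (g s * k (t - s))%:E = (k t - g t)%:E)%E.
Proof.
have [i E] := @ml_sum_conv R alpha alpha_gt0 alpha alpha t alpha_gt0 alpha_gt0; split => //.
by rewrite E; congr EFin; rewrite (@ml_sum_rec _ alpha alpha_gt0 alpha)//; ring.
Qed.

Lemma rl_kernel_small (b e : R) : 1 < b -> 0 < e -> exists2 d, 0 < d & rl_kernel b d < e.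
Proof.
move=> b1 e0; have b0 : 0 < b by apply: lt_trans b1.
pose E := e * Gamma b / 2.
have E0 : 0 < E by rewrite divr_gt0// mulr_gt0// Gamma_gt0.
have b10 : 0 < b - 1 by rewrite subr_gt0.
exists (E `^ (b - 1)^-1); first by rewrite powR_gt0.
rewrite rl_kernelE ?powR_gt0// -powRrM mulVf ?gt_eqF// powRr1 ?(ltW E0)//.
rewrite ltr_pdivrMr ?Gamma_gt0// /E.
by rewrite ltr_pdivrMr// ltr_pMr ?mulr_gt0 ?Gamma_gt0// ltr1n.
Qed.

(** Suppose that g vanishes first at t0, and let tau be a maximum point of g on a
    short interval [t0 - eta, t0], so that tau < t0. In the Volterra equation at
    t0, log-convexity bounds k(t0 - s) by c k(tau - s), with c = k(t0) / k(tau),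
    for s < tau, and g(s) by g(tau) for the remaining s. Comparison with the
    equation at tau leaves c g(tau) <= g(tau) k_(1+alpha)(2 eta), which is absurd
    for small eta, as c stays away from 0. *)
Lemma ml_sum_gt0 (t : R) : 0 < t -> 0 < g t.
Proof.
move=> t_gt0; rewrite ltNge; apply/negP => gt_le0.
pose phi y := mittag_leffler alpha alpha (- y).
have gphi s : 0 < s -> g s = s `^ (alpha - 1) * phi (s `^ alpha).
  by move=> s0; rewrite ml_sumE.
have cphi : continuous phi.
  by move=> y; apply: continuous_comp; [exact: opp_continuous|exact: continuous_mittag_leffler].
have sgn s : 0 < s -> (0 < g s) = (0 < phi (s `^ alpha)).
  by move=> s0; rewrite gphi// pmulr_rgt0// powR_gt0.
have [|||y0 [y0_gt0 py0 pos]] := @first_nonpos phi (t `^ alpha) cphi.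
- by rewrite /phi oppr0 mittag_leffler0// invr_gt0 Gamma_gt0.
- by rewrite powR_gt0.
- by rewrite leNgt -sgn// -leNgt.
pose t0 := y0 `^ alpha^-1.
have t0_gt0 : 0 < t0 by rewrite powR_gt0.
have t0y : t0 `^ alpha = y0 by rewrite -powRrM mulVf ?powRr1 ?gt_eqF// ltW.
have g0 : g t0 <= 0 by rewrite leNgt sgn// t0y -leNgt.
have gpos s : 0 < s < t0 -> 0 < g s.
  move=> /andP[s0 st0]; rewrite sgn//; apply: pos; rewrite powR_ge0/= -t0y.
  by rewrite gt0_ltr_powR ?nnegrE ?(ltW s0) ?(ltW t0_gt0).
have a1 : 1 < 1 + alpha by rewrite ltrDl.
(* 2^-1 is a lower bound of c = k(t0) / k(tau), since tau >= t0 / 2. *)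
have [d d0 dsmall] := @rl_kernel_small (1 + alpha) 2^-1 a1 ltac:(by rewrite invr_gt0).
pose eta := Num.min (d / 2) (t0 / 4).
have eta0 : 0 < eta by rewrite lt_min !divr_gt0.
have eta_d : 2 * eta <= d.
  have : eta <= d / 2 by rewrite ge_min lexx.
  by move=> H; lra.
have eta_t : eta <= t0 / 4 by rewrite ge_min lexx orbT.
have kap : rl_kernel (1 + alpha) (2 * eta) < 2^-1.
  apply: le_lt_trans dsmall; rewrite !rl_kernelE ?mulr_gt0//.
  rewrite ler_pM2r ?invr_gt0 ?Gamma_gt0 ?addr_gt0//.
  by rewrite ge0_ler_powR ?nnegrE ?mulr_ge0 ?(ltW eta0) ?(ltW d0)// addrAC subrr add0r ltW.
have [tau tauI taumax0] : exists2 c, c \in `[t0 - eta, t0] &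
    forall s, s \in `[t0 - eta, t0] -> ml_g alpha s <= ml_g alpha c.
  apply: EVT_max; first by rewrite gerBl ltW.
  apply: continuous_in_subspaceT => s; rewrite inE/= in_itv/= => /andP[s1 _].
  by apply: continuous_ml_g => //; apply: lt_le_trans s1; lra.
have itv_gt0 s : s \in `[t0 - eta, t0] -> 0 < s by rewrite in_itv/=; lra.
have taumax s : s \in `[t0 - eta, t0] -> g s <= g tau.
  by move=> sI; have := taumax0 s sI; rewrite !ml_gE// ?itv_gt0.
move: tauI.
rewrite in_itv/= => /andP[tau1 tau2].
have mid : 0 < g (t0 - eta) by apply: gpos; apply/andP; split; lra.
have gtau : 0 < g tau.
  by apply: lt_le_trans mid (taumax _ _); rewrite in_itv/= lexx gerBl ltW.
have tau_lt : tau < t0.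
  by rewrite lt_neqAle tau2 andbT; apply/eqP => E; move: gtau; rewrite E ltNge g0.
have tau0 : 0 < tau by lra.
have ktau := rl_kernel_gt0 alpha_gt0 tau0.
have kt0 := rl_kernel_gt0 alpha_gt0 t0_gt0.
have [i1 E1] := conv_g t0.
have [i2 E2] := conv_g tau.
(* The factor rl_kernel 1 (s - (t0 - 2 eta)) is the indicator of s > t0 - 2 eta; it
   localizes the part of the integral that the equation at tau does not control. *)
have [i3 E3] := @integral_rl_shift alpha (t0 - 2 * eta) t0 alpha_gt0.
have subE : t0 - (t0 - 2 * eta) = 2 * eta by ring.
rewrite subE in E3.
pose c := k t0 / k tau.
have c0 : 0 < c by rewrite divr_gt0.
have : ((k t0 - g t0)%:E <= (c * (k tau - g tau) + g tau * rl_kernel (1 + alpha) (2 * eta))%:E)%E.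
  rewrite -E1 EFinD (EFinM c) (EFinM (g tau)) -E2 -E3 -integralZl// -integralZl// -integralD//; last 2 first.
    exact: integrableZl.
    exact: integrableZl.
  apply: le_integral => //.
    by apply: integrableD => //; exact: integrableZl.
  move=> s _; rewrite -!EFinM -EFinD lee_fin.
  have P3 : 0 <= g tau * (rl_kernel 1 (s - (t0 - 2 * eta)) * k (t0 - s)).
    by apply: mulr_ge0; [exact: ltW|apply: mulr_ge0; exact: rl_kernel_ge0].
  have [s0|s0] := lerP s 0.
    by rewrite (@ml_sum_le0 _ alpha alpha s)// !mul0r mulr0 add0r.
  have [st|st] := ltrP s tau.
    apply: (@le_trans _ _ (c * (g s * k (tau - s)))); last by rewrite lerDl.
    have -> : c * (g s * k (tau - s)) = g s * (c * k (tau - s)) by rewrite mulrCA.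
    apply: ler_wpM2l; first by apply/ltW/gpos; rewrite s0 (lt_trans st).
    have -> : c * k (tau - s) = k t0 * k (tau - s) / k tau by rewrite /c mulrAC.
    by rewrite ler_pdivlMr// rl_kernel_log_convex.
  rewrite (@rl_kernel_le0 R alpha (tau - s)) ?subr_le0// !mulr0 add0r.
  rewrite rl_kernel1; last by rewrite subr_gt0; lra.
  rewrite mul1r.
  have [st0|st0] := lerP s t0; last by rewrite rl_kernel_le0 ?mulr0// subr_le0 ltW.
  rewrite ler_wpM2r ?rl_kernel_ge0//; apply: taumax; rewrite in_itv/= st0 andbT.
  by rewrite (le_trans tau1).
rewrite lee_fin => H.
have ck : c * k tau = k t0 by rewrite /c divfK// gt_eqF.
have : c * g tau <= g tau * rl_kernel (1 + alpha) (2 * eta).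
  by rewrite mulrBr ck in H; lra.
rewrite mulrC ler_pM2l// => H1.
have : 2^-1 <= c.
  rewrite /c !rl_kernelE//.
  have -> : t0 `^ (alpha - 1) / Gamma alpha / (tau `^ (alpha - 1) / Gamma alpha) = (tau / t0) `^ (1 - alpha).
    rewrite powRM ?invr_ge0 ?(ltW tau0) ?(ltW t0_gt0)//.
    have -> : t0^-1 `^ (1 - alpha) = t0 `^ (alpha - 1).
      by rewrite -(powR_inv1 (ltW t0_gt0)) -powRrM; congr powR; ring.
    have -> : tau `^ (1 - alpha) = (tau `^ (alpha - 1))^-1.
      by rewrite -powRN; congr powR; ring.
    have frac (x y G : R) : G != 0 -> y != 0 -> x / G / (y / G) = y^-1 * x.
      by move=> G0 yn0; field; rewrite G0 yn0.
    by apply: frac; rewrite gt_eqF ?Gamma_gt0 ?powR_gt0.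
  have q1 : tau / t0 <= 1 by rewrite ler_pdivrMr// mul1r.
  have q0 : 0 < tau / t0 by rewrite divr_gt0.
  apply: (@le_trans _ _ (tau / t0)).
    by rewrite ler_pdivlMr//; lra.
  rewrite ger1_powR ?q0 ?q1//; lra.
by move=> H2; have := lt_le_trans kap (le_trans H2 H1); rewrite ltxx.
Qed.

Local Notation f := (ml_sum alpha 1).

Lemma ml_sum_ge0 (t : R) : 0 <= g t.
Proof.
have [t0|t0] := ltP 0 t; first exact/ltW/ml_sum_gt0.
by rewrite ml_sum_le0.
Qed.

Lemma rl_kernel_large (e : R) : 0 < e -> exists2 r, 0 < r & k r <= e.
Proof.
move=> e0.
pose E := e * Gamma alpha.
have E0 : 0 < E by rewrite mulr_gt0// Gamma_gt0.
exists (E `^ (alpha - 1)^-1); first by rewrite powR_gt0.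
rewrite rl_kernelE ?powR_gt0// -powRrM mulVf ?powRr1 ?(ltW E0)//; last first.
  by rewrite subr_eq0 lt_eqF.
by rewrite /E mulfK// gt_eqF// Gamma_gt0.
Qed.

(** The Volterra equation of f. *)
Lemma conv_f (t : R) : 0 < t -> mu.-integrable [set: R] (fun s => (f s * k (t - s))%:E) /\
  (\int[mu]_s (f s * k (t - s))%:E = (1 - f t)%:E)%E.
Proof.
move=> t0; have [i E] := @ml_sum_conv R alpha alpha_gt0 alpha 1 t alpha_gt0 ltr01; split => //.
rewrite E; congr EFin; rewrite addrC (@ml_sum_rec _ alpha alpha_gt0 1)// rl_kernel1//.
by rewrite subKr.
Qed.

(** The factor rl_kernel 1 (t - s) is the indicator of s < t. *)
Lemma primitive_g (t : R) : 0 < t -> mu.-integrable [set: R] (fun s => (g s * rl_kernel 1 (t - s))%:E) /\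
  (\int[mu]_s (g s * rl_kernel 1 (t - s))%:E = (1 - f t)%:E)%E.
Proof.
move=> t0; have [i E] := @ml_sum_conv R alpha alpha_gt0 1 alpha t ltr01 alpha_gt0; split => //.
rewrite E; congr EFin; rewrite (@ml_sum_rec _ alpha alpha_gt0 1)// rl_kernel1//.
by rewrite subKr.
Qed.

Lemma rl_kernel1_nd (s t : R) : s <= t -> rl_kernel 1 s <= rl_kernel 1 t.
Proof.
move=> st; have [s0|s0] := ltP 0 s.
  by rewrite !rl_kernel1// (lt_le_trans s0).
by rewrite rl_kernel_le0// rl_kernel_ge0.
Qed.

Lemma ml_sum1_ni (s t : R) : 0 < s -> s <= t -> f t <= f s.
Proof.
move=> s0 st; have t0 := lt_le_trans s0 st.
have [i1 E1] := primitive_g s0; have [i2 E2] := primitive_g t0.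
suff : ((1 - f s)%:E <= (1 - f t)%:E)%E by rewrite lee_fin lerD2l lerN2.
rewrite -E1 -E2; apply: le_integral => // r _; rewrite lee_fin.
by apply: ler_wpM2l; [exact: ml_sum_ge0|apply: rl_kernel1_nd; rewrite lerD2r].
Qed.

Lemma ml_sum1_le1 (t : R) : 0 < t -> f t <= 1.
Proof.
move=> t0; have [i1 E1] := primitive_g t0.
rewrite -subr_ge0 -lee_fin -E1; apply: integral_ge0 => s _.
by rewrite lee_fin; apply: mulr_ge0; [exact: ml_sum_ge0|exact: rl_kernel_ge0].
Qed.

Lemma rl_kernel_ni (s t : R) : 0 < s -> s <= t -> k t <= k s.
Proof.
move=> s0 st; have t0 := lt_le_trans s0 st.
rewrite !rl_kernelE// ler_pM2r ?invr_gt0 ?Gamma_gt0//.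
rewrite -(opprK (alpha - 1)) opprB !powRN lef_pV2 ?posrE ?powR_gt0//.
by rewrite ge0_ler_powR ?nnegrE ?(ltW s0) ?(ltW t0) ?subr_ge0 ?(ltW alpha_lt1).
Qed.

(** If f(t1) < 0 then f <= f(t1) < 0 beyond t1, since f is nonincreasing. In the Volterra
    equation at t1 + r only [0, t1] contributes positively, at most (t1 + 1) k(r); for
    large r this is at most 1, while the left-hand side 1 - f(t1 + r) exceeds 1. *)
Lemma ml_sum1_ge0 (t : R) : 0 < t -> 0 <= f t.
Proof.
move=> t1_gt0; set t1 := t in t1_gt0 *; rewrite leNgt; apply/negP => ft1.
pose C := rl_kernel 2 (t1 + 1).
have t1p : 0 < t1 + 1 by rewrite addr_gt0.
have C0 : 0 < C by exact: rl_kernel_gt0.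
have [r r0 kr] := @rl_kernel_large C^-1 ltac:(by rewrite invr_gt0).
have tr0 : 0 < t1 + r by rewrite addr_gt0.
have [i E] := conv_f tr0.
have i2 := @integrable_rl_conv R 1 1 (t1 + 1) ltr01 ltr01.
have E2 := @rl_kernel_conv R 1 1 (t1 + 1) ltr01 ltr01.
have : ((1 - f (t1 + r))%:E <= (k r * C)%:E)%E.
  rewrite -E EFinM /C -[2]/(1 + 1) -E2 -integralZl//.
  apply: le_integral => //; first exact: integrableZl.
  move=> s _; rewrite -EFinM lee_fin.
  have P3 : 0 <= k r * (rl_kernel 1 s * rl_kernel 1 (t1 + 1 - s)).
    by apply: mulr_ge0; [exact: rl_kernel_ge0|apply: mulr_ge0; exact: rl_kernel_ge0].
  have [s0|s0] := lerP s 0; first by rewrite (@ml_sum_le0 _ alpha 1 s)// mul0r.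
  have [st|st] := ltrP t1 s.
    apply: le_trans P3; apply: mulr_le0_ge0; last exact: rl_kernel_ge0.
    apply: le_trans (ltW ft1); apply: ml_sum1_ni => //; exact: ltW.
  rewrite !rl_kernel1 ?mulr1//; last by lra.
  apply: (@le_trans _ _ (1 * k (t1 + r - s))).
    by apply: ler_wpM2r; [exact: rl_kernel_ge0|exact: ml_sum1_le1].
  by rewrite mul1r; apply: rl_kernel_ni => //; lra.
have f1 : f (t1 + r) <= f t1 by apply: ml_sum1_ni => //; lra.
have kC : k r * C <= 1 by rewrite -ler_pdivlMr// mul1r.
rewrite lee_fin => H.
by move: ft1 f1 kC H; clear; lra.
Qed.

(** As f is nonincreasing, its convolution with k is at least f(t) times the integral
    of k over [0, t], and it equals 1 - f(t) <= 1. *)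
Lemma ml_sum1_decay (t : R) : 0 < t -> f t * rl_kernel (1 + alpha) t <= 1.
Proof.
move=> t0; have [i E] := conv_f t0.
have E2 := @rl_kernel_conv R 1 alpha t ltr01 alpha_gt0.
have i2 := @integrable_rl_conv R 1 alpha t ltr01 alpha_gt0.
apply: (@le_trans _ _ (1 - f t)); last by rewrite gerBl ml_sum1_ge0.
rewrite -lee_fin -E EFinM -E2 -integralZl//.
apply: le_integral => //; first exact: integrableZl.
move=> s _; rewrite -EFinM lee_fin.
have [s0|s0] := lerP s 0; first by rewrite (@ml_sum_le0 _ alpha 1 s)// (@rl_kernel_le0 R 1 s)// !mul0r mulr0.
rewrite rl_kernel1// mul1r.
have [st|st] := ltrP t s; first by rewrite (@rl_kernel_le0 R alpha)// ?mulr0// subr_le0 ltW.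
by apply: ler_wpM2r; [exact: rl_kernel_ge0|exact: ml_sum1_ni].
Qed.

Lemma ml_sum1_cvg0 (e : R) : 0 < e -> exists2 T, 0 < T & forall t, T <= t -> f t <= e.
Proof.
move=> e0; pose E := e^-1 * Gamma (1 + alpha).
have a1 : 0 < 1 + alpha by rewrite addr_gt0.
have E0 : 0 < E by rewrite mulr_gt0 ?invr_gt0// Gamma_gt0.
have T0 : 0 < E `^ alpha^-1 by rewrite powR_gt0.
exists (E `^ alpha^-1) => // t Tt.
apply: le_trans (ml_sum1_ni T0 Tt) _.
have := ml_sum1_decay T0.
rewrite rl_kernelE// addrAC subrr add0r -powRrM mulVf ?gt_eqF// powRr1 ?(ltW E0)//.
by rewrite /E mulfK ?gt_eqF ?Gamma_gt0// ler_pdivrMr// mul1r.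
Qed.

Lemma integral_ml_sum : (\int[mu]_s (g s)%:E = 1)%E.
Proof.
pose h (n : nat) s := (g s * rl_kernel 1 (n.+1%:R - s))%:E.
have mg : measurable_fun [set: R] (fun s => (g s)%:E).
  by apply/measurable_EFinP; exact: measurable_ml_sum.
have cv : (\int[mu]_s h n s)%E @[n --> \oo] --> (\int[mu]_s (g s)%:E)%E.
  rewrite (_ : (\int[mu]_s (g s)%:E)%E = (\int[mu]_s limn (h ^~ s))%E).
    apply: cvg_monotone_convergence => //.
    - move=> n; apply/measurable_EFinP; apply: measurable_funM; first exact: measurable_ml_sum.
      exact: measurable_rl_kernel_reflect.
    - move=> n s _; rewrite lee_fin; apply: mulr_ge0; [exact: ml_sum_ge0|exact: rl_kernel_ge0].
    - move=> s _ m n mn; rewrite lee_fin; apply: ler_wpM2l; first exact: ml_sum_ge0.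
      by apply: rl_kernel1_nd; rewrite lerD2r ler_nat.
  apply: eq_integral => s _; apply/esym/cvg_lim => //.
  apply: cvg_near_cst; near=> n; rewrite /h rl_kernel1 ?mulr1//.
  rewrite subr_gt0; near: n; exists (Num.truncn s) => // n /= sn.
  by rewrite (lt_le_trans (truncnS_gt s))// ler_nat ltnS.
apply/esym; apply: (cvg_unique _ _ cv) => //=.
rewrite (_ : (fun n => _) = (fun n => (1 - f n.+1%:R)%:E)); last first.
  by apply/funext => n; have [_ ->] := @primitive_g n.+1%:R ltac:(by []).
apply: cvg_EFin; first exact: nearW.
rewrite -[X in _ --> X]subr0; apply: cvgB; first exact: cvg_cst.
apply/cvgrPdist_le => e e0.
have [T T0 HT] := ml_sum1_cvg0 e0.
exists (Num.truncn T) => // n /= Tn.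
rewrite sub0r normrN ger0_norm ?ml_sum1_ge0//; apply: HT.
by rewrite (le_trans (ltW (truncnS_gt T)))// ler_nat ltnS.
Unshelve. all: by end_near. Qed.

Lemma integral_ml_sum_tail (t : R) : 0 < t ->
  (\int[mu]_(s in `[t, +oo[) (g s)%:E = (f t)%:E)%E.
Proof.
move=> t0; have [i E] := primitive_g t0.
have mg : measurable_fun [set: R] (fun s => (g s)%:E).
  by apply/measurable_EFinP; exact: measurable_ml_sum.
have ig : mu.-integrable [set: R] (fun s => (g s)%:E).
  apply/integrableP; split => //.
  rewrite [X in (X < _)%E](_ : _ = 1%E) ?ltry// -integral_ml_sum.
  by apply: eq_integral => s _; rewrite gee0_abs// lee_fin ml_sum_ge0.
rewrite integral_mkcond.
transitivity (\int[mu]_s ((g s)%:E - (g s * rl_kernel 1 (t - s))%:E))%E.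
  apply: eq_integral => s _; rewrite patchE mem_setE in_itv/= andbT -EFinB.
  case: ifPn => ts; first by rewrite rl_kernel_le0 ?mulr0 ?subr0// subr_le0.
  by rewrite rl_kernel1 ?mulr1 ?subrr// subr_gt0 ltNge.
by rewrite integralB// integral_ml_sum E -EFinB subKr.
Qed.

Lemma ml_f_cvg0 : ml_f alpha t @[t --> +oo] --> (0 : R).
Proof.
apply/cvgrPdist_le => e e0; have [T T0 HT] := ml_sum1_cvg0 e0.
near=> t.
have Tt : T <= t by near: t; apply: nbhs_pinfty_ge; exact: num_real.
have t0 := lt_le_trans T0 Tt.
by rewrite sub0r normrN ml_fE// ger0_norm ?ml_sum1_ge0// HT.
Unshelve. all: by end_near. Qed.

(** g(t) = t^(alpha-1) phi(t^alpha), with phi continuous and positive on the compact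
    interval [0, r^alpha]. *)
Lemma ml_sum_lb (r : R) : 0 < r -> exists2 c, 0 < c & forall t, 0 < t <= r -> c <= g t.
Proof.
move=> r0.
pose phi y := mittag_leffler alpha alpha (- y).
have cphi : continuous phi.
  by move=> y; apply: continuous_comp; [exact: opp_continuous|exact: continuous_mittag_leffler].
have gphi s : 0 < s -> g s = s `^ (alpha - 1) * phi (s `^ alpha).
  by move=> s0; rewrite ml_sumE.
have ppos y : 0 <= y -> 0 < phi y.
  rewrite le_eqVlt => /predU1P[<-|y0].
    by rewrite /phi oppr0 mittag_leffler0// invr_gt0 Gamma_gt0.
  have s0 : 0 < y `^ alpha^-1 by rewrite powR_gt0.
  have yE : (y `^ alpha^-1) `^ alpha = y.
    by rewrite -powRrM mulVf ?gt_eqF// powRr1 ?(ltW y0).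
  have := ml_sum_gt0 s0; rewrite gphi// yE.
  by rewrite pmulr_rgt0// powR_gt0.
have [y + ymin] : exists2 c, c \in `[0, r `^ alpha] & forall y, y \in `[0, r `^ alpha] -> phi c <= phi y.
  by apply: EVT_min; [exact: powR_ge0|exact: continuous_subspaceT].
rewrite in_itv/= => /andP[y0 _].
exists (r `^ (alpha - 1) * phi y); first by rewrite mulr_gt0 ?powR_gt0 ?ppos.
move=> t /andP[t0 tr]; rewrite gphi//; apply: ler_pM.
- exact: powR_ge0.
- exact/ltW/ppos.
- rewrite -(opprK (alpha - 1)) opprB !powRN lef_pV2 ?posrE ?powR_gt0//.
  by rewrite ge0_ler_powR ?nnegrE ?(ltW r0) ?(ltW t0) ?subr_ge0 ?(ltW alpha_lt1).
- apply: ymin; rewrite in_itv/= powR_ge0/=.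
  by rewrite ge0_ler_powR ?nnegrE ?(ltW r0) ?(ltW t0) ?(ltW alpha_gt0).
Qed.

Lemma ml_sum1_gt0 (t : R) : 0 < t -> 0 < f t.
Proof.
move=> t0; have t10 : 0 < t + 1 by rewrite addr_gt0.
have [c c0 clb] := ml_sum_lb t10.
apply: (lt_le_trans c0); rewrite -lee_fin -integral_ml_sum_tail//.
apply: (@le_trans _ _ (\int[mu]_(s in `[t, (t + 1)%R]) c%:E)%E).
  rewrite integral_cst//= lebesgue_measure_itv/= lte_fin ltrDl ltr01.
  by rewrite -EFinB addrAC subrr add0r mule1.
have mg : measurable_fun [set: R] (fun s => (g s)%:E).
  by apply/measurable_EFinP; exact: measurable_ml_sum.
apply: (@le_trans _ _ (\int[mu]_(s in `[t, (t + 1)%R]) (g s)%:E)%E).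
  apply: ge0_le_integral => //.
  - by move=> s _; rewrite lee_fin ltW.
  - exact: measurable_funTS.
  - move=> s /=; rewrite in_itv/= => /andP[s1 s2]; rewrite lee_fin clb// s2 andbT.
    exact: lt_le_trans s1.
apply: ge0_subset_integral => //.
- exact: measurable_funTS.
- by move=> s _; rewrite lee_fin ml_sum_ge0.
- by move=> s /=; rewrite !in_itv/= => /andP[-> _].
Qed.

Lemma ml_f_gt0 (t : R) : 0 <= t -> 0 < ml_f alpha t.
Proof.
by rewrite le_eqVlt => /predU1P[<-|t0]; [rewrite ml_f0|rewrite ml_fE// ml_sum1_gt0].
Qed.

End relaxation_kernel.

(** * Averages over the past *)

Section delay_average.
Variables (R : realType) (g : R -> R).
Local Notation mu := (@lebesgue_measure R).
Hypothesis g_ge0 : forall r, 0 <= g r.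
Hypothesis g_le0 : forall r, r <= 0 -> g r = 0.
Hypothesis measurable_g : measurable_fun [set: R] g.
Hypothesis g_mass : (\int[mu]_r (g r)%:E = 1)%E.
Hypothesis g_cont : forall r, 0 < r -> {for r, continuous g}.
Hypothesis g_lb : forall r, 0 < r -> exists2 c, 0 < c & forall s, 0 < s <= r -> c <= g s.

Definition bounded_measurable (w : R -> R) :=
  measurable_fun [set: R] w /\ exists C, forall r, `|w r| <= C.

Definition avg (w : R -> R) : R := \int[mu]_r (g r * w r).

Definition tail_mass (x : R) : R := \int[mu]_(r in `[x, +oo[) g r.

Lemma integrable_g : mu.-integrable [set: R] (EFin \o g).
Proof.
apply/integrableP; split; first exact/measurable_EFinP.
rewrite [X in (X < _)%E](_ : _ = 1%E) ?ltry// -g_mass.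
by apply: eq_integral => r _ /=; rewrite ger0_norm.
Qed.

Lemma integrable_avg w : bounded_measurable w ->
  mu.-integrable [set: R] (fun r => (g r * w r)%:E).
Proof.
move=> [mw [C Cw]].
apply: (@le_integrable _ _ _ mu _ measurableT _ (fun r => (g r * C)%:E)).
- by apply/measurable_EFinP; exact: measurable_funM.
- move=> r _ /=; rewrite lee_fin !normrM ler_wpM2l//.
  by rewrite (le_trans (Cw r))// ler_norm.
- rewrite (_ : (fun r => _) = (fun r => (C%:E * (EFin \o g) r)%E)).
    by apply: integrableZl => //; exact: integrable_g.
  by apply/funext => r /=; rewrite -EFinM mulrC.
Qed.

Lemma bounded_measurableD w1 w2 : bounded_measurable w1 -> bounded_measurable w2 ->
  bounded_measurable (fun r => w1 r + w2 r).
Proof.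
move=> [m1 [C1 b1]] [m2 [C2 b2]]; split; first exact: measurable_funD.
by exists (C1 + C2) => r; rewrite (le_trans (ler_normD _ _))// lerD.
Qed.

Lemma bounded_measurableZ k w : bounded_measurable w -> bounded_measurable (fun r => k * w r).
Proof.
move=> [m1 [C1 b1]]; split; first exact: measurable_funM.
by exists (`|k| * C1) => r; rewrite normrM ler_wpM2l.
Qed.

Lemma bounded_measurableB w1 w2 : bounded_measurable w1 -> bounded_measurable w2 ->
  bounded_measurable (fun r => w1 r - w2 r).
Proof.
move=> b1 b2; rewrite (_ : (fun r => _) = fun r => w1 r + (-1) * w2 r).
  by apply: bounded_measurableD => //; exact: bounded_measurableZ.
by apply/funext => r; rewrite mulN1r.
Qed.

Lemma bounded_measurable_cst k : bounded_measurable (fun=> k).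
Proof. by split => //; exists `|k|. Qed.

Lemma avgD w1 w2 : bounded_measurable w1 -> bounded_measurable w2 ->
  avg (fun r => w1 r + w2 r) = avg w1 + avg w2.
Proof.
move=> b1 b2; rewrite /avg -RintegralD//; last 2 first.
- exact: integrable_avg.
- exact: integrable_avg.
by apply: eq_Rintegral => r _; rewrite mulrDr.
Qed.

Lemma avgZ k w : bounded_measurable w -> avg (fun r => k * w r) = k * avg w.
Proof.
move=> b; rewrite /avg -RintegralZl//; last exact: integrable_avg.
by apply: eq_Rintegral => r _; rewrite mulrCA.
Qed.

Lemma avgB w1 w2 : bounded_measurable w1 -> bounded_measurable w2 ->
  avg (fun r => w1 r - w2 r) = avg w1 - avg w2.
Proof.
move=> b1 b2; rewrite /avg -RintegralB//; last 2 first.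
- exact: integrable_avg.
- exact: integrable_avg.
by apply: eq_Rintegral => r _; rewrite mulrBr.
Qed.

Lemma avg_cst k : avg (fun=> k) = k.
Proof.
rewrite /avg RintegralZr//; last exact: integrable_g.
by rewrite /Rintegral g_mass mul1r.
Qed.

Lemma avg_le w1 w2 : bounded_measurable w1 -> bounded_measurable w2 ->
  (forall r, 0 < r -> w1 r <= w2 r) -> avg w1 <= avg w2.
Proof.
move=> b1 b2 w12; apply: le_Rintegral => //; try exact: integrable_avg.
move=> r _; have [r0|r0] := ltP 0 r; first by rewrite ler_wpM2l// w12.
by rewrite g_le0// !mul0r.
Qed.

Lemma tail_massE x : tail_mass x = \int[mu]_r (g r * \1_(`[x, +oo[) r).
Proof.
rewrite /tail_mass Rintegral_mkcond; apply: eq_Rintegral => r _.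
by rewrite patchE indicE; case: ifPn => _; rewrite ?mulr1 ?mulr0.
Qed.

Lemma bounded_measurable_indic (D : set R) : measurable D -> bounded_measurable \1_D.
Proof.
move=> mD; split; first exact: measurable_indic.
by exists 1 => r; rewrite indicE; case: (_ \in _); rewrite ?normr1 ?normr0.
Qed.

Lemma indic_itv_oc (a b : R) : a <= b ->
  mu.-integrable [set: R] (fun r => (\1_(`]a, b]) r)%:E) /\
  \int[mu]_r \1_(`]a, b]) r = b - a.
Proof.
move=> ab.
have E : (\int[mu]_r (\1_(`]a, b]) r)%:E = (b - a)%:E)%E.
  rewrite integral_indic//= setIT lebesgue_measure_itv/= lte_fin.
  case: ifPn => [_|]; first by rewrite -EFinB.
  rewrite -leNgt => ba; have -> : b = a by apply/eqP; rewrite eq_le ba ab.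
  by rewrite subrr.
by split; [|by rewrite /Rintegral E]; exact: (integrable_indic_itv a b false false).
Qed.

(** The quantitative form of positivity behind every contradiction below: a
    contribution m on the window from r1 to r2 must be paid for by the negative part
    of w, which sits in the far past r >= S where g has little mass. *)
Lemma avg_lb (rho r1 r2 S m C : R) c w : bounded_measurable w ->
  (forall s, 0 < s <= rho -> c <= g s) -> 0 <= c -> 0 <= r1 -> r1 <= r2 -> r2 <= rho -> 0 <= m -> 0 <= C ->
  (forall r, 0 < r -> r < S -> 0 <= w r) ->
  (forall r, r1 < r <= r2 -> m <= w r) ->
  (forall r, 0 < r -> - C <= w r) -> r2 < S ->
  m * c * (r2 - r1) - C * tail_mass S <= avg w.
Proof.
move=> bw cg c0 r10 r12 r2r m0 C0 w0 wm wC r2S.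
rewrite tail_massE.
have mI : measurable [set` `]r1, r2]] by exact: measurable_itv.
have bI2 := @bounded_measurable_indic [set` `[S, +oo[] (measurable_itv _).
have [iI EI] := indic_itv_oc r12.
have i1 : mu.-integrable [set: R] (fun r => ((m * c) * \1_(`]r1, r2]) r)%:E).
  rewrite (_ : (fun r => _) = (fun r => (m * c)%:E * (\1_(`]r1, r2]) r)%:E)%E); last first.
    by apply/funext => r; rewrite EFinM.
  exact: integrableZl.
have iT := integrable_avg bI2.
rewrite -EI -RintegralZl//.
rewrite -RintegralZl// -RintegralB//; last first.
  rewrite (_ : (EFin \o _) = (fun r => C%:E * (g r * \1_(`[S, +oo[) r)%:E)%E); last by apply/funext.
  exact: integrableZl.
apply: le_Rintegral => //.
- rewrite (_ : (EFin \o _) = (fun r => ((m * c) * \1_(`]r1, r2]) r)%:E - C%:E * (g r * \1_(`[S, +oo[) r)%:E)%E); last by apply/funext.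
  by apply: integrableB => //; exact: integrableZl.
- exact: integrable_avg.
move=> r _; rewrite !indicE !mem_setE !in_itv/= andbT.
have [r0|r0] := lerP r 0.
  rewrite g_le0// !mul0r !mulr0 subr0.
  by rewrite ltNge (le_trans r0 r10)/= mulr0.
have [Sr|Sr] := lerP S r.
  rewrite (lt_geF (lt_le_trans r2S Sr)) andbF mulr0 add0r mulr1 -mulNr mulrC.
  by rewrite ler_wpM2l// wC.
rewrite !mulr0 subr0.
case: (boolP (r1 < r <= r2)) => [/andP[r1r rr2]|_] /=; last by rewrite mulr0 mulr_ge0// w0.
rewrite mulr1 mulrC ler_pM//.
- by apply: cg; rewrite r0 (le_trans rr2).
- by apply: wm; rewrite r1r.
Qed.

Lemma avg_cvg (w_ : nat -> R -> R) (w : R -> R) (C : R) :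
  (forall n, measurable_fun [set: R] (w_ n)) -> measurable_fun [set: R] w ->
  (forall n r, `|w_ n r| <= C) ->
  (forall r, 0 < r -> w_ n r @[n --> \oo] --> w r) ->
  avg (w_ n) @[n --> \oo] --> avg w.
Proof.
move=> mw_ mw wC ww.
have mgw v : measurable_fun [set: R] v -> measurable_fun [set: R] (fun r => (g r * v r)%:E).
  by move=> mv; apply/measurable_EFinP; exact: measurable_funM.
have dom : mu.-integrable [set: R] (fun r => (g r * C)%:E).
  by apply: integrable_avg; exact: bounded_measurable_cst.
have [|||||iw _ cv] := @dominated_convergence _ _ _ mu setT measurableT
   (fun n r => (g r * w_ n r)%:E) (fun r => (g r * w r)%:E) (fun r => (g r * C)%:E).
- by move=> n; exact: mgw.
- exact: mgw.
- apply: aeW => r _; apply: cvg_EFin; first exact: nearW.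
  have [r0|r0] := ltP 0 r; first by apply: cvgM; [exact: cvg_cst|exact: ww].
  by rewrite g_le0// mul0r; under eq_fun do rewrite mul0r; exact: cvg_cst.
- exact: dom.
- by apply: aeW => r n _ /=; rewrite lee_fin normrM (ger0_norm (g_ge0 r)) ler_wpM2l.
apply: fine_cvg; rewrite fineK//; exact: integrable_fin_num.
Qed.

(** The translates of g converge to g at every r > 0; as g may jump at 0, only the
    positive part of the difference, which g dominates, is integrated. *)
Lemma integral_shift_defect : forall e, 0 < e -> exists2 d, 0 < d & forall h, `|h| <= d ->
  \int[mu]_r Num.max 0 (g r - g (r + h)) <= e.
Proof.
move=> e e0; apply: contrapT => /forall2NP H.
have {}H n : exists h : R, `|h| <= n.+1%:R^-1 /\ e < \int[mu]_r Num.max 0 (g r - g (r + h)).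
  have [|] := H n.+1%:R^-1; first by rewrite invr_gt0 ltr0n.
  by move=> /existsNP[h /not_implyP[h1 /negP h2]]; exists h; split => //; rewrite ltNge.
have [h hP] := choice H.
have h0 : h n @[n --> \oo] --> (0 : R).
  apply/cvgrPdist_le => eps eps0; near=> n.
  rewrite sub0r normrN; apply: le_trans (hP n).1 _.
  apply: ltW; near: n; exact: (near_infty_natSinv_lt (PosNum eps0)).
have mh (x : R) : measurable_fun [set: R] (fun r => g (r + x)).
  by apply: (measurableT_comp measurable_g); exact: measurable_funD.
have mw (x : R) : measurable_fun [set: R] (fun r => Num.max 0 (g r - g (r + x))).
  by apply: measurable_maxr => //; exact: measurable_funB.
have [|||||iw _ cv] := @dominated_convergence _ _ _ mu setT measurableT
   (fun n r => (Num.max 0 (g r - g (r + h n)))%:E) (fun r => 0%E) (EFin \o g).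
- by move=> n; apply/measurable_EFinP; exact: mw.
- exact: measurable_cst.
- apply: aeW => r _; apply: cvg_EFin; first exact: nearW.
  rewrite [X in _ --> X](_ : _ = Num.max 0 (0 : R)); last by rewrite maxxx.
  have [r0|r0] := ltP 0 r.
    have c1 : r + h n @[n --> \oo] --> r.
      by rewrite -[X in _ --> X]addr0; apply: cvgD => //; exact: cvg_cst.
    have c2 : g (r + h n) @[n --> \oo] --> g r by exact: (cvg_comp _ _ c1 (g_cont r0)).
    have c3 : g r - g (r + h n) @[n --> \oo] --> (0 : R).
      by rewrite -[X in _ --> X](subrr (g r)); apply: cvgB => //; exact: cvg_cst.
    have c4 := @continuous_max R R (fun=> 0) id 0 (@cst_continuous _ _ _ _) (@cvg_id _ _).
    exact: (cvg_comp _ _ c3 c4).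
  rewrite g_le0// maxxx; apply: cvg_near_cst; apply: nearW => n.
  by apply/max_idPl; rewrite sub0r oppr_le0.
- exact: integrable_g.
- apply: aeW => r n _ /=; rewrite lee_fin ger0_norm ?le_max ?lexx//.
  by rewrite ge_max g_ge0/= gerBl.
rewrite integral0 in cv.
have cv' : \int[mu]_r Num.max 0 (g r - g (r + h n)) @[n --> \oo] --> (0 : R).
  exact: (fine_cvg cv).
have := @cvgr_lt R _ _ _ _ _ cv' e e0 => -[N _ /(_ N (leqnn N))] /=.
by rewrite ltNge (ltW (hP N).2).
Unshelve. all: by end_near. Qed.

(** Translations are continuous in L1, hence act continuously on averages, uniformly
    over functions with values in [0, kap]. *)
Lemma avg_shift (kap e : R) : 0 < kap -> 0 < e -> exists2 d, 0 < d &
  forall (h : R) (w : R -> R), `|h| <= d -> measurable_fun [set: R] w -> (forall r, 0 <= w r <= kap) ->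
  avg w <= avg (fun r => w (r - h)) + e.
Proof.
move=> k0 e0; have [d d0 Hd] := @integral_shift_defect (e / kap) ltac:(by rewrite divr_gt0).
exists d => // h w hd mw w01.
have mh : measurable_fun [set: R] (fun r => g (r + h)).
  by apply: (measurableT_comp measurable_g); exact: measurable_funD.
have mwh : measurable_fun [set: R] (fun r => w (r - h)).
  by apply: (measurableT_comp mw); exact: measurable_funB.
have bw : bounded_measurable w.
  by split => //; exists kap => r; have /andP[w0 w1] := w01 r; rewrite ger0_norm.
have bwh : bounded_measurable (fun r => w (r - h)).
  by split => //; exists kap => r; have /andP[w0 w1] := w01 (r - h); rewrite ger0_norm.
pose p r := Num.max 0 (g r - g (r + h)).
have mp : measurable_fun [set: R] p by apply: measurable_maxr => //; exact: measurable_funB.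
have p0 r : 0 <= p r by rewrite le_max lexx.
have pg r : p r <= g r by rewrite ge_max g_ge0/= gerBl.
have ip : mu.-integrable [set: R] (EFin \o p).
  apply: (@le_integrable _ _ _ mu _ measurableT _ (EFin \o g)) => //.
  - exact/measurable_EFinP.
  - by move=> r _ /=; rewrite lee_fin !ger0_norm.
  - exact: integrable_g.
have E : (\int[mu]_r (g (r + h) * w r)%:E = \int[mu]_r (g r * w (r - h))%:E)%E.
  rewrite -[RHS](@ge0_integral_shift R h).
  - by apply: eq_integral => r _; rewrite addrK.
  - by apply/measurable_EFinP; exact: measurable_funM.
  - by move=> r; rewrite lee_fin mulr_ge0//; have /andP[] := w01 (r - h).
have ish : mu.-integrable [set: R] (fun r => (g (r + h) * w r)%:E).
  apply/integrableP; split; first by apply/measurable_EFinP; exact: measurable_funM.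
  rewrite [X in (X < _)%E](_ : _ = (avg (fun r => w (r - h)))%:E) ?ltry//.
  rewrite /avg /Rintegral fineK; last exact/integrable_fin_num/integrable_avg.
  rewrite -E; apply: eq_integral => r _; rewrite gee0_abs// lee_fin mulr_ge0//.
  by have /andP[] := w01 r.
rewrite [avg (fun r => w (r - h))](_ : _ = \int[mu]_r (g (r + h) * w r)); last first.
  by rewrite /avg /Rintegral E.
apply: (@le_trans _ _ (\int[mu]_r (g (r + h) * w r) + kap * \int[mu]_r p r)); last first.
  rewrite lerD2l; have := Hd h hd; rewrite -/p ler_pdivlMr//.
  by rewrite mulrC.
have iZ : mu.-integrable [set: R] (EFin \o (fun r => kap * p r)).
  rewrite (_ : (EFin \o _) = (fun r => kap%:E * (EFin \o p) r)%E); last by apply/funext.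
  exact: integrableZl.
rewrite -RintegralZl// -RintegralD//; apply: le_Rintegral => //.
- exact: integrable_avg.
- rewrite (_ : (EFin \o _) = (fun r => (g (r + h) * w r)%:E + (kap * p r)%:E)%E); last by apply/funext.
  exact: integrableD.
move=> r _; have /andP[w0 w1] := w01 r.
rewrite -lerBlDl -mulrBl.
apply: (@le_trans _ _ (p r * w r)); first by rewrite ler_wpM2r// le_max lexx orbT.
by rewrite mulrC ler_wpM2r.
Qed.

Lemma avg_shift2 (kap e : R) : 0 < kap -> 0 < e -> exists2 d, 0 < d &
  forall (h : R) (w : R -> R), `|h| <= d -> measurable_fun [set: R] w -> (forall r, 0 <= w r <= kap) ->
  `|avg (fun r => w (r - h)) - avg w| <= e.
Proof.
move=> k0 e0; have [d d0 Hd] := avg_shift k0 e0.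
exists d => // h w hd mw w01.
have mwh : measurable_fun [set: R] (fun r => w (r - h)).
  by apply: (measurableT_comp mw); exact: measurable_funB.
have H1 := Hd h w hd mw w01.
have := Hd (- h) (fun r => w (r - h)) _ mwh (fun r => w01 (r - h)).
rewrite normrN => /(_ hd).
rewrite [avg (fun r => w (r - - h - h))](_ : _ = avg w); last first.
  by congr avg; apply/funext => r; rewrite opprK addrK.
move=> H2; rewrite ler_norml; apply/andP; split; lra.
Qed.

Lemma tail_mass_cvg0 (e : R) : 0 < e -> exists2 S, 0 < S & forall x, S <= x -> tail_mass x <= e.
Proof.
move=> e0.
have mI n : measurable_fun [set: R] (\1_(`[n.+1%:R, +oo[) : R -> R).
  by apply: measurable_indic; exact: measurable_itv.
have cv : avg (\1_(`[n.+1%:R, +oo[)) @[n --> \oo] --> avg (fun=> 0).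
  apply: (@avg_cvg _ _ 1) => //.
  - by move=> n r; rewrite indicE; case: (_ \in _); rewrite ?normr1 ?normr0.
  - move=> r r0; apply: cvg_near_cst; near=> n.
    rewrite indicE mem_setE in_itv/= andbT leNgt.
    have -> // : r < n.+1%:R.
    near: n; exists (Num.truncn r) => // n /= rn.
    by rewrite (lt_le_trans (truncnS_gt r))// ler_nat ltnS.
rewrite avg_cst in cv.
have := @cvgr_le R _ _ _ _ _ cv e e0 => -[N _ /(_ N (leqnn N))] /= HN.
exists N.+1%:R => // x Nx; apply: le_trans HN.
rewrite tail_massE; apply: avg_le.
- by apply: bounded_measurable_indic; exact: measurable_itv.
- by apply: bounded_measurable_indic; exact: measurable_itv.
move=> r _; rewrite !indicE !mem_setE !in_itv/= !andbT ler_nat.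
by have [xr|] := boolP (x <= r) => //; rewrite (le_trans Nx xr).
Unshelve. all: by end_near. Qed.

(** * Asymptotic fronts *)

Variables (P : R -> R) (kap Lam rho k0 : R).
Hypothesis kap_gt0 : 0 < kap.
Hypothesis P_ni : forall x y : R, x <= y -> P y <= P x.
Hypothesis P_ge0 : forall x, 0 <= P x.
Hypothesis P_sym : forall x, P (- x) = kap - P x.
Hypothesis Lam_gt0 : 0 < Lam.
Hypothesis P_lip : forall x y : R, x <= y -> P x - P y <= Lam * (y - x).
Hypothesis P_cvg0 : forall e : R, 0 < e -> exists2 q : R, 0 < q & P q <= e.
Hypothesis rho_gt0 : 0 < rho.
Hypothesis k0_gt0 : 0 < k0.
Hypothesis P_strict : forall x y : R, - rho <= x -> x <= y -> y <= rho -> k0 * (y - x) <= P x - P y.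

Ltac clra := clear - R g g_ge0 g_le0 measurable_g g_mass g_cont g_lb P kap Lam rho k0
  kap_gt0 P_ni P_ge0 P_sym Lam_gt0 P_lip P_cvg0 rho_gt0 k0_gt0 P_strict; lra.

Definition delayed (a : R -> R) (t x : R) : R := avg (fun r => P (x - a (t - r))).

(** An approximate equation is enough, and it absorbs the influence of the initial
    datum, which fades as t grows. *)
Definition asymptotic_front (a : R -> R) (u : R) :=
  [/\ continuous a, forall s : R, s <= 0 -> a s = a 0 &
   forall e : R, 0 < e -> exists T : R, forall t : R, T <= t -> `|delayed a t (a t) - u| <= e].

Lemma P_le x : P x <= kap.
Proof. by rewrite -subr_ge0 -P_sym P_ge0. Qed.

Lemma P0 : P 0 = kap / 2.
Proof. by have := P_sym 0; rewrite oppr0 => H; lra. Qed.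

Lemma measurable_P : measurable_fun [set: R] P.
Proof. by apply: nonincreasing_measurable. Qed.

Lemma bounded_measurable_P (v : R -> R) : measurable_fun [set: R] v ->
  bounded_measurable (fun r => P (v r)).
Proof.
move=> mv; split; first exact: (measurableT_comp measurable_P).
by exists kap => r; rewrite ger0_norm ?P_ge0 ?P_le.
Qed.

Lemma measurable_history (a : R -> R) (t : R) : continuous a ->
  measurable_fun [set: R] (fun r => a (t - r)).
Proof.
move=> ca; apply: (measurableT_comp (continuous_measurable_fun ca)).
exact: measurable_funB.
Qed.

Lemma bounded_measurable_history (a : R -> R) (t x : R) : continuous a ->
  bounded_measurable (fun r => P (x - a (t - r))).
Proof.
move=> ca; apply: bounded_measurable_P; apply: measurable_funB => //.
exact: measurable_history.
Qed.

Lemma delayed_ni (a : R -> R) (t x y : R) : continuous a -> x <= y ->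
  delayed a t y <= delayed a t x.
Proof.
move=> ca xy; apply: avg_le; try exact: bounded_measurable_history.
by move=> r _; apply: P_ni; rewrite lerD2r.
Qed.

(** A change of time is a translation of the averaging variable. *)
Lemma delayed_time (a : R -> R) (e : R) : continuous a -> 0 < e ->
  exists2 d, 0 < d & forall t t' x, `|t' - t| <= d -> `|delayed a t' x - delayed a t x| <= e.
Proof.
move=> ca e0; have [d d0 H] := avg_shift2 kap_gt0 e0.
exists d => // t t' x tt'.
have := H (t' - t) (fun r => P (x - a (t - r))) tt' (bounded_measurable_history t x ca).1.
rewrite (_ : avg (fun r => P (x - a (t - (r - (t' - t))))) = delayed a t' x).
  by apply => r; rewrite P_ge0 P_le.
by congr avg; apply/funext => r; congr (P (_ - a _)); ring.
Qed.

Lemma delayedN (a : R -> R) (t x : R) : continuous a ->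
  delayed (fun t => - a t) t x = kap - delayed a t (- x).
Proof.
move=> ca; rewrite -[in RHS](avg_cst kap) -avgB; last 2 first.
- exact: bounded_measurable_cst.
- exact: bounded_measurable_history.
by congr avg; apply/funext => r; rewrite -P_sym; congr P; ring.
Qed.

(** The reflection x |-> - x turns P into kap - P. *)
Lemma asymptotic_frontN (a : R -> R) (u : R) : asymptotic_front a u ->
  asymptotic_front (fun t => - a t) (kap - u).
Proof.
move=> [ca a0 aJ]; split.
- by move=> t; apply: cvgN; exact: ca.
- by move=> s s0; rewrite a0.
- move=> e e0; have [T HT] := aJ e e0; exists T => t Tt.
  rewrite delayedN// opprK (_ : kap - _ - _ = - (delayed a t (a t) - u)) ?normrN; last by ring.
  exact: HT.
Qed.

(** At a time where the front is furthest back, its whole past lies ahead of it and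
    the delayed average is at least P(0) = kap / 2 > u. *)
Lemma front_bounded_below (a : R -> R) (u : R) : asymptotic_front a u -> u < kap / 2 ->
  exists B, forall t, B <= a t.
Proof.
move=> [ca a0 aJ] uk.
have [T HT] := aJ ((kap / 2 - u) / 2) ltac:(lra).
pose T1 := Num.max T 0.
have T10 : 0 <= T1 by rewrite le_max lexx orbT.
have [c cI cmin] : exists2 c, c \in `[0, T1] & forall t, t \in `[0, T1] -> a c <= a t.
  by apply: EVT_min => //; exact: continuous_subspaceT.
exists (a c) => t.
have [t0|t0] := lerP t 0; first by rewrite (a0 t)//; apply: cmin; rewrite in_itv/= lexx T10.
have [s sI smin] : exists2 s, s \in `[0, t] & forall r, r \in `[0, t] -> a s <= a r.
  by apply: EVT_min; [exact: ltW|exact: continuous_subspaceT].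
move: sI; rewrite in_itv/= => /andP[s0 st].
apply: le_trans (smin t _); last by rewrite in_itv/= lexx ltW.
have [sT|sT] := lerP s T1; first by apply: cmin; rewrite in_itv/= s0 sT.
exfalso; have := HT s; rewrite (le_trans _ (ltW sT)) ?le_max ?lexx// => /(_ isT).
have : kap / 2 <= delayed a s (a s).
  rewrite -[leLHS](avg_cst); apply: avg_le; first exact: bounded_measurable_cst.
    exact: bounded_measurable_history.
  move=> r r0; rewrite -P0; apply: P_ni; rewrite subr_le0.
  have [sr|sr] := lerP 0 (s - r); first by apply: smin; rewrite in_itv/= sr; lra.
  by rewrite (a0 _ (ltW sr)); apply: smin; rewrite in_itv/= lexx; lra.
by move=> H; rewrite ler_norml => /andP[_]; lra.
Qed.

Definition runmax (a : R -> R) (t : R) : R := sup [set a s | s in [set s | s <= t]].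

Section running_maximum.
Variable a : R -> R.
Hypotheses (ca : continuous a) (a0 : forall s : R, s <= 0 -> a s = a 0).

Lemma runmax_attained (t : R) : exists2 s, s <= t & (forall r, r <= t -> a r <= a s) /\ runmax a t = a s.
Proof.
suff [s st smax] : exists2 s, s <= t & (forall r, r <= t -> a r <= a s).
  exists s => //; split => //; apply/eqP; rewrite eq_le; apply/andP; split.
    by apply: ge_sup; [exists (a s), s|move=> _ [r rt <-]; exact: smax].
  apply: ub_le_sup; last by exists s.
  by exists (a s) => _ [r rt <-]; exact: smax.
have [t0|t0] := lerP t 0.
  by exists t => // r rt; rewrite !a0 ?(le_trans rt).
have [s sI smax] : exists2 s, s \in `[0, t] & forall r, r \in `[0, t] -> a r <= a s.
  by apply: EVT_max; [exact: ltW|exact: continuous_subspaceT].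
move: sI; rewrite in_itv/= => /andP[s0 st]; exists s => // r rt.
have [r0|r0] := lerP r 0; first by rewrite (a0 r0); apply: smax; rewrite in_itv/= lexx ltW.
by apply: smax; rewrite in_itv/= rt ltW.
Qed.

Lemma runmax_ge (s t : R) : s <= t -> a s <= runmax a t.
Proof. by move=> st; have [r _ [H ->]] := runmax_attained t; exact: H. Qed.

Lemma runmax_le (t x : R) : (forall s, s <= t -> a s <= x) -> runmax a t <= x.
Proof. by move=> H; have [r rt [_ ->]] := runmax_attained t; exact: H. Qed.

Lemma runmax_nd (s t : R) : s <= t -> runmax a s <= runmax a t.
Proof. by move=> st; apply: runmax_le => r rs; apply: runmax_ge; exact: le_trans st. Qed.

Lemma runmax_continuous : continuous (runmax a).
Proof.
move=> t; apply/cvgrPdist_le => e e0.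
have := @ca t => /cvgrPdist_le /(_ (e / 2) ltac:(by rewrite divr_gt0)) [/= d d0 Hd].
exists d => //= t' tt'.
have near_t s : s \in `[t, t'] \/ s \in `[t', t] -> `|a t - a s| <= e / 2.
  move=> H; apply: Hd => /=; apply: le_lt_trans tt'.
  case: H; rewrite in_itv/= => /andP[h1 h2]; last first.
    by rewrite !ger0_norm ?subr_ge0 ?(le_trans h1)// lerD2l lerN2.
  by rewrite !ler0_norm ?subr_le0 ?(le_trans h1)// lerN2 lerD2l lerN2.
have at' : `|a t - a t'| <= e / 2.
  by apply: near_t; have [h|/ltW h] := lerP t t'; [left|right]; rewrite in_itv/= lexx h.
rewrite ler_norml; apply/andP; split.
- suff : runmax a t' <= runmax a t + e / 2 by lra.
  apply: runmax_le => s st'.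
  have [st|/ltW ts] := lerP s t; first by have := runmax_ge st; lra.
  have := near_t s; rewrite !in_itv/= ts st' => /(_ (or_introl isT)).
  by rewrite ler_norml => /andP[h _]; have := runmax_ge (lexx t); lra.
- suff : runmax a t <= runmax a t' + e by lra.
  apply: runmax_le => s st.
  have [st'|/ltW ts] := lerP s t'; first by have := runmax_ge st'; lra.
  have := near_t s; rewrite !in_itv/= ts st => /(_ (or_intror isT)).
  have := runmax_ge (lexx t').
  by move: at'; rewrite !ler_norml; lra.
Qed.

End running_maximum.

(** * The front does not retreat *)

(** Moving back by l >= 2 q from a point x >= 0 nearly doubles P: either x is
    within q of 0 and the move ends below - q, where P is almost kap, while
    P(x) <= kap / 2; or x > q and P(x) <= u / 2 already. *)
Lemma P_retreat (u q l x : R) : 0 <= q -> P q <= u / 2 -> 2 * q <= l -> 0 <= x -> 0 <= u ->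
  2 * P x - u / 2 <= P (x - l).
Proof.
move=> q0 Pq ql x0 u0.
have [xq|/ltW qx] := lerP x q.
  have h1 : kap - u / 2 <= P (x - l).
    apply: (@le_trans _ _ (P (- q))); last by apply: P_ni; move: ql xq; clra.
    by rewrite P_sym lerD2l lerN2.
  have h2 : P x <= kap / 2 by rewrite -P0; exact: P_ni.
  by move: h1 h2; clra.
have h1 : P x <= P q by apply: P_ni.
have h2 : P x <= P (x - l) by apply: P_ni; move: ql q0; clra.
by move: h1 h2 Pq; clra.
Qed.

(** If p is nonincreasing, its value L is kept on [0, tau], and p hardly changes on average
    under a shift by tau, then p loses at most d in each step of length tau / 2,
    hence little on the part [0, S] of the past that carries most of the mass. *)
Lemma avg_slow_variation (tau eta : R) : 0 < tau -> 0 < eta -> exists2 eps, 0 < eps &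
  forall (p : R -> R) (L : R), (forall r1 r2, r1 <= r2 -> p r2 <= p r1) ->
    (forall r, 0 <= p r <= kap) -> (forall r, 0 <= r <= tau -> p r = L) ->
    avg (fun r => p r - p (r + tau)) <= eps -> L - eta <= avg p.
Proof.
move=> tau0 eta0.
have eta20 : 0 < eta / (2 * kap) by rewrite divr_gt0// mulr_gt0.
have [S S0 /(_ S (lexx S)) HS] := tail_mass_cvg0 eta20.
have {}HS : kap * tail_mass S <= eta / 2.
  by rewrite mulrC -ler_pdivlMr// -mulrA -invfM.
pose N := (Num.truncn (2 * S / tau)).+1.
have NS : 2 * S <= N%:R * tau by rewrite -ler_pdivrMr// ltW// truncnS_gt.
have N0 : 0 < N%:R :> R by rewrite ltr0n.
have Ntau0 : 0 < N.+1%:R * tau by rewrite mulr_gt0.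
have [c c0 Hc] := g_lb Ntau0.
have ct0 : 0 < c * tau by rewrite mulr_gt0.
exists (eta * (c * tau) / (4 * N%:R)); first by rewrite divr_gt0// mulr_gt0.
move=> p L p_ni p01 pL dsmall.
pose d := eta / (2 * N%:R).
have Nd : N%:R * d = eta / 2 by rewrite /d; field; rewrite gt_eqF.
have mp : measurable_fun [set: R] p by apply: nonincreasing_measurable.
have bp : bounded_measurable p.
  by split => //; exists kap => r; have /andP[h1 h2] := p01 r; rewrite ger0_norm.
have bp' : bounded_measurable (fun r => p (r + tau)).
  split; first by apply: (measurableT_comp mp); exact: measurable_funD.
  by exists kap => r; have /andP[h1 h2] := p01 (r + tau); rewrite ger0_norm.
have tau_ge0 := ltW tau0.
have tau2 : 0 < tau / 2 by rewrite divr_gt0.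
(* By monotonicity the whole half-step from r1 to r1 + tau / 2 contributes to the
   average defect the drop of p between r1 + tau / 2 and r1 + tau. *)
have step r1 : 0 <= r1 -> r1 + tau / 2 <= N.+1%:R * tau -> p (r1 + tau / 2) - d <= p (r1 + tau).
  move=> r10 r1N.
  have hS : r1 + tau / 2 < r1 + tau by rewrite ltrD2l gtr_pMr// invf_lt1// ltr1n.
  have r2p : r1 <= r1 + tau / 2 by rewrite lerDl ltW.
  have m0 : 0 <= p (r1 + tau / 2) - p (r1 + tau) by rewrite subr_ge0; apply/p_ni/ltW.
  have w0 r : 0 < r -> 0 <= p r - p (r + tau) by move=> _; rewrite subr_ge0; apply: p_ni; rewrite lerDl.
  have wm r : r1 < r <= r1 + tau / 2 -> p (r1 + tau / 2) - p (r1 + tau) <= p r - p (r + tau).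
    move=> /andP[h1 h2]; apply: lerB; apply: p_ni => //.
    by rewrite lerD2r ltW.
  have := avg_lb (bounded_measurableB bp bp') Hc (ltW c0) r10 r2p r1N m0 (lexx 0)
     (fun r r0 _ => w0 r r0) wm _ hS.
  rewrite oppr0 mul0r subr0 => /(_ w0) H.
  have {}H := le_trans H dsmall.
  have E : (p (r1 + tau / 2) - p (r1 + tau)) * (c * tau) / 2 <= d * (c * tau) / 2.
    apply: le_trans (le_trans _ H) _; first by rewrite le_eqVlt; apply/orP; left; apply/eqP; field.
    rewrite /d le_eqVlt; apply/orP; left; apply/eqP; field.
    by rewrite gt_eqF.
  rewrite lerBlDl -lerBlDr; move: E.
  by rewrite ler_pM2r ?invr_gt0// ler_pM2r.
have iter k : (k <= N)%N -> L - k%:R * d <= p (k.+1%:R * (tau / 2)).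
  elim: k => [|k IH] kN.
    rewrite mul0r subr0 mul1r pL// (ltW tau2)/=.
    by rewrite ger_pMr// invf_le1// ler1n.
  have e1 : k%:R * (tau / 2) + tau / 2 = k.+1%:R * (tau / 2) by rewrite -[k.+1%:R]natr1 mulrDl mul1r.
  have e2 : k%:R * (tau / 2) + tau = k.+2%:R * (tau / 2) by rewrite -[k.+2%:R]natr1 -[k.+1%:R]natr1; field.
  have h1 : 0 <= k%:R * (tau / 2) by rewrite mulr_ge0// ltW.
  have h2 : k.+1%:R * (tau / 2) <= N.+1%:R * tau.
    apply: ler_pM; rewrite ?ler_nat ?(ltW tau2)//; first exact: ltnW.
    by rewrite ger_pMr// invf_le1// ler1n.
  have := step _ h1; rewrite e1 e2 => /(_ h2); apply: le_trans.
  have -> : k.+1%:R * d = k%:R * d + d by rewrite -[k.+1%:R]natr1 mulrDl mul1r.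
  by rewrite opprD addrA lerD2r; exact: IH (ltnW kN).
have pS r : 0 < r -> r < S -> L - eta / 2 <= p r.
  move=> r0 rS; apply: le_trans (p_ni r (N.+1%:R * (tau / 2)) _).
    by apply: le_trans (iter N (leqnn N)); rewrite Nd.
  by rewrite -[N.+1%:R]natr1 mulrDl; move: rS NS tau0; clra.
have Lk : L <= kap by have := pL 0; rewrite lexx tau_ge0 => <- //; have /andP[] := p01 0.
have bw : bounded_measurable (fun r => p r - (L - eta / 2)).
  by apply: bounded_measurableB => //; exact: bounded_measurable_cst.
have H1 r : 0 < r -> r < S -> 0 <= p r - (L - eta / 2) by move=> r0 rS; rewrite subr_ge0 pS.
have H2 r : 0 < r <= 0 -> 0 <= p r - (L - eta / 2).
  by move=> /andP[h1 h2]; have := lt_le_trans h1 h2; rewrite ltxx.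
have H3 r : 0 < r -> - kap <= p r - (L - eta / 2).
  by move=> r0; have /andP[h _] := p01 r; move: h Lk eta0; clra.
have := avg_lb bw Hc (ltW c0) (lexx 0) (lexx 0) (ltW Ntau0) (lexx 0) (ltW kap_gt0) H1 H2 H3 S0.
rewrite avgB//; last exact: bounded_measurable_cst.
rewrite avg_cst !mul0r sub0r; move: HS; clra.
Qed.

(** Let t' be a time at which the front is furthest behind its running maximum, by l
    say, and s an earlier time where that maximum was attained. If t' - s is short,
    the delayed average has hardly changed since s, but moving back by l from
    a(s) would nearly double it. If t' - s is long, the history of the running maximum
    seen from t' gives an average that is at most u, and at least u after a shift
    by the threshold tau between short and long, up to a small error: it varies slowly
    and starts with the value P(0) = kap / 2 > u. *)
Lemma front_bounded_retreat (a : R -> R) (u : R) : asymptotic_front a u ->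
  0 < u -> u < kap / 2 -> exists B, forall s t, s <= t -> a s - a t <= B.
Proof.
move=> F u0 uk; have [B0 HB0] := front_bounded_below F uk.
have [ca a0 aJ] := F.
have u20 : 0 < u / 2 by rewrite divr_gt0.
have [q q0 Pq] := P_cvg0 u20.
have u80 : 0 < u / 8 by rewrite divr_gt0.
have [tau tau0 Htau] := delayed_time ca u80.
pose eta := (kap / 2 - u) / 2.
have eta0 : 0 < eta by rewrite divr_gt0// subr_gt0.
have [eps1 eps10 slow] := avg_slow_variation tau0 eta0.
pose eps := Num.min (u / 16) (Num.min (eta / 2) (eps1 / 2)).
have eps0 : 0 < eps by rewrite !lt_min (divr_gt0 u0)// (divr_gt0 eta0)// (divr_gt0 eps10).
have eps_u : eps <= u / 16 by rewrite !ge_min lexx.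
have eps_eta : eps <= eta / 2 by rewrite !ge_min lexx /= ?orbT.
have eps_1 : eps <= eps1 / 2 by rewrite !ge_min lexx /= !orbT.
have [T HT] := aJ eps eps0.
move: eps0 eps_u eps_eta eps_1 HT; move: eps => eps eps0 eps_u eps_eta eps_1 HT.
pose B := Num.max (2 * q) (runmax a T - B0).
have Bq : 2 * q <= B by rewrite le_max lexx.
have BT : runmax a T - B0 <= B by rewrite le_max lexx orbT.
have cM := runmax_continuous ca a0.
have runmaxN r : r <= 0 -> runmax a r - a r <= 0.
  by move=> r0; rewrite subr_le0; apply: runmax_le => // s sr; rewrite !a0 ?(le_trans sr).
suff H t : runmax a t - a t <= B.
  exists B => s t st; apply: le_trans (H t); rewrite lerD2r.
  exact: runmax_ge.
rewrite leNgt; apply/negP => tB.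
have B_gt0 : 0 < B by apply: lt_le_trans Bq; rewrite mulr_gt0.
have t0 : 0 < t.
  rewrite ltNge; apply/negP => t0.
  by have := lt_le_trans (lt_trans B_gt0 tB) (runmaxN t t0); rewrite ltxx.
have [t' t'I t'max] : exists2 c, c \in `[0, t] & forall r, r \in `[0, t] -> runmax a r - a r <= runmax a c - a c.
  apply: EVT_max; first exact: ltW.
  by apply: continuous_subspaceT => r; apply: cvgB; [exact: cM|exact: ca].
pose l := runmax a t' - a t'.
have lB : B < l by apply: lt_le_trans tB (t'max _ _); rewrite in_itv/= lexx ltW.
have l0 : 0 < l by exact: lt_trans lB.
have lmax r : r <= t' -> runmax a r - a r <= l.
  move=> rt'; have [r0|r0] := lerP r 0; first by rewrite (le_trans (runmaxN r r0))// ltW.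
  by apply: t'max; move: t'I; rewrite !in_itv/= => /andP[_ h]; rewrite (ltW r0) (le_trans rt').
have [s st' [smax sM]] := runmax_attained ca a0 t'.
have aM : a t' = a s - l by rewrite /l sM subKr.
have sT : T <= s.
  rewrite leNgt; apply/negP => /ltW sT.
  have := runmax_ge ca a0 sT; have := HB0 t'.
  by move: BT lB aM; clra.
have HTs := HT s sT; have HTt := HT t' (le_trans sT st').
move: HTs HTt; rewrite !ler_norml => /andP[Js1 Js2] /andP[Jt1 Jt2].
have bJ t1 : bounded_measurable (fun r => P (a t1 - a (t1 - r))) by exact: bounded_measurable_history.
have [htau|htau] := lerP (t' - s) tau.
(* The fast retreat: the average at a(t') would be almost 2 u - u / 2. *)
  have := Htau s t' (a t'); rewrite ger0_norm ?subr_ge0// => /(_ htau).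
  rewrite ler_norml => /andP[h1 h2].
  have h3 : 2 * delayed a s (a s) - u / 2 <= delayed a s (a t').
    rewrite -[delayed a s (a s)]/(avg _) -avgZ// -[u / 2 in leLHS]avg_cst -avgB; last 2 first.
    - exact: bounded_measurableZ.
    - exact: bounded_measurable_cst.
    apply: avg_le.
    - apply: bounded_measurableB; first exact: bounded_measurableZ.
      exact: bounded_measurable_cst.
    - exact: bounded_measurable_history.
    move=> r r0; rewrite aM.
    rewrite (_ : a s - l - a (s - r) = (a s - a (s - r)) - l); last by rewrite addrAC.
    apply: (P_retreat (ltW q0) Pq); [exact/ltW/(le_lt_trans Bq)| |exact: ltW].
    by rewrite subr_ge0; apply: smax; apply: le_trans st'; rewrite gerBl ltW.
  by move: h1 h2 h3 Js1 Js2 Jt1 Jt2 eps_u u0; clra.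
(* The slow retreat. *)
pose p r := P (runmax a t' - runmax a (t' - r)).
have p_ni r1 r2 : r1 <= r2 -> p r2 <= p r1.
  by move=> r12; apply: P_ni; rewrite lerD2l lerN2; apply: runmax_nd => //; rewrite lerD2l lerN2.
have bp : bounded_measurable p.
  by apply: bounded_measurable_P; apply: measurable_funB => //; exact: measurable_history.
have bp' : bounded_measurable (fun r => p (r + tau)).
  split; last by exists kap => r; rewrite ger0_norm ?P_ge0 ?P_le.
  by apply: (measurableT_comp bp.1); exact: measurable_funD.
have pJt : avg p <= delayed a t' (a t').
  apply: avg_le => // r r0; apply: P_ni.
  have := lmax (t' - r); rewrite gerBl (ltW r0) => /(_ isT).
  by rewrite /l; clra.
have pJs : delayed a s (a s) <= avg (fun r => p (r + tau)).
  apply: avg_le => // r r0; apply: P_ni; rewrite sM lerD2l lerN2.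
  apply: le_trans (runmax_ge ca a0 (lexx (s - r))) _.
  by apply: runmax_nd => //; move: htau; clra.
have pL r : 0 <= r <= tau -> p r = kap / 2.
  move=> /andP[r0 rt]; rewrite /p -P0; congr P; apply/eqP; rewrite subr_eq0 eq_le; apply/andP; split.
    by rewrite sM; apply: runmax_ge => //; move: rt htau; clra.
  by apply: runmax_nd => //; rewrite gerBl.
have : kap / 2 - eta <= avg p.
  apply: (slow p) => //; first by move=> r; rewrite P_ge0 P_le.
  by rewrite avgB//; move: pJt pJs Js1 Jt2 eps_1; clra.
by move: pJt Jt2 eps_eta eta0; rewrite /eta; clra.
Qed.

(** * Width of the level sets and equicontinuity *)

Definition level_width (a : R -> R) (u w : R) := exists e T, 0 < e /\
  forall t x y : R, T <= t -> `|delayed a t x - u| <= e -> `|delayed a t y - u| <= e -> y - x <= w.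

Lemma le_level_width (a : R -> R) (u w w' : R) : w <= w' -> level_width a u w -> level_width a u w'.
Proof.
move=> ww' [e [T [e0 H]]]; exists e, T; split => // t x y Tt hx hy.
exact: le_trans (H _ _ _ Tt hx hy) ww'.
Qed.

Lemma level_widthN (a : R -> R) (u w : R) : continuous a ->
  level_width (fun t => - a t) (kap - u) w -> level_width a u w.
Proof.
move=> ca [e [T [e0 H]]]; exists e, T; split => // t x y Tt hx hy.
have E z : kap - delayed a t z - (kap - u) = - (delayed a t z - u) by ring.
have := H t (- y) (- x) Tt; rewrite !delayedN// !opprK !E !normrN => /(_ hy hx).
by rewrite addrC.
Qed.

(** Since the front never retreats by more than B, ahead of a(t) + q + B the past
    of the front is at distance at least q behind, and the average is below u / 2. This also
    bounds the advance of the front in a short time, and thereby in any time S: far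
    enough behind a(t) the recent front lies well ahead, and the average is
    close to kap. *)
Lemma front_level_width_lt (a : R -> R) (u : R) : asymptotic_front a u ->
  0 < u -> u < kap / 2 -> exists w, level_width a u w.
Proof.
move=> F u0 uk; have [B HB] := front_bounded_retreat F u0 uk.
have [ca a0 aJ] := F.
have B0 : 0 <= B by have := HB 0 0 (lexx 0); rewrite subrr.
have u20 : 0 < u / 2 by rewrite divr_gt0.
have [q q0 Pq] := P_cvg0 u20.
pose L := q + B.
have L0 : 0 < L by rewrite ltr_wpDr.
have up t : delayed a t (a t + L) <= u / 2.
  rewrite -[leRHS]avg_cst; apply: avg_le; first exact: bounded_measurable_history.
    exact: bounded_measurable_cst.
  move=> r r0; apply: le_trans Pq; apply: P_ni.
  by have := HB (t - r) t; rewrite gerBl (ltW r0) /L => /(_ isT); clra.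
have u80 : 0 < u / 8 by rewrite divr_gt0.
have [d d0 Hd] := delayed_time ca u80.
have [T HT] := aJ _ u80.
have speed t h : T <= t -> 0 <= h -> h <= d -> a (t + h) <= a t + L.
  move=> Tt h0 hd; rewrite leNgt; apply/negP => /ltW bad.
  have Tth : T <= t + h by rewrite ler_wpDr.
  have := HT _ Tth; have := Hd t (t + h) (a t + L).
  rewrite addrAC subrr add0r ger0_norm// => /(_ hd); rewrite !ler_norml => /andP[_ h1] /andP[h2 _].
  have h3 := delayed_ni (t + h) ca bad; have h4 := up t.
  by move: h1 h2 h3 h4 u0; clra.
have speedn n t h : T <= t -> 0 <= h -> h <= n%:R * d -> a (t + h) <= a t + n%:R * L.
  elim: n h => [|n IH] h Tt h0 hn.
    have -> : h = 0 by apply/eqP; rewrite eq_le h0 andbT; move: hn; rewrite mul0r.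
    by rewrite mul0r !addr0.
  have E (x : R) : n.+1%:R * x = n%:R * x + x by rewrite -[n.+1%:R]natr1 mulrDl mul1r.
  have [hd|/ltW hd] := lerP h d.
    apply: (le_trans (speed t h Tt h0 hd)); rewrite lerD2l E lerDr.
    by rewrite mulr_ge0// ltW.
  have hd0 : 0 <= h - d by rewrite subr_ge0.
  have hdn : h - d <= n%:R * d by rewrite lerBlDr -E.
  have := IH (h - d) Tt hd0 hdn.
  have Tt' : T <= t + (h - d) by rewrite ler_wpDr.
  have := speed (t + (h - d)) d Tt' (ltW d0) (lexx d).
  by rewrite -addrA subrK E; clra.
pose eta := kap - u.
have eta0 : 0 < eta by rewrite /eta; move: uk kap_gt0; clra.
have eta40 : 0 < eta / 4 by rewrite divr_gt0.
have etak : 0 < eta / (4 * kap) by rewrite divr_gt0// mulr_gt0.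
have [S S0 /(_ S (lexx S)) HS] := tail_mass_cvg0 etak.
have {}HS : kap * tail_mass S <= eta / 4.
  by rewrite mulrC -ler_pdivlMr// -mulrA -invfM.
pose n := (Num.truncn (S / d)).+1.
have nS : S <= n%:R * d by rewrite -ler_pdivrMr// ltW// truncnS_gt.
have [q' q'0 Pq'] := P_cvg0 eta40.
pose C := n%:R * L.
pose L' := q' + C.
have [c c0 Hc] := g_lb S0.
have down t : T + S <= t -> u + eta / 2 <= delayed a t (a t - L').
  move=> TSt.
  have bw : bounded_measurable (fun r => P (a t - L' - a (t - r)) - (kap - eta / 4)).
    by apply: bounded_measurableB; [exact: bounded_measurable_history|exact: bounded_measurable_cst].
  have H1 r : 0 < r -> r < S -> 0 <= P (a t - L' - a (t - r)) - (kap - eta / 4).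
    move=> r0 rS; have Ttr : T <= t - r by move: rS TSt; clra.
    have := speedn n (t - r) r Ttr (ltW r0) (le_trans (ltW rS) nS); rewrite subrK -/C => h.
    have : P (- q') <= P (a t - L' - a (t - r)) by apply: P_ni; rewrite /L'; move: h; clra.
    by rewrite P_sym; move: Pq'; clra.
  have H2 r : 0 < r <= 0 -> 0 <= P (a t - L' - a (t - r)) - (kap - eta / 4).
    by move=> /andP[h1 h2]; have := lt_le_trans h1 h2; rewrite ltxx.
  have H3 r : 0 < r -> - kap <= P (a t - L' - a (t - r)) - (kap - eta / 4).
    by move=> r0; have := P_ge0 (a t - L' - a (t - r)); move: eta0; clra.
  have := avg_lb bw Hc (ltW c0) (lexx 0) (lexx 0) (ltW S0) (lexx 0) (ltW kap_gt0) H1 H2 H3 S0.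
  rewrite avgB; [|exact: bounded_measurable_history|exact: bounded_measurable_cst].
  by rewrite -/(delayed a t (a t - L')) avg_cst !mul0r sub0r; move: HS; rewrite /eta; clra.
exists (L + L').
pose e := Num.min (u / 4) (eta / 4).
have e_u : e <= u / 4 by rewrite ge_min lexx.
have e_eta : e <= eta / 4 by rewrite ge_min lexx orbT.
have e0 : 0 < e by rewrite lt_min !divr_gt0.
move: e e_u e_eta e0 => e e_u e_eta e0.
exists e, (T + S); split => // t x y Tt; rewrite !ler_norml => /andP[x1 x2] /andP[y1 y2].
have hy : y <= a t + L.
  rewrite leNgt; apply/negP => /ltW yL.
  have := delayed_ni t ca yL; have := up t.
  by move: y1 e_u u0; clra.
have hx : a t - L' <= x.
  rewrite leNgt; apply/negP => /ltW xL.
  have := delayed_ni t ca xL; have := down t Tt.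
  by move: x2 e_eta eta0; clra.
by move: hx hy; clra.
Qed.

(** Above the level kap / 2 by reflection. At this level the front is assumed to stay at
    rest, and the average is P itself. *)
Lemma front_level_width (a : R -> R) (u : R) : asymptotic_front a u ->
  0 < u -> u < kap -> (u = kap / 2 -> forall t, a t = a 0) -> exists w, level_width a u w.
Proof.
move=> F u0 uk ueq; have [ca a0 aJ] := F.
have [ulow|uhigh|umid] := ltgtP u (kap / 2); first exact: front_level_width_lt F u0 ulow.
  have h1 : 0 < kap - u by rewrite subr_gt0.
  have h2 : kap - u < kap / 2 by move: uhigh; clra.
  have [w W] := front_level_width_lt (asymptotic_frontN F) h1 h2.
  by exists w; exact: level_widthN.
have ac := ueq umid; have kr : 0 < k0 * rho by rewrite mulr_gt0.
exists (2 * rho), (k0 * rho / 2), 0; split; first by rewrite divr_gt0.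
move=> t x y _.
have D z : delayed a t z = P (z - a 0).
  by rewrite -[RHS]avg_cst; congr avg; apply/funext => r; rewrite ac.
rewrite !D umid -P0 => hx hy.
have hy' : y - a 0 <= rho.
  rewrite leNgt; apply/negP => /ltW h; have h3 := P_ni h.
  have : k0 * (rho - 0) <= P 0 - P rho by apply: P_strict => //; rewrite ?oppr_le0 ltW.
  by move: hy kr; rewrite ler_norml => /andP[]; move: h3; clra.
have hx' : - rho <= x - a 0.
  rewrite leNgt; apply/negP => /ltW h; have h3 := P_ni h.
  have : k0 * (0 - - rho) <= P (- rho) - P 0 by apply: P_strict => //; rewrite ?oppr_le0 ltW.
  by move: hx kr; rewrite ler_norml => /andP[]; move: h3; clra.
by move: hx' hy'; clra.
Qed.

Lemma P_gap (X Y delta : R) : X < rho / 2 -> - (rho / 2) < Y -> delta <= Y - X -> 0 < delta ->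
  k0 * Num.min delta (rho / 2) <= P X - P Y.
Proof.
move=> hX hY XY d0.
pose X' := Num.max X (- rho); pose Y' := Num.min Y rho.
have XX' : X <= X' by rewrite le_max lexx.
have rX' : - rho <= X' by rewrite le_max lexx orbT.
have YY' : Y' <= Y by rewrite ge_min lexx.
have rY' : Y' <= rho by rewrite ge_min lexx orbT.
have m0 : 0 <= Num.min delta (rho / 2) by rewrite le_min ltW//= divr_ge0// ltW.
have gap : Num.min delta (rho / 2) <= Y' - X'.
  have md : Num.min delta (rho / 2) <= delta by rewrite ge_min lexx.
  have mr : Num.min delta (rho / 2) <= rho / 2 by rewrite ge_min lexx orbT.
  rewrite /X' /Y'; have [h1|h1] := lerP X (- rho); have [h2|h2] := lerP Y rho;
    by move: md mr h1 h2 hX hY XY rho_gt0; clra.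
have h1 := P_ni XX'; have h2 := P_ni YY'.
have XY' : X' <= Y' by rewrite -subr_ge0; apply: le_trans gap.
have h3 := P_strict rX' XY' rY'.
have h4 : k0 * Num.min delta (rho / 2) <= k0 * (Y' - X') by rewrite ler_pM2l.
by move: h1 h2 h3 h4; clra.
Qed.

(** The position a(t + h) solves the equation at time t + h, and the delayed average
    changes slowly in time. *)
Lemma delayed_at_past_front (a : R -> R) (u e : R) : asymptotic_front a u -> 0 < e ->
  exists2 d, 0 < d & exists T, forall t h, T <= t -> `|h| <= d -> `|delayed a t (a (t + h)) - u| <= e.
Proof.
move=> [ca a0 aJ] e0; have e20 : 0 < e / 2 by rewrite divr_gt0.
have [d d0 Hd] := delayed_time ca e20; have [T HT] := aJ _ e20.
exists d => //; exists (T + d) => t h Tt hd.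
have Tth : T <= t + h by move: hd Tt; rewrite ler_norml => /andP[]; clra.
have := HT _ Tth; have := Hd (t + h) t (a (t + h)).
rewrite opprD addrA subrr add0r normrN => /(_ hd).
by rewrite !ler_norml => /andP[h1 h2] /andP[h3 h4]; apply/andP; split; move: h1 h2 h3 h4; clra.
Qed.

(** The recent positions z = a(t - r) are themselves almost on the level set of J_t.
    If x, y in this set are more than w - rho / 2 apart, then x - z < rho / 2 and
    y - z > - rho / 2, where P has a definite slope: J_t(x) and J_t(y) cannot both
    be close to u. *)
Lemma level_width_shrink (a : R -> R) (u w delta : R) : asymptotic_front a u -> 0 < delta ->
  level_width a u w -> level_width a u (Num.max delta (w - rho / 2)).
Proof.
move=> F d0 [e [T [e0 H]]]; have [ca a0 aJ] := F.
have [r0 r00 [T' H']] := delayed_at_past_front F e0.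
have [c c0 Hc] := g_lb r00.
pose m := k0 * Num.min delta (rho / 2).
have m0 : 0 < m by rewrite mulr_gt0// lt_min d0 divr_gt0.
pose e' := Num.min e (m * c * r0 / 4).
have mc0 : 0 < m * c * r0 by rewrite mulr_gt0// mulr_gt0.
have e'0 : 0 < e' by rewrite lt_min e0 divr_gt0.
have e'e : e' <= e by rewrite ge_min lexx.
have e'm : e' <= m * c * r0 / 4 by rewrite ge_min lexx orbT.
exists e', (Num.max T T'); split => // t x y; rewrite ge_max => /andP[Tt T't] hx hy.
rewrite leNgt; apply/negP; rewrite gt_max => /andP[h1 h2].
have hx' := le_trans hx e'e; have hy' := le_trans hy e'e.
have bw : bounded_measurable (fun r => P (x - a (t - r)) - P (y - a (t - r))).
  by apply: bounded_measurableB; exact: bounded_measurable_history.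
have xy : x <= y by move: h1 d0; clra.
have H1 r : 0 < r -> 0 <= P (x - a (t - r)) - P (y - a (t - r)).
  by move=> _; rewrite subr_ge0; apply: P_ni; rewrite lerD2r.
have H2 r : 0 < r <= r0 -> m <= P (x - a (t - r)) - P (y - a (t - r)).
  move=> /andP[rp rr0].
  have rn : `|- r| <= r0 by rewrite normrN gtr0_norm.
  have hz := H' t (- r) T't rn.
  have z1 := H t _ y Tt hz hy'; have z2 := H t x _ Tt hx' hz.
  apply: P_gap => //; [move: z1 h2|move: z2 h2|move: h1]; clra.
have r01 : r0 < r0 + 1 by rewrite ltrDl.
have := avg_lb bw Hc (ltW c0) (lexx 0) (ltW r00) (lexx r0) (ltW m0) (lexx 0)
  (fun r rp _ => H1 r rp) H2 _ r01.
rewrite oppr0 mul0r !subr0 => /(_ H1).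
rewrite avgB; [|exact: bounded_measurable_history|exact: bounded_measurable_history].
rewrite -/(delayed a t x) -/(delayed a t y).
move: hx hy; rewrite !ler_norml => /andP[_ x2] /andP[y1 _].
by move: e'm mc0 x2 y1; clra.
Qed.

Lemma level_width_small (a : R -> R) (u w delta : R) : asymptotic_front a u -> 0 < delta ->
  level_width a u w -> level_width a u delta.
Proof.
move=> F d0 W.
have {}W n : level_width a u (Num.max delta (w - n%:R * (rho / 2))).
  elim: n => [|n IH]; first by apply: le_level_width W; rewrite mul0r subr0 le_max lexx orbT.
  apply: le_level_width (level_width_shrink F d0 IH).
  rewrite ge_max le_max lexx/= lerBlDr ge_max; apply/andP; split.
    by rewrite ler_wpDr ?le_max ?lexx// divr_ge0// ltW.
  rewrite -lerBlDr le_max; apply/orP; right.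
  by rewrite -[n.+1%:R]natr1 mulrDl mul1r opprD addrA.
pose n := (Num.truncn (w / (rho / 2))).+1.
have r2 : 0 < rho / 2 by rewrite divr_gt0.
apply: le_level_width (W n); rewrite ge_max lexx/= lerBlDr.
rewrite ler_wpDl ?(ltW d0)// -ler_pdivrMr//.
exact: ltW (truncnS_gt _).
Qed.

Lemma front_equicontinuous (a : R -> R) (u w delta : R) : asymptotic_front a u -> 0 < delta ->
  level_width a u w ->
  exists2 d, 0 < d & exists T, forall t h, T <= t -> `|h| <= d -> `|a (t + h) - a t| <= delta.
Proof.
move=> F d0 W; have [e [T [e0 H]]] := level_width_small F d0 W.
have [d d_gt0 [T' H']] := delayed_at_past_front F e0.
exists d => //; exists (Num.max T T') => t h; rewrite ge_max => /andP[Tt T't] hd.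
have h1 := H' t h T't hd.
have h2 : `|delayed a t (a t) - u| <= e.
  by have := H' t 0 T't; rewrite normr0 addr0 => /(_ (ltW d_gt0)).
have h3 := H _ _ _ Tt h1 h2; have h4 := H _ _ _ Tt h2 h1.
by rewrite ler_norml lerNl opprB h3 h4.
Qed.

(** * The level of a wave of given speed *)

Definition wave_level (c : R) : R := avg (fun r => P (c * r)).

Lemma bounded_measurable_wave (c : R) : bounded_measurable (fun r => P (c * r)).
Proof. by apply: bounded_measurable_P; exact: measurable_funM. Qed.

Lemma wave_levelN (c : R) : wave_level (- c) = kap - wave_level c.
Proof.
rewrite -[in RHS](avg_cst kap) -avgB; last 2 first.
- exact: bounded_measurable_cst.
- exact: bounded_measurable_wave.
by congr avg; apply/funext => r; rewrite mulNr P_sym.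
Qed.

(** An estimate on (0, S) costs at most kap times the mass beyond S. *)
Lemma avg_le_trunc (w1 w2 : R -> R) (S e : R) : 0 < S -> bounded_measurable w1 -> bounded_measurable w2 ->
  (forall r, 0 < r -> r < S -> w1 r <= w2 r + e) -> (forall r, 0 < r -> w1 r <= w2 r + e + kap) ->
  avg w1 <= avg w2 + e + kap * tail_mass S.
Proof.
move=> S0 b1 b2 h1 h2.
have [c c0 Hc] := g_lb S0.
have b3 : bounded_measurable (fun r => w2 r + e).
  by apply: bounded_measurableD => //; exact: bounded_measurable_cst.
have bw : bounded_measurable (fun r => w2 r + e - w1 r) by apply: bounded_measurableB.
have H1 r : 0 < r -> r < S -> 0 <= w2 r + e - w1 r by move=> r0 rS; rewrite subr_ge0 h1.
have H2 r : 0 < r <= 0 -> 0 <= w2 r + e - w1 r.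
  by move=> /andP[x1 x2]; have := lt_le_trans x1 x2; rewrite ltxx.
have H3 r : 0 < r -> - kap <= w2 r + e - w1 r.
  by move=> r0; have := h2 r r0; clra.
have := avg_lb bw Hc (ltW c0) (lexx 0) (lexx 0) (ltW S0) (lexx 0) (ltW kap_gt0) H1 H2 H3 S0.
rewrite avgB// avgD//; last exact: bounded_measurable_cst.
by rewrite avg_cst !mul0r sub0r; clra.
Qed.

(** P decreases strictly near 0, so small r already make a difference. *)
Lemma wave_level_dec (c c' : R) : c < c' -> wave_level c' < wave_level c.
Proof.
move=> cc'.
pose q := `|c| + `|c'| + 1.
have q0 : 0 < q by rewrite ltr_wpDl// addr_ge0.
pose rb := rho / q.
have rb0 : 0 < rb by rewrite divr_gt0.
have rb2 : 0 < rb / 2 by rewrite divr_gt0.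
have [b b0 Hb] := g_lb rb0.
have bw : bounded_measurable (fun r => P (c * r) - P (c' * r)).
  by apply: bounded_measurableB; exact: bounded_measurable_wave.
have cr r : 0 < r -> c * r <= c' * r by move=> r0; rewrite ler_pM2r// ltW.
have H1 r : 0 < r -> 0 <= P (c * r) - P (c' * r).
  by move=> r0; rewrite subr_ge0; exact/P_ni/cr.
pose m := k0 * (c' - c) * (rb / 2).
have m0 : 0 < m by rewrite mulr_gt0// mulr_gt0// subr_gt0.
have bd x r : `|x| <= q -> 0 < r -> r <= rb -> `|x * r| <= rho.
  move=> xq r0 rr; rewrite normrM (gtr0_norm r0).
  have -> : rho = q * rb by rewrite /rb mulrC divfK// gt_eqF.
  by apply: ler_pM => //; exact: ltW.
have cq : `|c| <= q by rewrite /q; have := normr_ge0 c'; clra.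
have c'q : `|c'| <= q by rewrite /q; have := normr_ge0 c; clra.
have H2 r : rb / 2 < r <= rb -> m <= P (c * r) - P (c' * r).
  move=> /andP[r1 r2]; have r0 : 0 < r by apply: lt_trans r1.
  have := bd c r cq r0 r2; have := bd c' r c'q r0 r2.
  rewrite !ler_norml => /andP[_ h1] /andP[h2 _].
  have := P_strict h2 (cr r r0) h1; apply: le_trans.
  rewrite -mulrBl mulrA /m ler_pM2l; first exact: ltW.
  by rewrite mulr_gt0// subr_gt0.
have rb12 : rb / 2 <= rb by rewrite ger_pMr// invf_le1// ler1n.
have rbS : rb < rb + 1 by rewrite ltrDl.
have := avg_lb bw Hb (ltW b0) (ltW rb2) rb12 (lexx rb) (ltW m0) (lexx 0) (fun r r0 _ => H1 r r0) H2 _ rbS.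
rewrite oppr0 mul0r subr0 => /(_ H1).
rewrite avgB; [|exact: bounded_measurable_wave|exact: bounded_measurable_wave].
rewrite -subr_gt0; apply: lt_le_trans.
by rewrite mulr_gt0//; [rewrite mulr_gt0|rewrite subr_gt0 gtr_pMr// invf_lt1// ltr1n].
Qed.

Lemma wave_level_continuous : continuous wave_level.
Proof.
have key (c c' S : R) : 0 < S -> c <= c' ->
    0 <= wave_level c - wave_level c' <= Lam * (c' - c) * S + kap * tail_mass S.
  move=> S0 cc'; apply/andP; split.
    rewrite subr_ge0; apply: avg_le; try exact: bounded_measurable_wave.
    by move=> r r0; apply: P_ni; rewrite ler_pM2r.
  have h0 : 0 <= Lam * (c' - c) * S by rewrite !mulr_ge0 ?subr_ge0 ?(ltW S0) ?(ltW Lam_gt0).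
  have := @avg_le_trunc (fun r => P (c * r)) (fun r => P (c' * r)) S (Lam * (c' - c) * S) S0
    (bounded_measurable_wave c) (bounded_measurable_wave c').
  rewrite -/(wave_level c) -/(wave_level c') => H.
  have : wave_level c <= wave_level c' + Lam * (c' - c) * S + kap * tail_mass S; last by clra.
  apply: H => [r r0 rS|r r0].
    have h : c * r <= c' * r by rewrite ler_pM2r.
    have := P_lip h; rewrite -mulrBl mulrA.
    have : Lam * (c' - c) * r <= Lam * (c' - c) * S.
      by apply: ler_wpM2l (ltW rS); rewrite mulr_ge0 ?subr_ge0 ?(ltW Lam_gt0).
    by clra.
  by have := P_le (c * r); have := P_ge0 (c' * r); move: h0; clra.
move=> c; apply/cvgrPdist_le => e e0.
have ek : 0 < e / (2 * kap) by rewrite divr_gt0// mulr_gt0.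
have [S S0 /(_ S (lexx S)) HS] := tail_mass_cvg0 ek.
have {}HS : kap * tail_mass S <= e / 2 by rewrite mulrC -ler_pdivlMr// -mulrA -invfM.
have LS : 0 < Lam * S by rewrite mulr_gt0.
near=> c'.
have cc' : `|c - c'| <= e / (2 * (Lam * S)).
  by near: c'; apply: cvgr_dist_le; rewrite ?divr_gt0// mulr_gt0.
have {}cc' : Lam * `|c - c'| * S <= e / 2.
  rewrite mulrAC [X in X <= _]mulrC -ler_pdivlMr//.
  by apply: le_trans cc' _; rewrite -mulrA -invfM.
have [h|/ltW h] := lerP c c'.
  have /andP[x1 x2] := key c c' S S0 h.
  by rewrite ger0_norm//; move: cc'; rewrite ler0_norm ?subr_le0// opprB; move: x2 HS; clra.
have /andP[x1 x2] := key c' c S S0 h.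
by rewrite distrC ger0_norm//; move: cc'; rewrite ger0_norm ?subr_ge0//; move: x2 HS; clra.
Unshelve. all: by end_near. Qed.

Lemma wave_level_small (e : R) : 0 < e -> exists c, wave_level c <= e.
Proof.
move=> e0.
have cv : avg (fun r => P (n.+1%:R * r)) @[n --> \oo] --> avg (fun=> 0).
  apply: (@avg_cvg _ _ kap) => //.
  - by move=> n; exact: (bounded_measurable_wave _).1.
  - by move=> n r; rewrite ger0_norm ?P_ge0 ?P_le.
  - move=> r r0; apply/cvgrPdist_le => eps eps0.
    have [q q0 Pq] := P_cvg0 eps0.
    near=> n; rewrite sub0r normrN ger0_norm ?P_ge0//.
    apply: le_trans Pq; apply: P_ni; rewrite -ler_pdivrMr//.
    near: n; exists (Num.truncn (q / r)) => // n /= qn.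
    by rewrite (le_trans (ltW (truncnS_gt (q / r))))// ler_nat ltnS.
rewrite avg_cst in cv.
have := @cvgr_le R _ _ _ _ _ cv e e0 => -[N _ /(_ N (leqnn N))] /= HN.
by exists N.+1%:R.
Unshelve. all: by end_near. Qed.

Lemma wave_speed (u : R) : 0 < u -> u < kap -> exists c, unique (fun c => u = wave_level c) c.
Proof.
move=> u0 uk.
have [c2 h2] := wave_level_small u0.
have uk' : 0 < kap - u by rewrite subr_gt0.
have [c1' h1'] := wave_level_small uk'.
pose c1 := - c1'.
have h1 : u <= wave_level c1 by rewrite wave_levelN; move: h1'; clra.
have c12 : c1 <= c2.
  rewrite leNgt; apply/negP => /wave_level_dec h.
  by move: h h1 h2; clra.
have [c _ Ec] : exists2 c, c \in `[c1, c2] & wave_level c = u.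
  apply: IVT => //; first by apply: continuous_subspaceT; exact: wave_level_continuous.
  by rewrite ge_min le_max h1 h2 !orbT.
exists c; split => // c' Ec'.
have [h|h|//] := ltgtP c c'; have := wave_level_dec h; by rewrite Ec -Ec' ltxx.
Qed.

(** * Increments of the front *)

Section increments.
Variables (a : R -> R) (u h : R).
Hypothesis F : asymptotic_front a u.
Hypothesis equi : forall delta : R, 0 < delta ->
  exists2 d : R, 0 < d & exists T : R, forall t x : R, T <= t -> `|x| <= d -> `|a (t + x) - a t| <= delta.
Hypothesis h_gt0 : 0 < h.

Local Notation D t := (a (t + h) - a t).

Let ca : continuous a. Proof. by case: F. Qed.

Ltac clra_i := clear - R g g_ge0 g_le0 measurable_g g_mass g_cont g_lb P kap Lam rho k0
  kap_gt0 P_ni P_ge0 P_sym Lam_gt0 P_lip P_cvg0 rho_gt0 k0_gt0 P_strict a u h F equi h_gt0 ca; lra.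

(** By equicontinuity in finitely many short steps. *)
Lemma increment_bounded : exists C T : R, forall t : R, T <= t -> `|D t| <= C.
Proof.
have [d d0 [T HT]] := equi ltr01.
have stepn n t x : T <= t -> 0 <= x -> x <= n%:R * d -> `|a (t + x) - a t| <= n%:R.
  elim: n x => [|n IH] x Tt x0 xn.
    have -> : x = 0 by apply/eqP; rewrite eq_le x0 andbT; move: xn; rewrite mul0r.
    by rewrite addr0 subrr normr0.
  have [xd|/ltW dx] := lerP x d.
    by apply: (le_trans (HT t x Tt _)); rewrite ?ger0_norm// ler1n.
  have xd0 : 0 <= x - d by rewrite subr_ge0.
  have xdn : x - d <= n%:R * d by move: xn; rewrite -[n.+1%:R]natr1 mulrDl mul1r lerBlDr.
  have h1 := IH _ Tt xd0 xdn.
  have Tt' : T <= t + (x - d) by rewrite ler_wpDr.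
  have dd : `|d| <= d by rewrite gtr0_norm.
  have := HT _ d Tt' dd; rewrite -addrA subrK => h2.
  rewrite -[n.+1%:R]natr1 -(subrK (a (t + (x - d))) (a (t + x))) -addrA.
  by rewrite (le_trans (ler_normD _ _))// [leRHS]addrC lerD.
pose n := (Num.truncn (h / d)).+1.
exists n%:R, T => t Tt; apply: stepn => //; first exact: ltW.
by rewrite -ler_pdivrMr// ltW// truncnS_gt.
Qed.

(** M is the upper limit of the increments. *)
Lemma increment_limsup : exists M : R, (forall e : R, 0 < e -> exists T : R, forall t : R, T <= t -> D t <= M + e) /\
  (forall e T : R, 0 < e -> exists2 t : R, T <= t & M - e <= D t).
Proof.
have [C [T0 HC]] := increment_bounded.
pose S := [set m : R | exists T : R, forall t : R, T <= t -> D t <= m].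
have SC : S C by exists T0 => t Tt; have := HC t Tt; rewrite ler_norml => /andP[].
have lbS : lbound S (- C).
  move=> m [T HT]; have := HT (Num.max T T0); have := HC (Num.max T T0).
  rewrite !le_max !lexx orbT => /(_ isT); rewrite ler_norml => /andP[h1 _] /(_ isT).
  exact: le_trans.
have hS : has_inf S by split; [exists C|exists (- C)].
exists (inf S); split => [e e0|e T e0].
  have [m [T HT] me] := inf_adherent e0 hS.
  by exists T => t Tt; rewrite (le_trans (HT t Tt))// ltW.
apply: contrapT => /forall2NP H.
have : S (inf S - e).
  exists T => t Tt; case: (H t) => // /negP; by rewrite -ltNge => /ltW.
move=> /(ge_inf (ex_intro _ _ lbS)).
by rewrite lerBrDr gerDl leNgt e0.
Qed.

Variable M : R.
Hypothesis M_ub : forall e : R, 0 < e -> exists T : R, forall t : R, T <= t -> D t <= M + e.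

Ltac clra_M := clear - R g g_ge0 g_le0 measurable_g g_mass g_cont g_lb P kap Lam rho k0
  kap_gt0 P_ni P_ge0 P_sym Lam_gt0 P_lip P_cvg0 rho_gt0 k0_gt0 P_strict a u h F equi h_gt0 ca M M_ub; lra.

(** Put x(s) = a(t) - a(t - s) and y(s) = a(t + h) - a(t + h - s). The averages of P(x)
    and P(y) are both almost u, and y - x = D(t) - D(t - s) is almost
    nonnegative because D(t) is almost maximal: P(x) - P(y) is almost
    nonnegative with almost zero average. If D(t - r) were below M - e, then y - x would
    stay above e / 2 on a window next to r, on which x is small because r <= sigma, and
    the slope of P near 0 would make that average positive. *)
Lemma increment_propagation : exists2 sigma : R, 0 < sigma & forall e : R, 0 < e ->
  exists2 e' : R, 0 < e' & exists T : R, forall t r : R, T <= t -> M - e' <= D t -> 0 <= r -> r <= sigma ->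
    M - e <= D (t - r).
Proof.
have rho4 : 0 < rho / 4 by rewrite divr_gt0.
have [s2 s20 [T0 H0]] := equi rho4.
pose sigma := s2 / 2; have sigma0 : 0 < sigma by rewrite divr_gt0.
have s2E : s2 = sigma + sigma by rewrite /sigma; field.
exists sigma => // e e0.
have e80 : 0 < e / 8 by rewrite divr_gt0.
have [d d0 [Te He]] := equi e80.
pose l := Num.min d sigma.
have l0 : 0 < l by rewrite lt_min d0.
have ld : l <= d by rewrite ge_min lexx.
have ls : l <= sigma by rewrite ge_min lexx orbT.
have [c c0 Hc] := g_lb s20.
have e20 : 0 < e / 2 by rewrite divr_gt0.
pose m := k0 * Num.min (e / 2) (rho / 2).
have m0 : 0 < m by rewrite mulr_gt0// lt_min e20 divr_gt0.
pose q := m * c * l.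
have q0 : 0 < q by rewrite mulr_gt0// mulr_gt0.
pose e' := Num.min (e / 4) (q / (8 * Lam)).
have e'0 : 0 < e' by rewrite lt_min (divr_gt0 e0)// (divr_gt0 q0)// mulr_gt0.
have e'e : e' <= e / 4 by rewrite ge_min lexx.
have e'q : 2 * Lam * e' <= q / 4.
  have : e' <= q / (8 * Lam) by rewrite ge_min lexx orbT.
  by rewrite ler_pdivlMr ?mulr_gt0//; clra_M.
exists e' => //.
have [T1 HT1] := M_ub e'0.
have qk : 0 < q / (4 * kap) by rewrite (divr_gt0 q0)// mulr_gt0.
have [S S0 HS] := tail_mass_cvg0 qk.
have q80 : 0 < q / 8 by rewrite (divr_gt0 q0).
have [_ _ /(_ _ q80)[T2 HT2]] := F.
exists (Num.max (Num.max T0 (Te + s2)) (Num.max (T1 + S + s2 + 1) T2)) => t r.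
rewrite !ge_max => /andP[/andP[T0t Tet] /andP[T1t T2t]] Dt r0 rs.
rewrite leNgt; apply/negP => bad.
pose x s := a t - a (t - s); pose y s := a (t + h) - a (t + h - s).
have xy s : y s - x s = D t - D (t - s).
  by rewrite /x /y -(addrA t) (addrC h) addrA; ring.
have bx : bounded_measurable (fun s => P (x s)) by exact: bounded_measurable_history.
have by_ : bounded_measurable (fun s => P (y s)) by exact: bounded_measurable_history.
have b3 : bounded_measurable (fun s => P (x s) + 2 * Lam * e').
  by apply: bounded_measurableD => //; exact: bounded_measurable_cst.
have bw : bounded_measurable (fun s => P (x s) + 2 * Lam * e' - P (y s)).
  exact: bounded_measurableB.
have H1 s : 0 < s -> s < t - T1 -> 0 <= P (x s) + 2 * Lam * e' - P (y s).
  move=> s0 st; have T1s : T1 <= t - s by move: st; clra_M.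
  have h1 := HT1 _ T1s.
  have xy1 : x s - 2 * e' <= y s by have := xy s; move: Dt h1; clra_M.
  have h2 := P_ni xy1.
  have h3 : x s - 2 * e' <= x s by rewrite gerBl mulr_ge0// ltW.
  have := P_lip h3; move: h2.
  have -> : x s - (x s - 2 * e') = 2 * e' by ring.
  by clra_M.
have H2 s : r < s <= r + l -> m <= P (x s) + 2 * Lam * e' - P (y s).
  move=> /andP[s1 s2'].
  have s0 : 0 < s by apply: le_lt_trans s1.
  have ss2 : s <= s2 by rewrite s2E; move: s2' rs ls; clra_M.
  have hx : `|a (t + (- s)) - a t| <= rho / 4 by apply: H0 => //; rewrite normrN gtr0_norm.
  have Tr : Te <= t - r by move: Tet rs sigma0; rewrite s2E; clra_M.
  have Trh : Te <= t - r + h by rewrite ler_wpDr// ltW.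
  have sr : `|r - s| <= d.
    by rewrite ler0_norm ?subr_le0 ?(ltW s1)// opprB; move: s2' ld; clra_M.
  have hy1 := He _ _ Tr sr; have hy2 := He _ _ Trh sr.
  have E1 : t - r + (r - s) = t - s by ring.
  have E2 : t - r + h + (r - s) = t - s + h by ring.
  rewrite E1 in hy1; rewrite E2 in hy2.
  have gap : e / 2 <= y s - x s.
    rewrite xy; move: hy1 hy2 bad Dt e'e e0; rewrite !ler_norml => /andP[a1 a2] /andP[a3 a4].
    by move: a1 a2 a3 a4; clra_M.
  have X1 : x s < rho / 2 /\ - (rho / 2) < x s.
    by rewrite /x /=; move: hx rho_gt0; rewrite ler_norml => /andP[h1 h2] h3; split; move: h1 h2 h3; clra_M.
  have Y1 : - (rho / 2) < y s by move: X1 gap e0 => [_]; clra_M.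
  have h1 := P_gap X1.1 Y1 gap e20; rewrite -/m in h1.
  have h2 : 0 <= 2 * Lam * e' by rewrite !mulr_ge0 ?(ltW e'0) ?(ltW Lam_gt0).
  by move: h1 h2; clra_M.
have H3 s : 0 < s -> - kap <= P (x s) + 2 * Lam * e' - P (y s).
  move=> s0; have := P_ge0 (x s); have := P_le (y s).
  have h2 : 0 <= 2 * Lam * e' by rewrite !mulr_ge0 ?(ltW e'0) ?(ltW Lam_gt0).
  by move: h2; clra_M.
have rl : r <= r + l by rewrite lerDl ltW.
have rls : r + l <= s2 by rewrite s2E; move: rs ls; clra_M.
have rlS : r + l < t - T1 by move: rls T1t S0; clra_M.
have := avg_lb bw Hc (ltW c0) r0 rl rls (ltW m0) (ltW kap_gt0) H1 H2 H3 rlS.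
rewrite avgB// avgD//; last exact: bounded_measurable_cst.
rewrite avg_cst -/(delayed a t (a t)) -/(delayed a (t + h) (a (t + h))).
have -> : m * c * (r + l - r) = q by rewrite addrAC subrr add0r.
have T2th : T2 <= t + h by rewrite ler_wpDr// ltW.
have := HT2 t T2t; have := HT2 _ T2th; rewrite !ler_norml => /andP[j1 j2] /andP[j3 j4].
have St : S <= t - T1 by move: T1t s20; clra_M.
have HSt : kap * tail_mass (t - T1) <= q / 4.
  by rewrite mulrC -ler_pdivlMr// -mulrA -invfM; exact: HS.
by move: j1 j2 j3 j4 HSt q0 e'q; clra_M.
Qed.

Lemma increment_propagation_far (L e : R) : 0 < e ->
  exists2 e' : R, 0 < e' & exists T : R, forall t r : R, T <= t -> M - e' <= D t -> 0 <= r -> r <= L ->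
    M - e <= D (t - r).
Proof.
move=> e0; have [sigma sigma0 prop] := increment_propagation.
have iter n : exists2 e' : R, 0 < e' & exists T : R, forall t r : R, T <= t -> M - e' <= D t ->
    0 <= r -> r <= n%:R * sigma -> M - e <= D (t - r).
  elim: n => [|n [e1 e10 [T1 H1]]].
    exists e => //; exists 0 => t r _ Dt r0; rewrite mul0r => r1.
    by have -> : r = 0 by [apply/eqP; rewrite eq_le r0 r1]; rewrite subr0.
  have [e2 e20 [T2 H2]] := prop _ e10.
  exists e2 => //; exists (Num.max T2 (T1 + sigma)) => t r; rewrite ge_max => /andP[T2t T1t] Dt r0 rn.
  have [rs|/ltW rs] := lerP r sigma.
    have Tr : T1 <= t - r by move: T1t rs; clra_M.
    have := H1 (t - r) 0 Tr (H2 t r T2t Dt r0 rs) (lexx 0).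
    by rewrite subr0; apply; rewrite mulr_ge0// ltW.
  have Ts : T1 <= t - sigma by move: T1t; clra_M.
  have rs0 : 0 <= r - sigma by rewrite subr_ge0.
  have rsn : r - sigma <= n%:R * sigma by move: rn; rewrite -[n.+1%:R]natr1 mulrDl mul1r lerBlDr.
  have := H1 (t - sigma) (r - sigma) Ts (H2 t sigma T2t Dt (ltW sigma0) (lexx _)) rs0 rsn.
  by have -> : t - sigma - (r - sigma) = t - r by ring.
pose n := (Num.truncn (L / sigma)).+1.
have [e' e'0 [T H]] := iter n; exists e' => //; exists T => t r Tt Dt r0 rL.
by apply: H => //; rewrite (le_trans rL)// -ler_pdivrMr// ltW// truncnS_gt.
Qed.

Hypothesis M_lb : forall e T : R, 0 < e -> exists2 t : R, T <= t & M - e <= D t.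

Ltac clra_L := clear - R g g_ge0 g_le0 measurable_g g_mass g_cont g_lb P kap Lam rho k0
  kap_gt0 P_ni P_ge0 P_sym Lam_gt0 P_lip P_cvg0 rho_gt0 k0_gt0 P_strict a u h F equi h_gt0 ca M M_ub M_lb; lra.

(** See the increments as a perturbation of those of a line of slope M / h: on a long
    window b(s) = a(s) - (M / h) s grows by at least - e over a period h, so it is at most
    n e above its maximum over the last period. From that maximum point s0 the past of
    the front lies behind the line, up to n e, and J_(s0)(a(s0)) <= w(M / h) + small. *)
Lemma increment_limsup_level : u <= wave_level (M / h).
Proof.
rewrite leNgt; apply/negP => bad.
pose eta := u - wave_level (M / h).
have eta0 : 0 < eta by rewrite subr_gt0.
have ek : 0 < eta / (4 * kap) by rewrite (divr_gt0 eta0)// mulr_gt0.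
have [S S0 /(_ S (lexx S)) HS] := tail_mass_cvg0 ek.
have {}HS : kap * tail_mass S <= eta / 4 by rewrite mulrC -ler_pdivlMr// -mulrA -invfM.
pose n := (Num.truncn (S / h)).+1.
have nS : S <= n%:R * h by rewrite -ler_pdivrMr// ltW// truncnS_gt.
have n0 : 0 < n%:R :> R by rewrite ltr0n.
pose e := eta / (4 * (Lam * n%:R)).
have Ln0 : 0 < Lam * n%:R by rewrite mulr_gt0.
have e0 : 0 < e by rewrite (divr_gt0 eta0)// mulr_gt0.
have Le : Lam * (n%:R * e) = eta / 4.
  by rewrite mulrA mulrC /e; field; rewrite !gt_eqF.
have [e' e'0 [T HT]] := increment_propagation_far (n.+1%:R * h) e0.
have eta40 : 0 < eta / 4 by rewrite (divr_gt0 eta0).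
have [_ _ /(_ _ eta40)[T3 HT3]] := F.
have [t Tt Dt] := M_lb (Num.max T (T3 + h)) e'0.
move: Tt; rewrite ge_max => /andP[Tt T3t].
have past s : t - n.+1%:R * h <= s -> s <= t -> M - e <= D s.
  move=> s1 s2; have := HT t (t - s) Tt Dt; rewrite subr_ge0 => /(_ s2).
  by rewrite subKr; apply; move: s1; clra_L.
pose b s := a s - M / h * s.
have bD s : b (s + h) - b s = D s - M.
  by rewrite /b; field; rewrite gt_eqF.
have th : t - h <= t by rewrite gerBl ltW.
have [s0 s0I s0max] : exists2 s, s \in `[t - h, t] & forall r, r \in `[t - h, t] -> b r <= b s.
  apply: EVT_max => //; apply: continuous_subspaceT => s; apply: cvgB; first exact: ca.
  by apply: cvgM; [exact: cvg_cst|exact: cvg_id].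
move: s0I; rewrite in_itv/= => /andP[s01 s02].
have E (k : nat) (z : R) : k.+1%:R * z = k%:R * z + z by rewrite -[k.+1%:R]natr1 mulrDl mul1r.
have climb k s : (k <= n)%N -> t - k.+1%:R * h <= s -> s <= t -> b s <= b s0 + k%:R * e.
  elim: k s => [|k IH] s kn s1 s2.
    by rewrite mul0r addr0; apply: s0max; rewrite in_itv/= s2 andbT; move: s1; rewrite mul1r.
  have [sh|sh] := lerP (t - h) s.
    have : b s <= b s0 by apply: s0max; rewrite in_itv/= s2 sh.
    by move=> bs; apply: (le_trans bs); rewrite lerDl mulr_ge0// ltW.
  have s1' : t - k.+1%:R * h <= s + h by move: s1; rewrite (E k.+1); clra_L.
  have s2' : s + h <= t by move: sh; clra_L.
  have h1 := IH (s + h) (ltnW kn) s1' s2'.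
  have s3 : t - n.+1%:R * h <= s.
    apply: le_trans s1; rewrite lerD2l lerN2 ler_pM2r// ler_nat.
    by rewrite ltnS.
  have := past s s3 s2; have := bD s; move: h1; rewrite (E k e); clra_L.
have s0S : T3 <= s0 by move: T3t s01; clra_L.
have bJ : bounded_measurable (fun r => P (a s0 - a (s0 - r))) by exact: bounded_measurable_history.
have e2 : 0 <= Lam * (n%:R * e) by rewrite Le ltW.
have := @avg_le_trunc (fun r => P (a s0 - a (s0 - r))) (fun r => P (M / h * r)) S (Lam * (n%:R * e)) S0
  bJ (bounded_measurable_wave _).
rewrite -/(delayed a s0 (a s0)) -/(wave_level (M / h)) => H.
have {}H : delayed a s0 (a s0) <= wave_level (M / h) + Lam * (n%:R * e) + kap * tail_mass S.
  apply: H => [r r0 rS|r r0]; last first.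
    by have := P_le (a s0 - a (s0 - r)); have := P_ge0 (M / h * r); move: e2; clra_L.
  have r1 : t - n.+1%:R * h <= s0 - r by rewrite (E n); move: rS nS s01; clra_L.
  have r2 : s0 - r <= t by move: s02 r0; clra_L.
  have := climb n (s0 - r) (leqnn n) r1 r2; rewrite /b mulrBr => cl.
  have h1 : M / h * r - n%:R * e <= a s0 - a (s0 - r) by move: cl; clra_L.
  have h2 : M / h * r - n%:R * e <= M / h * r by rewrite gerBl mulr_ge0// ltW.
  have h3 := P_ni h1; have h4 := P_lip h2; move: h3 h4.
  have -> : M / h * r - (M / h * r - n%:R * e) = n%:R * e by ring.
  by clra_L.
have := HT3 s0 s0S; rewrite ler_norml => /andP[j1 _].
by move: j1 H HS eta0; rewrite Le /eta; clra_L.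
Qed.

End increments.

Definition equicontinuous_at_infinity (a : R -> R) := forall delta : R, 0 < delta ->
  exists2 d : R, 0 < d & exists T : R, forall t x : R, T <= t -> `|x| <= d -> `|a (t + x) - a t| <= delta.

Lemma increment_upper_bound (a : R -> R) (u c h e : R) : asymptotic_front a u ->
  equicontinuous_at_infinity a -> u = wave_level c -> 0 < h -> 0 < e ->
  exists T : R, forall t : R, T <= t -> a (t + h) - a t <= c * h + e.
Proof.
move=> F equi uE h0 e0.
have [M [Mub Mlb]] := increment_limsup equi h0.
suff Mc : M <= c * h.
  have [T HT] := Mub e e0; exists T => t Tt.
  by apply: le_trans (HT t Tt) _; rewrite lerD2r.
rewrite -ler_pdivrMr// leNgt; apply/negP => /wave_level_dec.
by rewrite -uE ltNge (increment_limsup_level F equi h0 Mub Mlb).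
Qed.

Lemma increment_cvg (a : R -> R) (u w c r e : R) : asymptotic_front a u ->
  level_width a u w -> u = wave_level c -> 0 < r -> 0 < e ->
  exists T : R, forall t : R, T <= t -> `|a t - a (t - r) - c * r| <= e.
Proof.
move=> F W uE r0 e0.
have equi : equicontinuous_at_infinity a by move=> d d0; exact: front_equicontinuous F d0 W.
have equiN : equicontinuous_at_infinity (fun t => - a t).
  move=> d d0; have [d' d'0 [T HT]] := equi d d0.
  exists d' => //; exists T => t x Tt xd.
  by rewrite opprK addrC distrC; have := HT t x Tt xd; rewrite distrC.
have uEN : kap - u = wave_level (- c) by rewrite wave_levelN uE.
have [T1 H1] := increment_upper_bound F equi uE r0 e0.
have [T2 H2] := increment_upper_bound (asymptotic_frontN F) equiN uEN r0 e0.
exists (Num.max T1 T2 + r) => t; rewrite -lerBrDr ge_max => /andP[/H1 h1 /H2 h2].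
move: h1 h2; rewrite subrK mulNr => h1 h2.
by rewrite ler_norml; apply/andP; split; move: h1 h2; clra.
Qed.

(** * Convergence of the profile, and the half level *)

(** The difference of the integrands is at most the minimum of kap and of Lam times
    |a(t) - a(t - r) - c r|, which does not depend on z and tends to 0 for each r. *)
Lemma profile_cvg (a : R -> R) (c : R) : continuous a ->
  (forall r e : R, 0 < r -> 0 < e -> exists T : R, forall t : R, T <= t -> `|a t - a (t - r) - c * r| <= e) ->
  forall e : R, 0 < e -> exists T : R, forall t z : R, T <= t ->
    `|delayed a t (a t + z) - avg (fun r => P (z + c * r))| <= e.
Proof.
move=> ca inc e e0.
pose v t r := a t - a (t - r) - c * r.
pose w t r := Num.min kap (Lam * `|v t r|).
have mv t : measurable_fun [set: R] (v t).
  apply: measurable_funB; last exact: measurable_funM.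
  by apply: measurable_funB => //; exact: measurable_history.
have w0 t r : 0 <= w t r by rewrite le_min (ltW kap_gt0) mulr_ge0// ltW.
have wk t r : w t r <= kap by rewrite ge_min lexx.
have bw t : bounded_measurable (w t).
  split; last by exists kap => r; rewrite ger0_norm.
  apply: measurable_minr => //; apply: measurable_funM => //.
  exact: measurableT_comp.
have Pw (x y : R) : `|P x - P y| <= Num.min kap (Lam * `|x - y|).
  rewrite le_min; apply/andP; split.
    have := P_ge0 x; have := P_ge0 y; have := P_le x; have := P_le y => h1 h2 h3 h4.
    by rewrite ler_norml; apply/andP; split; move: h1 h2 h3 h4; clra.
  have [xy|/ltW yx] := lerP x y.
    by rewrite ger0_norm ?subr_ge0 ?P_ni//; exact: P_lip.
  by rewrite ler0_norm ?subr_le0 ?P_ni// opprB; exact: P_lip.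
have avg_w t z : `|delayed a t (a t + z) - avg (fun r => P (z + c * r))| <= avg (w t).
  have b1 : bounded_measurable (fun r => P (a t + z - a (t - r))) by exact: bounded_measurable_history.
  have b2 : bounded_measurable (fun r => P (z + c * r)).
    by apply: bounded_measurable_P; apply: measurable_funD => //; exact: measurable_funM.
  have h r : `|P (a t + z - a (t - r)) - P (z + c * r)| <= w t r.
    apply: le_trans (Pw _ _) _; rewrite /w /v.
    by have -> : a t + z - a (t - r) - (z + c * r) = a t - a (t - r) - c * r by ring.
  rewrite /delayed ler_norml -avgB//; apply/andP; split.
    rewrite -mulN1r -avgZ//; apply: avg_le => //.
    - exact: bounded_measurableZ.
    - exact: bounded_measurableB.
    - by move=> r _; have := h r; rewrite ler_norml mulN1r => /andP[].
  apply: avg_le => //; first exact: bounded_measurableB.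
  by move=> r _; have := h r; rewrite ler_norml => /andP[].
suff [T HT] : exists T : R, forall t : R, T <= t -> avg (w t) <= e.
  by exists T => t z Tt; apply: le_trans (avg_w t z) (HT t Tt).
apply: contrapT => H.
have {}H (n : nat) : exists t : R, n%:R <= t /\ e < avg (w t).
  apply: contrapT => H'; apply: H; exists n%:R => t nt.
  by rewrite leNgt; apply/negP => et; apply: H'; exists t.
have [tn Htn] := choice H.
have cv : avg (w (tn n)) @[n --> \oo] --> avg (fun=> 0).
  apply: (@avg_cvg _ _ kap) => //.
  - by move=> n; exact: (bw _).1.
  - by move=> n r; rewrite ger0_norm.
  - move=> r r0; apply/cvgrPdist_le => eps eps0.
    have eL : 0 < eps / Lam by rewrite divr_gt0.
    have [T HT] := inc r _ r0 eL.
    near=> n; rewrite sub0r normrN ger0_norm//.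
    rewrite /w ge_min; apply/orP; right.
    rewrite mulrC -ler_pdivlMr//; apply: HT.
    apply: le_trans (Htn n).1.
    near: n; exists (Num.truncn T).+1 => // n /= qn.
    by rewrite (le_trans (ltW (truncnS_gt T)))// ler_nat.
rewrite avg_cst in cv.
have := @cvgr_le R _ _ _ _ _ cv e e0 => -[N _ /(_ N (leqnn N))] /=.
by rewrite leNgt (Htn N).2.
Unshelve. all: by end_near. Qed.

(** At a positive time s where the front is at its running maximum, above a(0), every
    position reached in the past lies behind: P(a(s) - a(s - r)) <= kap / 2 for r < s. The
    frozen part r >= s of the average cancels against the term P(a(s) - a(0)) of the
    equation, which leaves kap / 2 <= kap / 2 + f(s) (v(a(s)) - kap / 2), although v is
    below kap / 2 beyond a(0). *)
Lemma half_level_front_le (a v : R -> R) : continuous a -> (forall s : R, s <= 0 -> a s = a 0) ->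
  (forall x y, x < y -> v y < v x) -> v (a 0) = kap / 2 ->
  (forall t : R, 0 < t -> 0 < tail_mass t) ->
  (forall t : R, 0 < t -> kap / 2 = delayed a t (a t) + tail_mass t * (v (a t) - P (a t - a 0))) ->
  forall t : R, a t <= a 0.
Proof.
move=> ca a0 vdec v0 f0 H t.
have [s st [smax _]] := runmax_attained ca a0 t.
apply: (le_trans (smax t (lexx t))); rewrite leNgt; apply/negP => as0.
have s0 : 0 < s by rewrite ltNge; apply/negP => /a0 E; move: as0; rewrite E ltxx.
have bI : bounded_measurable (\1_(`[s, +oo[) : R -> R).
  by apply: bounded_measurable_indic; exact: measurable_itv.
have b1 := bounded_measurableZ (P (a s - a 0) - kap / 2) bI.
have b2 := bounded_measurable_cst (kap / 2).
have : delayed a s (a s) <= kap / 2 + (P (a s - a 0) - kap / 2) * tail_mass s.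
  rewrite (_ : kap / 2 + _ = avg (fun r => kap / 2 + (P (a s - a 0) - kap / 2) * \1_(`[s, +oo[) r)).
    2: by rewrite avgD// avg_cst avgZ// tail_massE.
  apply: avg_le; first exact: bounded_measurable_history.
    exact: bounded_measurableD.
  move=> r r0; rewrite indicE mem_setE in_itv/= andbT.
  have [sr|rs] := lerP s r.
    by rewrite (a0 (s - r)) ?subr_le0//= mulr1 [leRHS]addrC subrK.
  rewrite /= mulr0 addr0 -P0; apply: P_ni; rewrite subr_ge0; apply: smax.
  by rewrite (le_trans _ st)// gerBl ltW.
have := vdec _ _ as0; rewrite v0 => h1.
have := f0 s s0; rewrite -subr_gt0 in h1 => h2; have h3 := mulr_gt0 h2 h1.
have := H s s0; move: h3; clra.
Qed.

Lemma half_level_front (a v : R -> R) : continuous a -> (forall s : R, s <= 0 -> a s = a 0) ->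
  (forall x y, x < y -> v y < v x) -> v (a 0) = kap / 2 ->
  (forall t : R, 0 < t -> 0 < tail_mass t) ->
  (forall t : R, 0 < t -> kap / 2 = delayed a t (a t) + tail_mass t * (v (a t) - P (a t - a 0))) ->
  forall t : R, a t = a 0.
Proof.
move=> ca a0 vdec v0 f0 H t; apply/eqP; rewrite eq_le (half_level_front_le ca a0 vdec v0 f0 H)/=.
rewrite -lerN2.
apply: (@half_level_front_le (fun t => - a t) (fun x => kap - v (- x))) => //.
- by move=> s; apply: cvgN; exact: ca.
- by move=> s s0; rewrite a0.
- by move=> x y xy; rewrite ltrD2l ltrN2 vdec// ltrN2.
- by rewrite opprK v0; clra.
- move=> s s0; rewrite delayedN// !opprK.
  have -> : - a s + a 0 = - (a s - a 0) by ring.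
  by rewrite P_sym; have := H s s0; clra.
Qed.

End delay_average.

(** * The tail integral of the connectivity kernel *)

Section tail_integral_theory.
Variables (R : realType) (K : R -> R).
Local Notation mu := (@lebesgue_measure R).
Hypothesis K_int : mu.-integrable [set: R] (EFin \o K).
Hypothesis K_ge0 : forall x, 0 <= K x.
Hypothesis K_sym : forall x, K x = K (- x).
Local Notation P := (tail_integral K).
Local Notation kap := (\int[mu]_y K y).

Lemma integrable_kernel (D : set R) : measurable D -> mu.-integrable D (EFin \o K).
Proof. by move=> mD; apply: integrableS K_int. Qed.

Lemma measurable_kernel : measurable_fun [set: R] K.
Proof. by apply/measurable_EFinP; exact: measurable_int K_int. Qed.

Lemma tail_integral_ge0 (x : R) : 0 <= P x.
Proof. exact: Rintegral_ge0. Qed.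

Lemma tail_integralB (x y : R) : x <= y -> P x - P y = \int[mu]_(s in `[x, y[) K s.
Proof.
move=> xy; rewrite /tail_integral.
rewrite (_ : [set` `[x, +oo[] = [set` `[x, y[] `|` [set` `[y, +oo[]); last first.
  by rewrite -itv_bndbnd_setU// bnd_simp.
rewrite Rintegral_setU//; first by rewrite addrK.
- by apply: integrable_kernel; exact: measurableU.
- apply/disj_set2P; rewrite -subset0 => z/=; rewrite !in_itv/= andbT => -[/andP[_]].
  by rewrite ltNge => /negbTE ->.
Qed.

Lemma tail_integral_ni (x y : R) : x <= y -> P y <= P x.
Proof. by move=> xy; rewrite -subr_ge0 tail_integralB//; exact: Rintegral_ge0. Qed.

Lemma Rintegral_cst_itv (k x y : R) : x <= y -> \int[mu]_(s in `[x, y[) k = k * (y - x).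
Proof.
move=> xy; rewrite Rintegral_cst; last exact: measurable_itv.
rewrite [X in fine X]lebesgue_measure_itv/= lte_fin.
case: ltP => [//|yx]; have -> : y = x by apply/eqP; rewrite eq_le xy yx.
by rewrite subrr.
Qed.

Lemma integrable_cst_itv (k x y : R) : mu.-integrable `[x, y[ (EFin \o cst k).
Proof.
apply/integrableP; split => //.
  by apply/measurable_EFinP; exact: measurable_cst.
rewrite [X in (X < _)%E](_ : _ = `|k|%:E * mu `[x, y[)%E; last first.
  by rewrite -(integral_cst mu)//; exact: measurable_itv.
rewrite [X in (_ * X)%E]lebesgue_measure_itv/=.
by case: ifP => _; rewrite ?mule0// -EFinB -EFinM ltry.
Qed.

Lemma tail_integral_lip (M x y : R) : (forall z, K z <= M) -> x <= y -> P x - P y <= M * (y - x).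
Proof.
move=> KM xy; rewrite tail_integralB// -Rintegral_cst_itv//.
apply: le_Rintegral => //; first exact: integrable_kernel.
exact: integrable_cst_itv.
Qed.

Lemma tail_integral_strict (rho k x y : R) : (forall z, `|z| <= rho -> k <= K z) ->
  - rho <= x -> x <= y -> y <= rho -> k * (y - x) <= P x - P y.
Proof.
move=> kK rx xy yr; rewrite tail_integralB// -Rintegral_cst_itv//.
apply: le_Rintegral => //; [exact: integrable_cst_itv|exact: integrable_kernel|].
move=> z /=; rewrite in_itv/= => /andP[xz zy]; apply: kK.
by rewrite ler_norml (le_trans rx xz) (le_trans (ltW zy) yr).
Qed.

Lemma tail_integral_indic (x : R) : (P x)%:E = (\int[mu]_y (K y * \1_(`[x, +oo[) y)%:E)%E.
Proof.
rewrite /tail_integral /Rintegral fineK; last exact/integrable_fin_num/integrable_kernel.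
rewrite integral_mkcond; apply: eq_integral => y _.
by rewrite patchE indicE; case: ifPn => _ /=; rewrite ?mulr1 ?mulr0.
Qed.

Lemma tail_integralN (x : R) : P (- x) = kap - P x.
Proof.
have E : P (- x) = \int[mu]_(y in `]-oo, x[) K y.
  apply: EFin_inj; rewrite tail_integral_indic -ge0_integral_opp; last 2 first.
  - apply/measurable_EFinP; apply: measurable_funM; first exact: measurable_kernel.
    by apply: measurable_indic; exact: measurable_itv.
  - by move=> y; rewrite lee_fin mulr_ge0.
  rewrite Rintegral_itv_bndo_bndc; last exact: integrable_kernel.
  rewrite /Rintegral fineK; last exact/integrable_fin_num/integrable_kernel.
  rewrite [RHS]integral_mkcond; apply: eq_integral => y _.
  rewrite patchE indicE !mem_setE !in_itv/= andbT lerN2 -K_sym.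
  by case: ifPn => _ /=; rewrite ?mulr1 ?mulr0.
rewrite E; apply/eqP; rewrite eq_sym subr_eq; apply/eqP.
rewrite /tail_integral -Rintegral_setU//.
- by rewrite -itv_bndbnd_setU// set_itvE.
- by apply: integrable_kernel; exact: measurableU.
- apply/disj_set2P; rewrite -subset0 => z/=; rewrite !in_itv/= andbT => -[].
  by rewrite ltNge => /negbTE ->.
Qed.

Lemma tail_integral_le (x : R) : P x <= kap.
Proof. by rewrite -subr_ge0 -tail_integralN tail_integral_ge0. Qed.

Lemma tail_integral_cvg0 (e : R) : 0 < e -> exists2 q, 0 < q & P q <= e.
Proof.
move=> e0.
have [|||||iw _ cv] := @dominated_convergence _ _ _ mu setT measurableT
   (fun n r => (K r * \1_(`[n.+1%:R, +oo[) r)%:E) (fun r => 0%E) (EFin \o K).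
- move=> n; apply/measurable_EFinP; apply: measurable_funM; first exact: measurable_kernel.
  by apply: measurable_indic; exact: measurable_itv.
- by [].
- apply: aeW => r _; apply: cvg_near_cst; near=> n.
  rewrite indicE mem_setE in_itv/= andbT leNgt.
  have -> /= : r < n.+1%:R; last by rewrite mulr0.
  near: n; exists (Num.truncn r) => // n /= rn.
  by rewrite (lt_le_trans (truncnS_gt r))// ler_nat ltnS.
- exact: K_int.
- apply: aeW => r n _ /=; rewrite lee_fin normrM (ger0_norm (K_ge0 r)) ler_piMr//.
  by rewrite indicE; case: (_ \in _); rewrite ?normr1 ?normr0.
rewrite integral0 in cv.
have {}cv : (P n.+1%:R)%:E @[n --> \oo] --> 0%:E.
  by under eq_fun do rewrite tail_integral_indic.
have {}cv : P n.+1%:R @[n --> \oo] --> 0 by exact: fine_cvg cv.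
have := @cvgr_le R _ _ _ _ _ cv e e0 => -[N _ /(_ N (leqnn N))] /= HN.
by exists N.+1%:R.
Unshelve. all: by end_near. Qed.

Variable h0 : R.

(** The arbitrary value of the Heaviside function at 0 matters at the single point a
    only. *)
Lemma heaviside_convolution (v : R -> R) (uT a x : R) :
  (forall y, y < a -> uT < v y) -> (forall y, a < y -> v y < uT) ->
  \int[mu]_y (K (x - y) * heaviside h0 (v y - uT)) = P (x - a).
Proof.
move=> va av; apply: EFin_inj.
pose F y := K (x - y) * \1_(`]-oo, a]) y.
pose G y := K (x - y) * (\1_(`]-oo, a[) y + heaviside h0 (v a - uT) * \1_[set a] y).
have mKx : measurable_fun [set: R] (fun y => K (x - y)).
  by apply: (measurableT_comp measurable_kernel); exact: measurable_funB.
have GE : G = fun y => K (x - y) * heaviside h0 (v y - uT).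
  apply/funext => y; rewrite /G; congr (_ * _).
  rewrite !indicE mem_setE in_itv/=.
  have [ya|ay|->] := ltgtP y a.
  - rewrite memNset/=; last by move=> E; rewrite E ltxx in ya.
    by rewrite mulr0 addr0 /heaviside subr_gt0 va.
  - rewrite memNset/=; last by move=> E; rewrite E ltxx in ay.
    rewrite mulr0 addr0 /heaviside subr_gt0 subr_lt0 av//.
    by rewrite ltNge ltW ?av.
  - by rewrite mem_set//= mulr1 add0r.
have FE : (\int[mu]_y (F y)%:E = (P (x - a))%:E)%E.
  rewrite tail_integral_indic -[RHS](ge0_integral_reflect x); last 2 first.
  - apply/measurable_EFinP; apply: measurable_funM; first exact: measurable_kernel.
    by apply: measurable_indic; exact: measurable_itv.
  - by move=> y; rewrite lee_fin mulr_ge0.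
  apply: eq_integral => y _; rewrite /F !indicE !mem_setE !in_itv/= andbT.
  by rewrite lerD2l lerN2.
rewrite -GE /Rintegral -[RHS]FE.
suff -> : (\int[mu]_y (G y)%:E = \int[mu]_y (F y)%:E)%E by rewrite FE.
apply: ae_eq_integral => //.
- apply/measurable_EFinP; apply: measurable_funM => //.
  apply: measurable_funD; first by apply: measurable_indic; exact: measurable_itv.
  by apply: measurable_funM => //; apply: measurable_indic; exact: measurable_set1.
- apply/measurable_EFinP; exact: measurable_funM.
- exists [set a]; split; [exact: measurable_set1|exact: lebesgue_measure_set1|].
  move=> y /= /not_implyP[_]; apply: contra_notP => /eqP ya.
  congr (_%:E); rewrite /G /F !indicE !mem_setE !in_itv/= le_eqVlt (negbTE ya)/=.
  by rewrite memNset ?mulr0 ?addr0//; exact/eqP.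
Qed.

End tail_integral_theory.

(** * The mild equation as a delay equation *)

Section mild_formulation.
Variables (R : realType) (alpha : R).
Hypothesis alpha01 : 0 < alpha < 1.
Local Notation mu := (@lebesgue_measure R).
Local Notation g := (ml_sum alpha alpha).

Let alpha_gt0 : 0 < alpha. Proof. by case/andP: alpha01. Qed.

Lemma ml_g0 : ml_g alpha 0 = 0.
Proof.
rewrite /ml_g powR0 ?mul0r// subr_eq0 lt_eqF//.
by case/andP: alpha01.
Qed.

Lemma ml_gE_ge0 (t : R) : 0 <= t -> ml_g alpha t = g t.
Proof.
rewrite le_eqVlt => /predU1P[<-|]; last exact: ml_gE.
by rewrite ml_g0 ml_sum_le0.
Qed.

Lemma measurable_relaxation : measurable_fun [set: R] g.
Proof. exact: measurable_ml_sum. Qed.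

Lemma tail_mass_relaxation (t : R) : 0 < t -> tail_mass g t = ml_f alpha t.
Proof.
move=> t0; rewrite ml_fE// /tail_mass /Rintegral integral_ml_sum_tail//.
Qed.

(** The initial time cuts the memory at r = t; beyond it w has the constant value k, so the
    missing part of the average is k times the tail f(t) of g. *)
Lemma memory_integral (w : R -> R) (k t : R) : bounded_measurable w -> (forall r, 0 <= w r) -> 0 < t ->
  (forall r, t <= r -> w r = k) ->
  \int[mu]_(s in `[0, t]) (ml_g alpha (t - s) * w (t - s)) = avg g w - k * ml_f alpha t.
Proof.
move=> bw w0 t0 wk.
have g0 := ml_sum_ge0 alpha01.
have mI (D : interval R) : measurable [set` D] by exact: measurable_itv.
pose I := \1_(`]t, +oo[) : R -> R.
have bI : bounded_measurable I by exact: bounded_measurable_indic.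
have EI : avg g I = ml_f alpha t.
  rewrite -tail_mass_relaxation// /tail_mass -Rintegral_itv_obnd_cbnd; last first.
    apply: integrableS (integrable_g g0 measurable_relaxation (integral_ml_sum alpha01)) => //.
  rewrite [RHS]Rintegral_mkcond; apply: eq_Rintegral => r _.
  by rewrite patchE /I indicE; case: ifPn => _; rewrite ?mulr1 ?mulr0.
have gm := integral_ml_sum alpha01.
have mg := measurable_relaxation.
have bkI : bounded_measurable (fun r => k * I r) by exact: bounded_measurableZ.
rewrite -EI -avgZ// -avgB//.
have [mwI _] := bounded_measurableB bw bkI.
pose F r := g r * (w r - k * I r).
have FE r : F r = if r <= t then g r * w r else 0.
  rewrite /F /I indicE mem_setE in_itv/= andbT; case: leP => [_|tr] /=; first by rewrite mulr0 subr0.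
  by rewrite mulr1 wk ?ltW// subrr mulr0.
have F0 r : 0 <= F r by rewrite FE; case: ifP => // _; rewrite mulr_ge0.
have mF : measurable_fun [set: R] F by exact: measurable_funM.
rewrite /avg -/F /Rintegral -(ge0_integral_reflect t (f := fun r => (F r)%:E)); last 2 first.
- exact/measurable_EFinP.
- by move=> r; rewrite lee_fin.
congr fine; rewrite integral_mkcond; apply: eq_integral => s _.
rewrite patchE mem_setE in_itv/= FE lerBlDl lerDr.
case: (lerP 0 s) => [s0|s0] //=; case: (lerP s t) => [st|ts] /=.
- by rewrite ml_gE_ge0 ?subr_ge0.
- by rewrite ml_sum_le0 ?mul0r// subr_le0 ltW.
Qed.

Variables (K : R -> R) (h0 uT : R) (u0 : R -> R) (u : R -> R -> R) (xs : R -> R).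
Hypothesis K_int : mu.-integrable [set: R] (EFin \o K).
Hypothesis K_ge0 : forall x, 0 <= K x.
Hypothesis K_sym : forall x, K x = K (- x).
Hypothesis u_mild : mild_solution alpha K h0 uT u0 u.
Hypothesis xs_front : threshold_location uT u xs.
Local Notation P := (tail_integral K).

(** Freezing the front before time 0 turns the mild equation into a delay equation
    over the whole past. *)
Definition past_extension (s : R) : R := xs (Num.max s 0).
Local Notation a := past_extension.

Lemma continuous_past_extension : continuous a.
Proof.
move=> t; have [/subspace_continuousP cxs _] := xs_front.
have m0 (s : R) : 0 <= Num.max s 0 by rewrite le_max lexx orbT.
have mA (s : R) : `[0, +oo[%classic (Num.max s 0) by rewrite /= in_itv/= m0.
apply: cvg_trans (cxs _ (mA t)).
move=> B; rewrite /= !nbhs_simpl/= /within/= => HB.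
have cm : continuous (fun s : R => Num.max s 0).
  by move=> s; apply: continuous_max; [exact: cvg_id|exact: cvg_cst].
have /= := cm t _ HB; rewrite !nbhs_simpl/=; apply: filterS => s /=.
by apply; exact: mA.
Qed.

Lemma past_extension_le0 (s : R) : s <= 0 -> a s = a 0.
Proof. by move=> s0; rewrite /a maxxx (max_idPr s0). Qed.

Lemma past_extensionE (t : R) : 0 <= t -> a t = xs t.
Proof. by move=> t0; rewrite /a (max_idPl t0). Qed.

Lemma mild_initial (x : R) : u 0 x = u0 x.
Proof.
have [_ /(_ 0 x (lexx 0)) ->] := u_mild.
by rewrite ml_f0// mul1r set_itv1 Rintegral_set1 addr0.
Qed.

Lemma mild_delayed (t x : R) : 0 < t ->
  u t x = delayed g P a t x + ml_f alpha t * (u0 x - P (x - a 0)).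
Proof.
move=> t0; have [_ /(_ t x (ltW t0)) ->] := u_mild.
have bw : bounded_measurable (fun r => P (x - a (t - r))).
  apply: (bounded_measurable_history (tail_integral_ni K_int K_ge0) (tail_integral_ge0 K_ge0)
    (tail_integralN K_int K_ge0 K_sym)).
  exact: continuous_past_extension.
rewrite [X in _ + X](_ : _ = \int[mu]_(s in `[0, t])
  (ml_g alpha (t - s) * P (x - a (t - (t - s))))); last first.
  apply: eq_Rintegral => s; rewrite mem_setE in_itv/= => /andP[s0 st].
  congr (_ * _); rewrite subKr past_extensionE//.
  have [xl _ xr] := xs_front.2 s s0.
  exact: heaviside_convolution.
rewrite (memory_integral (w := fun r => P (x - a (t - r))) (k := P (x - a 0)))//.
- by rewrite /delayed; ring.
- by move=> r; exact: tail_integral_ge0.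
- by move=> r tr; rewrite past_extension_le0// subr_le0.
Qed.

End mild_formulation.

Lemma continuous_relaxation (R : realType) (alpha r : R) : 0 < alpha < 1 -> 0 < r ->
  {for r, continuous (ml_sum alpha alpha)}.
Proof.
move=> /andP[alpha0 _] r0; rewrite /prop_for /continuous_at -ml_gE//.
apply: cvg_trans (continuous_ml_g alpha0 r0); apply: near_eq_cvg.
by near=> s; rewrite ml_gE//; near: s; exact: lt_nbhsr.
Unshelve. all: by end_near. Qed.

Lemma avg_relaxation (R : realType) (alpha : R) (w : R -> R) : 0 < alpha ->
  \int[@lebesgue_measure R]_(r in `]0, +oo[) (ml_g alpha r * w r) = avg (ml_sum alpha alpha) w.
Proof.
move=> alpha0; rewrite /avg Rintegral_mkcond; apply: eq_Rintegral => r _.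
rewrite patchE mem_setE in_itv/= andbT; case: ltP => [r0|r0]; first by rewrite ml_gE.
by rewrite ml_sum_le0// mul0r.
Qed.

(** * Convergence to the travelling wave *)

Lemma lt0_derive_decreasing (R : realType) (v : R -> R) : (forall x : R, derivable v x 1) ->
  (forall x, (v^`())%classic x < 0) -> forall x y, x < y -> v y < v x.
Proof.
move=> dv dv0 x y xy.
apply: (@ltr0_derive1_lt_cc _ v x y) => //.
- apply: continuous_subspaceT => z.
  by apply: differentiable_continuous; exact/derivable1_diffP.
- by rewrite in_itv/= lexx ltW.
- by rewrite in_itv/= lexx ltW.
Qed.

Lemma decreasing_between_limits (R : realType) (v : R -> R) (k : R) : (forall x y, x < y -> v y < v x) ->
  v x @[x --> -oo] --> k -> v x @[x --> +oo] --> (0 : R) -> forall x, 0 <= v x <= k.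
Proof.
move=> vdec vk v0 x; apply/andP; split.
  apply: (cvgr_to_le v0); near=> y; apply/ltW/vdec; near: y.
  exact/nbhs_pinfty_gt/num_real.
apply: (cvgr_to_ge vk); near=> y; apply/ltW/vdec; near: y.
exact/nbhs_ninfty_lt/num_real.
Unshelve. all: by end_near. Qed.

Theorem theorem2p5 (R : realType) (alpha : R) (halpha : 0 < alpha < 1)
  (K : R -> R)
  (hKint : (@lebesgue_measure R).-integrable [set: R] (EFin \o K))
  (hKbnd : exists M : R, forall x, `|K x| <= M)
  (hKcont : continuous K)
  (hKge0 : forall x, 0 <= K x)
  (hK0 : 0 < K 0)
  (hKsym : forall x, K x = K (- x))
  (kappa : R) (hkappa : kappa = \int[@lebesgue_measure R]_y K y)
  (h0 : R) (hh0 : 0 <= h0 <= 1)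
  (uT : R) (huT : 0 < uT < kappa)
  (u0 : R -> R)
  (hu0der : forall x : R, derivable u0 x 1)
  (hu0C1 : continuous (u0^`())%classic)
  (hu0decr : forall x, (u0^`())%classic x < 0)
  (hu00 : u0 0 = uT)
  (hu0ninfty : u0 x @[x --> -oo] --> kappa)
  (hu0pinfty : u0 x @[x --> +oo] --> (0 : R))
  (u : R -> R -> R) (hu : front_solution alpha K h0 uT u0 u)
  (xs : R -> R) (hxs : threshold_location uT u xs) :
  exists cs : R,
    unique (fun c : R => uT = \int[@lebesgue_measure R]_(r in `]0, +oo[)
                                (ml_g alpha r * tail_integral K (c * r))) cs /\
    ereal_sup (range (fun z : R =>
        `|u t (xs t + z) - front_profile alpha K z cs|%:E)) @[t --> +oo]
      --> (0 : \bar R)%E.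
Proof.
have alpha0 : 0 < alpha by case/andP: halpha.
have [uT0 uTk] := andP huT.
have kap0 : 0 < kappa by exact: lt_trans uTk.
set g := ml_sum alpha alpha; set P := tail_integral K.
have g_ge0 : forall r, 0 <= g r by exact: ml_sum_ge0.
have g_le0 : forall r, r <= 0 -> g r = 0 by move=> r; exact: ml_sum_le0.
have mg : measurable_fun [set: R] g by exact: measurable_relaxation.
have g_mass := integral_ml_sum halpha.
have g_cont := continuous_relaxation halpha.
have g_lb := ml_sum_lb halpha.
have P_ni := tail_integral_ni hKint hKge0.
have P_ge0 := tail_integral_ge0 hKge0.
have P_sym x : P (- x) = kappa - P x by rewrite hkappa; exact: tail_integralN.
have P_le x : P x <= kappa by rewrite hkappa; exact: tail_integral_le.
have [Lam Lam0 KLam] : exists2 Lam, 0 < Lam & forall z, K z <= Lam.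
  have [M KM] := hKbnd; exists (Num.max M 1) => [|z]; first by rewrite lt_max ltr01 orbT.
  by rewrite le_max (le_trans (ler_norm _) (KM z)).
have P_lip x y : x <= y -> P x - P y <= Lam * (y - x) by exact: tail_integral_lip.
have P_cvg0 := tail_integral_cvg0 hKint hKge0.
have k00 : 0 < K 0 / 2 by rewrite divr_gt0.
have [rho rho0 Krho] : exists2 rho, 0 < rho & forall z, `|z| <= rho -> K 0 / 2 <= K z.
  have /cvgrPdist_le/(_ _ k00)[/= d d0 Hd] := hKcont 0.
  exists (d / 2) => [|z zd]; first by rewrite divr_gt0.
  have : `|K 0 - K z| <= K 0 / 2.
    by apply: Hd; rewrite /= sub0r normrN (le_lt_trans zd)// gtr_pMr// invf_lt1// ltr1n.
  by rewrite ler_norml => /andP[_]; lra.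
have P_strict x y : - rho <= x -> x <= y -> y <= rho -> K 0 / 2 * (y - x) <= P x - P y.
  exact: tail_integral_strict.
have u0_dec := lt0_derive_decreasing hu0der hu0decr.
have u0_bounds := decreasing_between_limits u0_dec hu0ninfty hu0pinfty.
have [u_mild _] := hu.
set a := past_extension xs.
have ca : continuous a by exact: continuous_past_extension hxs.
have a_le0 : forall s, s <= 0 -> a s = a 0 by exact: past_extension_le0.
have a0 : a 0 = 0.
  have [_ xl xr] := hxs.2 0 (lexx 0).
  move: xl; rewrite (mild_initial halpha u_mild)// -hu00 /a past_extensionE// => E.
  by have [/u0_dec|/u0_dec|//] := ltgtP (xs 0) 0; rewrite E ltxx.
have uE t x : 0 < t -> u t x = delayed g P a t x + ml_f alpha t * (u0 x - P (x - a 0)).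
  by move=> t0; exact: (mild_delayed halpha hKint hKge0 hKsym u_mild hxs).
have f0 t : 0 < t -> 0 < ml_f alpha t by move=> t0; exact: ml_f_gt0 (ltW t0).
have defect t x : 0 < t -> `|u t x - delayed g P a t x| <= kappa * ml_f alpha t.
  move=> t0; rewrite uE// addrAC subrr add0r normrM (gtr0_norm (f0 t t0)) mulrC.
  rewrite ler_pM2r ?f0//.
  have /andP[h1 h2] := u0_bounds x; have h3 := P_le (x - a 0); have h4 := P_ge0 (x - a 0).
  by rewrite ler_norml; apply/andP; split; rewrite -/P in h4 *; move: h1 h2 h3 h4; lra.
have decay e : 0 < e -> exists2 T, 0 < T & forall t, T <= t -> kappa * ml_f alpha t <= e.
  move=> e0; have ek : 0 < e / kappa by rewrite divr_gt0.
  have [T [_ HT]] := @cvgr_le R _ _ _ _ _ (ml_f_cvg0 halpha) _ ek.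
  exists (Num.max T 0 + 1) => [|t Tt]; first by rewrite ltr_wpDl// le_max lexx orbT.
  rewrite mulrC -ler_pdivlMr//; apply: HT.
  by apply: lt_le_trans Tt; rewrite ltr_pwDr// le_max lexx.
have u_thr t : 0 < t -> u t (a t) = uT.
  by move=> t0; rewrite /a past_extensionE ?ltW//; have [_ ->] := hxs.2 t (ltW t0).
have F : asymptotic_front g P a uT.
  split => // e e0; have [T T0 HT] := decay e e0.
  exists T => t Tt; rewrite distrC -(u_thr t) ?(lt_le_trans T0)//.
  by rewrite (le_trans (defect _ _ _)) ?(lt_le_trans T0)// HT.
have half : uT = kappa / 2 -> forall t, a t = a 0.
  move=> uT2; have := half_level_front g_ge0 g_le0 mg g_mass P_ni P_ge0 P_sym ca a_le0 u0_dec.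
  rewrite -uT2 a0 hu00; apply => // t t0; rewrite tail_mass_relaxation// ?f0//.
  by have := uE t (a t) t0; rewrite a0 u_thr.
have [w W] := front_level_width g_ge0 g_le0 mg g_mass g_cont g_lb kap0 P_ni P_ge0 P_sym P_cvg0
  rho0 k00 P_strict F uT0 uTk half.
have [cs [cs_level cs_unique]] := wave_speed g_ge0 g_le0 mg g_mass g_lb kap0 P_ni P_ge0 P_sym
  Lam0 P_lip P_cvg0 rho0 k00 P_strict uT0 uTk.
exists cs; split.
  split=> [|c]; first by rewrite avg_relaxation.
  by rewrite avg_relaxation// => cE; exact: cs_unique.
have inc r e : 0 < r -> 0 < e -> exists T, forall t, T <= t -> `|a t - a (t - r) - cs * r| <= e.
  exact: (increment_cvg g_ge0 g_le0 mg g_mass g_cont g_lb kap0 P_ni P_ge0 P_sym Lam0 P_lip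
    rho0 k00 P_strict F W cs_level).
have prof := profile_cvg g_ge0 g_le0 mg g_mass kap0 P_ni P_ge0 P_sym Lam0 P_lip ca inc.
have sup_ge0 t : (0 <= ereal_sup (range (fun z : R =>
    `|u t (xs t + z) - front_profile alpha K z cs|%:E)))%E.
  by apply: ereal_sup_ge; exists (`|u t (xs t + 0) - front_profile alpha K 0 cs|%:E)%E => //; exists 0.
have sup_le e : 0 < e -> exists T : R, forall t, T <= t -> (ereal_sup (range (fun z : R =>
    `|u t (xs t + z) - front_profile alpha K z cs|%:E)) <= e%:E)%E.
  move=> e0; have e2 : 0 < e / 2 by rewrite divr_gt0.
  have [T1 T10 H1] := decay _ e2; have [T2 H2] := prof _ e2.
  exists (Num.max T1 T2) => t; rewrite ge_max => /andP[T1t T2t].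
  have t0 : 0 < t by exact: lt_le_trans T1t.
  apply: ge_ereal_sup => _ [z _ <-]; rewrite lee_fin.
  rewrite /front_profile avg_relaxation// -/g -/P.
  rewrite -(past_extensionE xs (ltW t0)) -/a.
  rewrite -(subrK (delayed g P a t (a t + z)) (u t _)) -addrA (le_trans (ler_normD _ _))//.
  rewrite [leRHS](splitr e) lerD ?H2// (le_trans (defect _ _ t0))//.
  exact: H1.
apply/fine_cvgP; split.
  have [T HT] := sup_le 1 ltr01; exists T; split; first exact: num_real.
  move=> t Tt; rewrite fin_numE.
  have h1 := sup_ge0 t; have h2 := HT t (ltW Tt).
  by rewrite -ltey -ltNye (lt_le_trans _ h1) ?ltNy0//= (le_lt_trans h2) ?ltry.
apply/cvgrPdist_le => e e0; have [T HT] := sup_le e e0; exists T; split; first exact: num_real.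
move=> t Tt; rewrite sub0r normrN.
have h1 := sup_ge0 t; have h2 := HT t (ltW Tt).
rewrite ger0_norm ?fine_ge0//= -lee_fin fineK//.
by rewrite fin_numE -ltey -ltNye (lt_le_trans _ h1) ?ltNy0//= (le_lt_trans h2) ?ltry.
Unshelve. all: by end_near. Qed.
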